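(* Let $k$ be a field of characteristic $0$ and let $\mathfrak g$ be a (non-shifted) graded Lie bialgebra over $k$. Let $d$ and $B$ be the differential and the BV operator on the cochain complex $C^\bullet(\mathfrak g)=C^\bullet(\mathfrak g,k)$. If $\Delta=[B,d]=Bd+dB$ acts semi-simply on $\mathfrak g^*$, then the embedding $\operatorname{Ker}\Delta\hookrightarrow C^\bullet(\mathfrak g)$ is a quasi-isomorphism of differential Gerstenhaber algebras.
   Context: Gradings are by $\mathbb Z$; $(U[m])^i=U^{i+m}$; $U^*$ is the graded dual. A graded Lie bialgebra is a graded Lie algebra $\mathfrak g$, with each $\mathfrak g^i$ finite-dimensional, and a degree $0$ cobracket $\phi\colon\mathfrak g\to\mathfrak g\otimes\mathfrak g$ such that $\phi^*$ is a graded Lie bracket on $\mathfrak g^*$ and $\phi([x,y])=\mathrm{ad}_x\phi(y)-(-1)^{\bar x\bar y}\mathrm{ad}_y\phi(x)$. $C^\bullet(\mathfrak g)=S^\bullet(\mathfrak g^*[-1])$ is the Chevalley–Eilenberg cochain algebra with differential $d$ of degree $+1$ (for infinite-dimensional $\mathfrak g$, $S^m(\mathfrak g^*[-1])$ means the graded dual of $S^m(\mathfrak g[1])$). It is a differential Gerstenhaber algebra with the bracket given by $\langle x[-1],y[-1]\rangle=\phi^*(x,y)[-1]$ on generators and extended by the derivation rule. The BV operator $B$ is the Chevalley–Eilenberg chain differential of the Lie algebra $(\mathfrak g^*,\phi^* )$, under the identification of $S^\bullet(\mathfrak g^*[-1])$ with $C_\bullet(\mathfrak g^*,k)$. It is a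 differential operator of order $\le 2$ and degree $-1$ with $B^2=0$, $B(1)=0$, $B|_{\mathfrak g^*[-1]}=0$, normalized so that $\langle x,y\rangle=(-1)^{|x|}(B(xy)-(Bx)y-(-1)^{|x|}xBy)$. The operator $\Delta$ has degree $0$ and preserves the subspace $\mathfrak g^*[-1]$ of generators; ''acts semi-simply on $\mathfrak g^*$'' means that each finite-dimensional graded component of $\mathfrak g^*$ is a semisimple $k[\Delta]$-module. A differential Gerstenhaber algebra is a graded-commutative dg algebra $(A,d)$, $\deg d=+1$, with a bracket of degree $-1$ making $A[1]$ a graded Lie algebra, with $\langle x,yz\rangle=\langle x,y\rangle z+(-1)^{(|x|-1)|y|}y\langle x,z\rangle$ and $d\langle x,y\rangle=\langle dx,y\rangle+(-1)^{|x|+1}\langle x,dy\rangle$. $\operatorname{Ker}\Delta$ carries the restricted product, differential and bracket. *)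

(* Defs.v *)
From HB Require Import structures.
From mathcomp Require Import all_boot all_order all_algebra.
From mathcomp Require Import boolp functions.
From mathcomp Require Import zify ring.
Set Implicit Arguments.
Unset Strict Implicit.
Unset Printing Implicit Defensive.
Import GRing.Theory.
Local Open Scope ring_scope.

(* Each [vectType] is finite-dimensional, so a [gvect] is a Z-graded vector
   space with finite-dimensional components. *)
Definition gvect (k : fieldType) := int -> vectType k.
Identity Coercion gvect_component : gvect >-> Funclass.

Section GradedSpaces.
Variable k : fieldType.
Implicit Type g : gvect k.

Definition hom_elt g := {i : int & g i}.
Definition homog g i (x : g i) : hom_elt g := Tagged (fun i => g i) x.

Definition gcast g (i j : int) (e : i = j) (x : g i) : g j :=
  ecast n (g n) e x.

(* [br] is a degree 0 bilinear bracket with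
     [x, y] = - (-1)^(|x||y|) [y, x],
     [x, [y, z]] = [[x, y], z] + (-1)^(|x||y|) [y, [x, z]]. *)
Record graded_lie g (br : forall i j, g i -> g j -> g (i + j)) : Prop :=
  GradedLie {
    glie_linearl : forall i j (c : k) (x x' : g i) (y : g j),
      br i j (c *: x + x') y = c *: br i j x y + br i j x' y;
    glie_linearr : forall i j (c : k) (x : g i) (y y' : g j),
      br i j x (c *: y + y') = c *: br i j x y + br i j x y';
    glie_anti : forall i j (x : g i) (y : g j),
      br i j x y = - ((-1) ^ (i * j) *: gcast (addrC j i) (br j i y x));
    glie_jacobi : forall i j l (x : g i) (y : g j) (z : g l),
      br i (j + l) x (br j l y z) =
        gcast (esym (addrA i j l)) (br (i + j) l (br i j x y) z)
        + (-1) ^ (i * j) *: gcast (addrCA j i l) (br j (i + l) y (br i l x z))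
  }.

(* The graded dual: (g^* )^i = (g^(-i))^*. *)
Definition gdual g : gvect k := fun i => 'Hom(g (- i), k^o).

(* A homogeneous functional, evaluated on homogeneous elements of any degree. *)
Definition gdual_eval g i (xi : gdual g i) (x : hom_elt g) : k :=
  untag (0 : k) (fun v : g (- i) => xi v : k) x.

End GradedSpaces.
Arguments homog {k} g {i} x.

Record gLie (k : fieldType) := GLie {
  gLie_sort :> gvect k;
  gLie_br : forall i j, gLie_sort i -> gLie_sort j -> gLie_sort (i + j);
  gLieP : graded_lie gLie_br
}.

Definition brH (k : fieldType) (g : gLie k) (x y : hom_elt g) : hom_elt g :=
  homog g (gLie_br (tagged x) (tagged y)).

Section TensorSquare.
Variables (k : fieldType) (g : gvect k).

Definition gbilin (b : hom_elt g -> hom_elt g -> k) : Prop :=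
  (forall i (c : k) (x y : g i) z,
     b (homog g (c *: x + y)) z = c * b (homog g x) z + b (homog g y) z) /\
  (forall i (c : k) z (x y : g i),
     b z (homog g (c *: x + y)) = c * b z (homog g x) + b z (homog g y)).

(* Over a field a tensor is determined by its pairings with all bilinear forms,
   so [g (x) g] is realised as the space of those functionals on bilinear forms
   that are sums of evaluations at pairs of homogeneous elements; by convention
   they vanish on functions that are not bilinear. *)
Definition tensor_of (s : seq (hom_elt g * hom_elt g)) :
    (hom_elt g -> hom_elt g -> k) -> k^o :=
  fun b => if `[< gbilin b >] then \sum_(p <- s) b p.1 p.2 else 0.

Definition is_tensor : {pred (hom_elt g -> hom_elt g -> k) -> k^o} :=
  fun T => `[< exists s, T = tensor_of s >].

Record gtensor := GTensor {
  tpair :> (hom_elt g -> hom_elt g -> k) -> k^o;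
  _ : tpair \in is_tensor
}.

HB.instance Definition _ := [isSub for tpair].
HB.instance Definition _ := [Choice of gtensor by <:].

Fact is_tensor_submod_closed : submod_closed is_tensor.
Proof.
split; first by apply/asboolP; exists [::]; apply/funext => b;
  rewrite /tensor_of big_nil if_same.
move=> c T U /asboolP[s ->] /asboolP[t ->]; apply/asboolP.
exists ([seq (homog g (c *: tagged p.1), p.2) | p : hom_elt g * hom_elt g <- s] ++ t).
apply/funext => b; rewrite /tensor_of.
have -> : forall (F G : (hom_elt g -> hom_elt g -> k) -> k^o),
  (c *: F + G) b = c * F b + G b by [].
case: asboolP => [[bl br]|_]; last by rewrite mulr0 addr0.
rewrite big_cat big_map mulr_sumr; congr (_ + _); apply: eq_bigr => -[[i x] y] _ /=.
have b0 : b (homog g (0 : g i)) y = 0.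
  by have := bl i (-1) 0 0 y; rewrite scaler0 addr0 mulN1r addNr.
by rewrite -[c *: x]addr0 bl b0 addr0.
Qed.

HB.instance Definition _ :=
  GRing.isSubmodClosed.Build k _ is_tensor is_tensor_submod_closed.
HB.instance Definition _ := [SubChoice_isSubLmodule of gtensor by <:].

Definition tensor_deg (n : int) (T : gtensor) : Prop :=
  exists s, all (fun p => tag p.1 + tag p.2 == n) s /\
            (T : _ -> k^o) = tensor_of s.

End TensorSquare.

Section AdjointAction.
Variables (k : fieldType) (g : gLie k).

(* ad_x (a (x) b) = [x, a] (x) b + (-1)^(|x||a|) a (x) [x, b]. *)
Definition tensor_ad_fun (x : hom_elt g) (T : gtensor g) :
    (hom_elt g -> hom_elt g -> k) -> k^o :=
  fun b => if `[< gbilin b >] then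
    T (fun u v => b (brH x u) v + (-1) ^ (tag x * tag u) * b u (brH x v))
  else 0.

Fact brH_linearr x i (c : k) (u v : g i) :
  brH x (homog g (c *: u + v)) =
    homog g (c *: gLie_br (tagged x) u + gLie_br (tagged x) v).
Proof. by congr existT; rewrite (glie_linearr (gLieP g)). Qed.

Fact tensor_ad_subproof x T : tensor_ad_fun x T \in @is_tensor k g.
Proof.
case: T => T' TP; have /asboolP[s Ts] := TP; apply/asboolP.
exists ([seq (brH x p.1, p.2) | p : hom_elt g * hom_elt g <- s] ++
  [seq (homog g ((-1) ^ (tag x * tag p.1) *: tagged p.1), brH x p.2)
     | p : hom_elt g * hom_elt g <- s]).
apply/funext => b; rewrite /tensor_ad_fun /= Ts /tensor_of.
case: asboolP => [bP|] //; have [bl br] := bP.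
rewrite asboolT; last first.
  by split=> [i c u v z|i c z u v]; rewrite brH_linearr !(bl, br) /=; ring.
rewrite big_cat !big_map /= -big_split; apply: eq_bigr => -[[i u] v] _ /=.
congr (_ + _); have b0 : b (homog g (0 : g i)) (brH x v) = 0.
  by have := bl i (-1) 0 0 (brH x v); rewrite scaler0 addr0 mulN1r addNr.
by rewrite -[_ *: u]addr0 bl b0 addr0.
Qed.

Definition tensor_ad x T : gtensor g := GTensor (tensor_ad_subproof x T).

End AdjointAction.

(* The bracket dual to a cobracket; no sign enters the pairing:
     < phi^*(xi, eta), x > = (xi (x) eta)(phi x). *)
Definition dual_br (k : fieldType) (g : gvect k)
    (phi : forall n, g n -> gtensor g) (i j : int)
    (xi : gdual g i) (eta : gdual g j) : gdual g (i + j) :=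
  linfun (fun x : g (- (i + j)) =>
    phi _ x (fun u v => gdual_eval xi u * gdual_eval eta v)).

Record gLieBialg (k : fieldType) := GLieBialg {
  gLieBialg_lie :> gLie k;
  cobr : forall n, {linear gLieBialg_lie n -> gtensor gLieBialg_lie};
  cobr_deg : forall n x, tensor_deg n (cobr n x);
  cobr_lie : graded_lie (dual_br cobr);
  cobr_cocycle : forall (i j : int)
      (x : gLieBialg_lie i) (y : gLieBialg_lie j),
    cobr (i + j) (gLie_br x y) =
      tensor_ad (homog gLieBialg_lie x) (cobr j y)
      - (-1) ^ (i * j) *: tensor_ad (homog gLieBialg_lie y) (cobr i x)
}.

(* The graded pieces [dg_comp n] sit in an ambient vector space that plays no
   role of its own: the laws below only concern homogeneous elements.
   [dg_bra p x y] is the bracket of [x] and [y] for [x] of degree [p]. *)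
Record dgData (k : fieldType) := DGData {
  dg_sort :> lmodType k;
  dg_comp : int -> dg_sort -> Prop;
  dg_one : dg_sort;
  dg_mul : dg_sort -> dg_sort -> dg_sort;
  dg_d : dg_sort -> dg_sort;
  dg_bra : int -> dg_sort -> dg_sort -> dg_sort
}.

Section DiffGerstenhaber.
Variables (k : fieldType) (A : dgData k).
Implicit Types (p q r : int) (c : k) (x y z : A).
Local Notation comp := (@dg_comp k A).
Local Notation one := (@dg_one k A).
Local Notation "x ** y" := (@dg_mul k A x y) (at level 40, left associativity).
Local Notation d := (@dg_d k A).
Local Notation bra := (@dg_bra k A).

Record graded_module : Prop := GradedModule {
  gm_zero : forall p, comp p 0;
  gm_lin : forall p c x y, comp p x -> comp p y -> comp p (c *: x + y)
}.

Record graded_comm_alg : Prop := GradedCommAlg {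
  ga_one : comp 0 one;
  ga_mul : forall p q x y, comp p x -> comp q y -> comp (p + q) (x ** y);
  ga_linearl : forall p q c x x' y, comp p x -> comp p x' -> comp q y ->
    (c *: x + x') ** y = c *: (x ** y) + x' ** y;
  ga_linearr : forall p q c x y y', comp p x -> comp q y -> comp q y' ->
    x ** (c *: y + y') = c *: (x ** y) + x ** y';
  ga_mul1 : forall p x, comp p x -> one ** x = x;
  ga_assoc : forall p q r x y z, comp p x -> comp q y -> comp r z ->
    x ** (y ** z) = (x ** y) ** z;
  ga_comm : forall p q x y, comp p x -> comp q y ->
    x ** y = (-1) ^ (p * q) *: (y ** x)
}.

Record differential : Prop := Differential {
  gd_deg : forall p x, comp p x -> comp (p + 1) (d x);
  gd_linear : forall p c x x', comp p x -> comp p x' ->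
    d (c *: x + x') = c *: d x + d x';
  gd_square : forall p x, comp p x -> d (d x) = 0;
  gd_leibniz : forall p q x y, comp p x -> comp q y ->
    d (x ** y) = d x ** y + (-1) ^ p *: (x ** d y)
}.

(* An element of degree [p] has degree [p - 1] in A[1]. *)
Record shifted_lie : Prop := ShiftedLie {
  sl_deg : forall p q x y, comp p x -> comp q y ->
    comp (p + q - 1) (bra p x y);
  sl_linearl : forall p q c x x' y, comp p x -> comp p x' -> comp q y ->
    bra p (c *: x + x') y = c *: bra p x y + bra p x' y;
  sl_linearr : forall p q c x y y', comp p x -> comp q y -> comp q y' ->
    bra p x (c *: y + y') = c *: bra p x y + bra p x y';
  sl_anti : forall p q x y, comp p x -> comp q y ->
    bra p x y = - ((-1) ^ ((p - 1) * (q - 1)) *: bra q y x);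
  sl_jacobi : forall p q r x y z, comp p x -> comp q y -> comp r z ->
    bra p x (bra q y z) = bra (p + q - 1) (bra p x y) z
      + (-1) ^ ((p - 1) * (q - 1)) *: bra q y (bra p x z)
}.

Record diff_gerstenhaber : Prop := DiffGerstenhaber {
  dG_module : graded_module;
  dG_alg : graded_comm_alg;
  dG_diff : differential;
  dG_lie : shifted_lie;
  dG_poisson : forall p q r x y z, comp p x -> comp q y -> comp r z ->
    bra p x (y ** z) =
      bra p x y ** z + (-1) ^ ((p - 1) * q) *: (y ** bra p x z);
  dG_d_bra : forall p q x y, comp p x -> comp q y ->
    d (bra p x y) = bra (p + 1) (d x) y + (-1) ^ (p + 1) *: bra p x (d y)
}.

Definition cocycle p x : Prop := comp p x /\ d x = 0.

(* Equality of the classes of two cocycles in H^p. *)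
Definition cohomologous p x y : Prop := exists2 z, comp (p - 1) z & x - y = d z.

End DiffGerstenhaber.

Section Morphisms.
Variables (k : fieldType) (A A' : dgData k) (f : A -> A').

Record dG_morphism : Prop := DGMorphism {
  dGm_comp : forall p x, dg_comp p x -> dg_comp p (f x);
  dGm_linear : forall p (c : k) (x y : A), dg_comp p x -> dg_comp p y ->
    f (c *: x + y) = c *: f x + f y;
  dGm_one : f (dg_one A) = dg_one A';
  dGm_mul : forall p q (x y : A), dg_comp p x -> dg_comp q y ->
    f (dg_mul x y) = dg_mul (f x) (f y);
  dGm_d : forall p (x : A), dg_comp p x -> f (dg_d x) = dg_d (f x);
  dGm_bra : forall p q (x y : A), dg_comp p x -> dg_comp q y ->
    f (dg_bra p x y) = dg_bra p (f x) (f y)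
}.

(* H^p(f) is injective and surjective for every p. *)
Definition cohomology_iso : Prop := forall p,
  (forall x y : A, cocycle p x -> cocycle p y ->
     cohomologous p (f x) (f y) -> cohomologous p x y) /\
  (forall y : A', cocycle p y ->
     exists2 x : A, cocycle p x & cohomologous p (f x) y).

Record dG_quasi_iso : Prop := DGQuasiIso {
  dGq_source : diff_gerstenhaber A;
  dGq_target : diff_gerstenhaber A';
  dGq_morphism : dG_morphism;
  dGq_cohomology : cohomology_iso
}.

End Morphisms.

Section CE.
Variables (k : fieldType) (g : gLieBialg k).

(* A functional on the symmetric powers S^m(g[1]), m >= 0, is a function of
   finite sequences of homogeneous elements of g. *)
Definition cochain := seq (hom_elt g) -> k^o.
HB.instance Definition _ := GRing.Lmodule.on cochain.
Implicit Types (F G : cochain) (s : seq (hom_elt g)).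

(* Degrees in g[1]. *)
Definition wt1 (x : hom_elt g) : int := tag x - 1.
Definition wt s : int := \sum_(x <- s) wt1 x.

(* The degree n part of the direct sum over m of the graded duals of
   S^m(g[1]): multilinear, graded symmetric functions, supported on sequences
   of total degree -n and of bounded length. *)
Record is_cochain (n : int) (F : cochain) : Prop := IsCochain {
  ce_linear : forall s t i (c : k) (x y : g i),
    F (s ++ homog g (c *: x + y) :: t) =
      c *: F (s ++ homog g x :: t) + F (s ++ homog g y :: t);
  ce_sym : forall s t (x y : hom_elt g),
    F (s ++ x :: y :: t) = (-1) ^ (wt1 x * wt1 y) *: F (s ++ y :: x :: t);
  ce_deg : forall s, wt s != - n -> F s = 0;
  ce_bounded : exists m : nat, forall s, (m < size s)%N -> F s = 0
}.

Definition ce_one : cochain := fun s => if s is [::] then 1 else 0.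

(* Exponent of the Koszul sign that sorts [s] into [mask m s] followed by the
   remaining elements. *)
Fixpoint unshuffle_exp (m : seq bool) s : int :=
  match m, s with
  | b :: m', x :: s' =>
      (if b then 0 else wt1 x * wt (mask m' s')) + unshuffle_exp m' s'
  | _, _ => 0
  end.

(* Dual to the unshuffle coproduct of S(g[1]). *)
Definition ce_mul F G : cochain := fun s =>
  \sum_(m : (size s).-tuple bool)
    (-1) ^ unshuffle_exp m s * F (mask m s) * G (mask (map negb m) s).

Definition entry s i : hom_elt g := nth (homog g (0 : g 0)) s i.
Definition remove (i : nat) s := take i s ++ drop i.+1 s.

(* Exponent of the Koszul sign that moves the i-th entry of [s] to the front. *)
Definition front_exp i s : int := wt1 (entry s i) * wt (take i s).

(* Precomposition with the coderivation of S(g[1]) extending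
     x y |-> - (-1)^|x| [x, y],
   where |x| is the degree of x in g; if g is concentrated in degree 0 this is
     (dF)(x_1, ..., x_n) =
       sum_(i < j) (-1)^(i + j) F ([x_i, x_j], x_1, ..., x_n)
   with x_i and x_j omitted from x_1, ..., x_n. *)
Definition ce_d F : cochain := fun s =>
  - \sum_(j < size s) \sum_(i < j)
      (-1) ^ (front_exp i s + front_exp j s
              + wt1 (entry s i) * wt1 (entry s j) + tag (entry s i))
      * F (brH (entry s i) (entry s j) :: remove i (remove j s)).

(* The Chevalley-Eilenberg chain differential of (g^*, phi^* ), written on the
   graded dual of S(g[1]) as precomposition with the derivation of S(g[1])
   extending
     x |-> - 1/2 sum (-1)^|x'| x' x''   for   phi(x) = sum x' (x) x''. *)
Definition ce_B F : cochain := fun s =>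
  - (2%:R^-1 * \sum_(i < size s)
      (-1) ^ front_exp i s
      * cobr g _ (tagged (entry s i))
          (fun u v => (-1) ^ tag u * F (u :: v :: remove i s))).

(* For F of degree p. *)
Definition ce_bra (p : int) F G : cochain :=
  (-1) ^ p *: (ce_B (ce_mul F G) - ce_mul (ce_B F) G
               - (-1) ^ p *: ce_mul F (ce_B G)).

Definition ce_Delta F : cochain := ce_B (ce_d F) + ce_d (ce_B F).

Definition CE : dgData k :=
  DGData is_cochain ce_one ce_mul ce_d ce_bra.

Definition Ker_Delta : dgData k :=
  DGData (fun n F => is_cochain n F /\ ce_Delta F = 0)
    ce_one ce_mul ce_d ce_bra.

Definition Ker_Delta_incl : Ker_Delta -> CE := id.

(* The generator xi[-1] of C(g), for xi in g^*. *)
Definition ce_gen i (xi : gdual g i) : cochain :=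
  fun s => if s is [:: x] then gdual_eval xi x else 0.

(* The action of Delta on (g^* )^i through [ce_gen]. *)
Definition Delta_dual i : 'End(gdual g i) :=
  linfun (fun xi : gdual g i =>
    linfun (fun x : g (- i) => ce_Delta (ce_gen xi) [:: homog g x]) : gdual g i).

End CE.

(* V is a semisimple k[f]-module: every submodule has a complement. *)
Definition semisimple_end (k : fieldType) (V : vectType k) (f : 'End(V)) : Prop :=
  forall U : {vspace V}, (f @: U <= U)%VS ->
  exists W : {vspace V},
    [/\ (f @: W <= W)%VS, (U + W = fullv)%VS & (U :&: W = 0)%VS].

Section Generators.
Variables (k : fieldType) (g : gLieBialg k).
Implicit Types (F G : cochain g) (s : seq (hom_elt g)).

Lemma gdual_eval_homog i (xi : gdual g i) (x : g (- i)) :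
  gdual_eval xi (homog g x) = xi x.
Proof. by rewrite /gdual_eval (untagE _ _ (erefl : tag (homog g x) = - i)). Qed.

Lemma gdual_eval0 i (xi : gdual g i) (x : hom_elt g) :
  tag x != - i -> gdual_eval xi x = 0.
Proof. exact: untag_dflt. Qed.

Lemma gdual_eval_linear i (xi : gdual g i) j (c : k) (x y : g j) :
  gdual_eval xi (homog g (c *: x + y)) =
  c * gdual_eval xi (homog g x) + gdual_eval xi (homog g y).
Proof.
case: (eqVneq j (- i)) => [E|ne]; last first.
  by rewrite !gdual_eval0 // mulr0 addr0.
by move: x y; rewrite E => x y; rewrite !gdual_eval_homog linearP.
Qed.

Lemma gbilin_gdual i j (xi : gdual g i) (eta : gdual g j) :
  gbilin (fun u v => gdual_eval xi u * gdual_eval eta v).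
Proof. by split=> [l c x y z|l c z x y]; rewrite gdual_eval_linear; ring. Qed.

Lemma dual_brE i j (xi : gdual g i) (eta : gdual g j) (x : g (- (i + j))) :
  dual_br (cobr g) xi eta x =
  cobr g _ x (fun u v => gdual_eval xi u * gdual_eval eta v).
Proof.
pose f (x : g (- (i + j))) : k^o :=
  cobr g _ x (fun u v => gdual_eval xi u * gdual_eval eta v).
have fl : linear f by move=> c u v; rewrite /f linearP.
pose lf : {linear g (- (i + j)) -> k^o} :=
  HB.pack f (GRing.isLinear.Build _ _ _ _ _ fl).
exact: (lfunE lf).
Qed.

Lemma tensorP (T : gtensor g) : exists t, forall b, T b = tensor_of t b.
Proof. by case: T => T TP; have /asboolP[t Ts] := TP; exists t => b /=; rewrite Ts. Qed.

Lemma sum_tuple_cons n (f : seq bool -> k) :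
  \sum_(m : n.+1.-tuple bool) f m =
  \sum_(m : n.-tuple bool) f (true :: m) + \sum_(m : n.-tuple bool) f (false :: m).
Proof.
rewrite (reindex (fun p : bool * n.-tuple bool => cons_tuple p.1 p.2)) /=; last first.
  exists (fun t : n.+1.-tuple bool => (thead t, [tuple of behead t])) => [[b t] _|t _] /=.
    by congr (_, _); apply: val_inj.
  by rewrite [RHS]tuple_eta; apply: val_inj.
rewrite -(pair_bigA _ (fun b (m : n.-tuple bool) => f (b :: m))) /=.
by rewrite big_bool.
Qed.

Lemma sum_tuple0 (f : seq bool -> k) : \sum_(m : 0.-tuple bool) f m = f [::].
Proof. by rewrite (big_pred1 [tuple]) // => t; apply/esym/eqP; exact: tuple0. Qed.

Lemma ce_mul_gen2 i j (xi : gdual g i) (eta : gdual g j) u v :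
  ce_mul (ce_gen xi) (ce_gen eta) [:: u; v] =
  gdual_eval xi u * gdual_eval eta v
  + (-1) ^ (wt1 u * wt1 v) * (gdual_eval xi v * gdual_eval eta u).
Proof.
pose f m : k := (-1) ^ unshuffle_exp m [:: u; v] *
  ce_gen xi (mask m [:: u; v]) * ce_gen eta (mask [seq ~~ b | b <- m] [:: u; v]).
rewrite -[LHS]/(\sum_(m : 2.-tuple bool) f m) sum_tuple_cons.
rewrite (sum_tuple_cons 0 (fun m => f (true :: m))) (sum_tuple_cons 0 (fun m => f (false :: m))).
rewrite (sum_tuple0 (fun m => f [:: true, true & m])) (sum_tuple0 (fun m => f [:: true, false & m])).
rewrite (sum_tuple0 (fun m => f [:: false, true & m])) (sum_tuple0 (fun m => f [:: false, false & m])).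
rewrite /f /= /wt ?big_cons ?big_nil ?mulr0 ?addr0 ?add0r ?expr0z.
ring.
Qed.

Lemma ce_B_gen i (xi : gdual g i) s : ce_B (ce_gen xi) s = 0.
Proof.
rewrite /ce_B big1 ?mulr0 ?oppr0 // => l _.
have [t Tt] := tensorP (cobr g _ (tagged (entry s l))).
rewrite Tt /tensor_of; case: asboolP => _; last by rewrite mulr0.
by rewrite big1 ?mulr0 // => p _; rewrite /= mulr0.
Qed.

Lemma size_mask2 (m : seq bool) s : size m = size s ->
  (size (mask m s) + size (mask (map negb m) s) = size s)%N.
Proof.
elim: m s => [|[] m IH] [|x s] //= [e]; first by rewrite addSn IH.
by rewrite addnS IH.
Qed.

Lemma ce_mul_gen0 i j (xi : gdual g i) (eta : gdual g j) s :
  size s != 2%N -> ce_mul (ce_gen xi) (ce_gen eta) s = 0.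
Proof.
move=> ns; rewrite /ce_mul big1 // => m _.
have := size_mask2 (size_tuple m).
case: (mask m s) => [|x [|y t]] /=; rewrite ?mulr0 ?mul0r //.
case: (mask _ s) => [|z [|z' t']] /=; rewrite ?mulr0 ?mul0r //.
by move=> e; rewrite -e in ns.
Qed.

Lemma ce_mul0F F s : ce_mul (fun=> 0) F s = 0.
Proof. by rewrite /ce_mul big1 // => m _; rewrite mulr0 mul0r. Qed.

Lemma ce_mulF0 F s : ce_mul F (fun=> 0) s = 0.
Proof. by rewrite /ce_mul big1 // => m _; rewrite mulr0. Qed.

Lemma dual_br_cast i j (xi : gdual g i) (eta : gdual g j) m (e : i + j = m) (x : g (- m)) :
  (gcast e (dual_br (cobr g) xi eta) : gdual g m) x =
  cobr g _ x (fun u v => gdual_eval xi u * gdual_eval eta v).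
Proof. by move: x; case: m / e => x; rewrite dual_brE. Qed.

Lemma size_remove l s : (l < size s)%N -> (size (remove l s)).+1 = size s.
Proof. by move=> ls; rewrite /remove size_cat size_take size_drop ls; lia. Qed.

Lemma signzE (n : int) : (-1) ^ n = (-1) ^+ odd `|n|%N :> k.
Proof.
case: n => n; first by rewrite signr_odd.
by rewrite signr_odd NegzE -exprz_inv invrN1.
Qed.

Lemma odd_abszD1 (n : int) : odd `|(n + 1)%R|%N = ~~ odd `|n|%N.
Proof.
case: n => [n|[|n]] //; first by rewrite -PoszD absz_nat addn1.
have -> : Negz n.+1 + 1 = Negz n by rewrite !NegzE; lia.
by rewrite /= negbK.
Qed.

(* <xi[-1], eta[-1]> = phi^*(xi, eta)[-1]. *)
Lemma ce_bra_gen (h2 : (2%:R : k) != 0) i j (xi : gdual g i) (eta : gdual g j) :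
  ce_bra (i + 1) (ce_gen xi) (ce_gen eta) = ce_gen (dual_br (cobr g) xi eta).
Proof.
apply/funext => s; rewrite /ce_bra.
have -> : ce_B (ce_gen xi) = (fun=> 0) by apply/funext => t; exact: ce_B_gen.
have -> : ce_B (ce_gen eta) = (fun=> 0) by apply/funext => t; exact: ce_B_gen.
have -> : ce_mul (fun=> 0) (ce_gen eta) = 0 by apply/funext => t; exact: ce_mul0F.
have -> : ce_mul (ce_gen xi) (fun=> 0) = 0 by apply/funext => t; exact: ce_mulF0.
rewrite scaler0 !subr0.
have -> : forall a (F : cochain g), (a *: F) s = a * F s by [].
case: (eqVneq (size s) 1%N) => [|ns]; last first.
  rewrite /ce_B big1 ?mulr0 ?oppr0 ?mulr0; last first.
    move=> l _; have [t Tt] := tensorP (cobr g _ (tagged (entry s l))).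
    rewrite Tt /tensor_of; case: asboolP => _; last by rewrite mulr0.
    rewrite big1 ?mulr0 // => p _; rewrite ce_mul_gen0 ?mulr0 //=.
    by have := size_remove (ltn_ord l); move: ns (ltn_ord l); move/eqP; lia.
  by case: s ns => [|x [|y s]].
case: s => [|[n x] [|y s]] // _; rewrite /ce_B big_ord1 /=.
rewrite /front_exp /= /wt big_nil mulr0 expr0z mul1r /remove /=.
have [t [td Tt]] := cobr_deg x.
set T := cobr g n x in td Tt *.
set b := (fun u v : hom_elt g => _).
case: (eqVneq n (- (i + j))) => [E|ne]; last first.
  rewrite gdual_eval0 // [T b](_ : _ = 0) ?mulr0 ?oppr0 ?mulr0 // Tt /tensor_of.
  case: asboolP => // _; rewrite big_seq big1 // => -[u v] /(allP td)/= /eqP uv.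
  rewrite /b ce_mul_gen2; have nz : forall u v, tag u + tag v = n ->
     gdual_eval xi u * gdual_eval eta v = 0.
    move=> u' v' e; case: (eqVneq (tag u') (- i)) => [ei|ni]; last by rewrite gdual_eval0 // mul0r.
    case: (eqVneq (tag v') (- j)) => [ej|nj]; last by rewrite (gdual_eval0 _ nj) mulr0.
    by case/eqP: ne; rewrite -e ei ej opprD.
  by rewrite !nz ?mulr0 ?addr0 ?mulr0 // addrC.
have S1 : T (fun u v => gdual_eval xi u * gdual_eval eta v) =
  \sum_(p <- t) gdual_eval xi p.1 * gdual_eval eta p.2.
  by rewrite Tt /tensor_of asboolT //; exact: gbilin_gdual.
have S2 : T (fun u v => gdual_eval eta u * gdual_eval xi v) =
  \sum_(p <- t) gdual_eval eta p.1 * gdual_eval xi p.2.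
  by rewrite Tt /tensor_of asboolT //; exact: gbilin_gdual.
have S12 : T (fun u v => gdual_eval xi u * gdual_eval eta v) =
   - ((-1) ^ (i * j) * T (fun u v => gdual_eval eta u * gdual_eval xi v)).
  rewrite {S1 S2 Tt td t b}/T; move: x; rewrite E => x.
  rewrite -dual_brE (glie_anti (cobr_lie g)) opp_lfunE scale_lfunE; congr (- (_ *: _)).
  exact: dual_br_cast.
have bb : gbilin b.
  by split=> [l c y y' z|l c z y y']; rewrite /b !ce_mul_gen2 !gdual_eval_linear /=; ring.
have -> : gdual_eval (dual_br (cobr g) xi eta) (existT _ n x) =
  T (fun u v => gdual_eval xi u * gdual_eval eta v).
  rewrite {S1 S2 S12 Tt td bb b t}/T; move: x; rewrite E => x.
  by rewrite -dual_brE; exact: gdual_eval_homog.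
rewrite {1}Tt /tensor_of asboolT //.
have -> : \sum_(p <- t) b p.1 p.2 =
  (-1) ^ i * (\sum_(p <- t) gdual_eval xi p.1 * gdual_eval eta p.2)
  + (-1) ^ j * (-1) ^ ((i + 1) * (j + 1)) * (\sum_(p <- t) gdual_eval eta p.1 * gdual_eval xi p.2).
  rewrite !mulr_sumr -big_split /=; apply: eq_bigr => -[u v] _ /=.
  rewrite /b ce_mul_gen2 mulrDr; congr (_ + _).
    case: (eqVneq (tag u) (- i)) => [->|ni]; last by rewrite gdual_eval0 // !mul0r !mulr0.
    by rewrite !signzE abszN.
  case: (eqVneq (tag u) (- j)) => [eu|ni]; last by rewrite (gdual_eval0 _ ni) !(mul0r, mulr0).
  case: (eqVneq (tag v) (- i)) => [ev|ni]; last by rewrite (gdual_eval0 _ ni) !(mul0r, mulr0).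
  rewrite /wt1 eu ev -!opprD mulrNN (addrC j) (addrC i) mulrC !signzE abszN.
  by rewrite (mulrC (1 + j)) (addrC 1) (addrC 1); ring.
rewrite -S1 -S2 S12 !signzE !abszM !oddM !odd_abszD1.
case: (odd `|i|%N); case: (odd `|j|%N); rewrite /= ?expr0 ?expr1; by field.
Qed.

Definition d_gen_sign (u v : hom_elt g) : k :=
  - (-1) ^ (front_exp 0 [:: u; v] + front_exp 1 [:: u; v]
            + wt1 u * wt1 v + tag u).

Lemma ce_d_gen2 i (xi : gdual g i) u v :
  ce_d (ce_gen xi) [:: u; v] = d_gen_sign u v * gdual_eval xi (brH u v).
Proof.
by rewrite /ce_d big_ord_recr big_ord1 big_ord1 big_ord0 [X in - X]add0r /= mulNr.
Qed.

Lemma ce_d_gen0 i (xi : gdual g i) s :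
  size s != 2%N -> ce_d (ce_gen xi) s = 0.
Proof.
move=> ns; rewrite /ce_d big1 ?oppr0 // => b _; rewrite big1 // => a _.
suff : size (remove a (remove b s)) != 0%N by case: (remove a _) => //= *; rewrite mulr0.
have := size_remove (ltn_ord b); have := ltn_ord a; have := ltn_ord b.
move=> bs ab e.
have ar : (a < size (remove b s))%N by lia.
by have := size_remove ar; move/eqP: ns; lia.
Qed.

Lemma gbilin_d_gen i (xi : gdual g i) :
  gbilin (fun u v => (-1) ^ tag u * ce_d (ce_gen xi) [:: u; v]).
Proof.
split=> [l c x y z|l c z x y]; rewrite !ce_d_gen2 /d_gen_sign.
  have -> : brH (homog g (c *: x + y)) z =
      homog g (c *: gLie_br x (tagged z) + gLie_br y (tagged z)).
    by congr existT; rewrite (glie_linearl (gLieP g)).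
  by rewrite gdual_eval_linear /front_exp /= /wt !big_cons !big_nil /wt1 /=; ring.
by rewrite brH_linearr gdual_eval_linear /front_exp /= /wt !big_cons !big_nil /wt1 /=; ring.
Qed.

Lemma ce_Delta_gen1 i (xi : gdual g i) x :
  ce_Delta (ce_gen xi) [:: x] = - (2%:R^-1 * cobr g _ (tagged x)
     (fun u v => (-1) ^ tag u * ce_d (ce_gen xi) [:: u; v])).
Proof.
rewrite /ce_Delta.
have -> : forall F G, (F + G) [:: x] = F [:: x] + G [:: x] by [].
rewrite [X in _ + X](_ : _ = 0) ?addr0; last by rewrite /ce_d !big_ord1 big_ord0 oppr0.
rewrite /ce_B big_ord1 /front_exp /= /wt big_nil mulr0 expr0z mul1r.
by [].
Qed.

(* Delta preserves the generators, and [Delta_dual] is its restriction. *)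
Lemma ce_Delta_gen i (xi : gdual g i) :
  ce_Delta (ce_gen xi) = ce_gen (Delta_dual g i xi).
Proof.
pose f (xi : gdual g i) (x : g (- i)) : k^o := ce_Delta (ce_gen xi) [:: homog g x].
have fl x : linear (f x).
  move=> c u v; rewrite /f !ce_Delta_gen1 /= linearP.
  have -> : forall (T U : gtensor g) b, (c *: T + U) b = c * T b + U b by [].
  by rewrite mulrDr opprD mulrCA -mulrN.
pose lf x : {linear g (- i) -> k^o} :=
  HB.pack (f x) (GRing.isLinear.Build _ _ _ _ _ (fl x)).
have hl : linear (fun xi => linfun (f xi) : gdual g i).
  move=> c u v; apply/lfunP => x; rewrite add_lfunE scale_lfunE !(lfunE (lf _)) /=.
  rewrite /f !ce_Delta_gen1 /=; have [t Tt] := tensorP (cobr g _ x).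
  rewrite !Tt /tensor_of !asboolT; do ?exact: gbilin_d_gen.
  rewrite /GRing.scale /= !mulrN -!opprD; congr (- _).
  rewrite mulrCA -mulrDr; congr (_ * _); rewrite mulr_sumr -big_split /=.
  apply: eq_bigr => p _; rewrite !ce_d_gen2.
  have -> : gdual_eval (c *: u + v) (brH p.1 p.2) =
     c * gdual_eval u (brH p.1 p.2) + gdual_eval v (brH p.1 p.2).
    case: (brH _ _) => n y; case: (eqVneq n (- i)) => [E|ne]; last first.
      by rewrite !gdual_eval0 // mulr0 addr0.
    by move: y; rewrite E => y; rewrite !gdual_eval_homog add_lfunE scale_lfunE.
  by ring.
pose lh : {linear gdual g i -> gdual g i} :=
  HB.pack (fun xi => linfun (f xi) : gdual g i) (GRing.isLinear.Build _ _ _ _ _ hl).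
have DE : Delta_dual g i xi = linfun (f xi) by exact: (lfunE lh).
apply/funext => s; case: (eqVneq (size s) 1%N) => [|ns]; last first.
  rewrite [RHS](_ : _ = 0); last by case: s ns => [|x [|y s]].
  rewrite /ce_Delta.
  have -> : forall F G, (F + G) s = F s + G s by [].
  have -> : ce_B (ce_gen xi) = (fun=> 0) by apply/funext => t; exact: ce_B_gen.
  rewrite [X in _ + X](_ : _ = 0) ?addr0; last first.
    by rewrite /ce_d big1 ?oppr0 // => b _; rewrite big1 // => a _; rewrite mulr0.
  rewrite /ce_B big1 ?mulr0 ?oppr0 // => l _.
  have [t Tt] := tensorP (cobr g _ (tagged (entry s l))).
  rewrite Tt /tensor_of; case: asboolP => _; last by rewrite mulr0.
  rewrite big1 ?mulr0 // => p _; rewrite ce_d_gen0 ?mulr0 //=.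
  by have := size_remove (ltn_ord l); move: ns (ltn_ord l); move/eqP; lia.
case: s => [|[n x] [|y s]] // _ /=.
case: (eqVneq n (- i)) => [E|ne].
  move: x; rewrite E => x.
  by rewrite [RHS](gdual_eval_homog _ x) DE (lfunE (lf xi)).
rewrite [RHS]gdual_eval0 // ce_Delta_gen1 /=; have [t [td ->]] := cobr_deg x.
rewrite /tensor_of asboolT; last exact: gbilin_d_gen.
rewrite big_seq big1 ?mulr0 ?oppr0 // => p /(allP td)/= /eqP e.
by rewrite ce_d_gen2 gdual_eval0 ?mulr0 //= e.
Qed.

End Generators.

(* Main.v *)
(* A function of sequences is determined by its value at the empty sequence and
   by its contractions [i_x F = F(x, -)], so every identity between operators on
   cochains follows by induction on the length of the argument from commutation
   rules with the [i_x].  With [e_x] the sign of the degree of x in g[1],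
     i_x d = e_x (d i_x + L_x),   i_y L_x = i_[x,y] +- L_x i_y,
     i_x B = Q_x + e_x B i_x,     Q_x = - 1/2 sum +- i_x'' i_x',
   d^2 = 0 comes down to the Jacobi identity, B^2 = 0 to the co-Jacobi identity,
   and the cocycle condition gives [i_x, Delta] = i_(D x) with
   D x = 1/2 sum [x', x''], the transpose of Delta on generators.  Hence Delta
   acts on a cochain as the derivation induced by D.

   On the cochains of fixed degrees (n_1, ..., n_m) Delta is a sum of commuting
   operators, each annihilated by a separable polynomial, so over a splitting
   field it is diagonalisable.  Therefore Ker Delta^2 = Ker Delta and
   C = Ker Delta + Im Delta.  As Delta commutes with d, both summands are
   subcomplexes, and on Im Delta the map B is a contracting homotopy up to the
   invertible operator Delta. *)

From HB Require Import structures.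
Require Import Defs.
From mathcomp Require Import all_boot all_order all_algebra.
From mathcomp Require Import boolp functions.
From mathcomp Require Import falgebra fieldext separable.
From mathcomp Require Import zify ring.
Set Implicit Arguments.
Unset Strict Implicit.
Unset Printing Implicit Defensive.
Import GRing.Theory.
Local Open Scope ring_scope.

(** * Linear algebra *)

(** If g has infinitely many nonzero components, cochains of a given length involve infinitely many
    degree tuples, so in general no polynomial in Delta kills them all, and neither the polynomial
    nor the splitting field can be chosen uniformly. For each tuple t = (n_1, ..., n_m) a polynomial
    Q_t with Q_t(0) = 1 and Delta Q_t(Delta) = 0 in these degrees is found over an extension of k,
    where sums a_1 + ... + a_m of eigenvalues on the factors supply its roots, and is brought back
    to k by a linear retraction that fixes 1. In these degrees Q_t(Delta) is the projector to Ker
    Delta whatever the choice of Q_t; therefore independently chosen pieces fit together to a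
    symmetric function.

    The bracket measures the failure of B to be a derivation. Since Q_x contains two contractions, B
    has order two, which gives the Poisson rule; with B^2 = 0 this yields the Jacobi identity, and
    the compatibility with d holds because Delta is a derivation. Characteristic 0 enters through
    separability, the factor 1/2 in B and the factor 3 in the co-Jacobi identity. *)

Section LinearOperators.
Variables (K : fieldType) (V : lmodType K).
Implicit Types (O : V -> V) (u v : V) (c : K).

Definition linop O := forall c u v, O (c *: u + v) = c *: O u + O v.

Lemma linop0 O : linop O -> O 0 = 0.
Proof. by move=> l; have := l (-1) 0 0; rewrite scaler0 addr0 scaleN1r addNr. Qed.

Lemma linopD O : linop O -> forall u v, O (u + v) = O u + O v.
Proof. by move=> l u v; have := l 1 u v; rewrite !scale1r. Qed.

Lemma linopZ O : linop O -> forall c u, O (c *: u) = c *: O u.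
Proof. by move=> l c u; have := l c u 0; rewrite addr0 (linop0 l) addr0. Qed.

Lemma linopN O : linop O -> forall u, O (- u) = - O u.
Proof. by move=> l u; rewrite -!scaleN1r linopZ. Qed.

Lemma linop_sum O : linop O -> forall (I : Type) (r : seq I) (f : I -> V),
  O (\sum_(i <- r) f i) = \sum_(i <- r) O (f i).
Proof.
move=> l I r f; elim: r => [|i r IH]; first by rewrite !big_nil linop0.
by rewrite !big_cons linopD // IH.
Qed.

End LinearOperators.

(** * Polynomials in a linear operator *)

Section PolynomialAction.
Variables (K : fieldType) (V : lmodType K) (T : V -> V).
Hypothesis Tlin : linop T.
Implicit Types (p q : {poly K}) (u v : V) (c : K).

(** T is a bare function because the main instances are operators on infinite-dimensional spaces of
    cochains. *)
Definition pact p v : V := \sum_(i < size p) p`_i *: iter i T v.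

Lemma pact_widen n p v : (size p <= n)%N -> pact p v = \sum_(i < n) p`_i *: iter i T v.
Proof.
move=> le; rewrite /pact (big_ord_widen _ (fun i => p`_i *: iter i T v) le) big_mkcond /=.
by apply: eq_bigr => i _; case: ltnP => // h; rewrite nth_default ?scale0r.
Qed.

Lemma pactD p q v : pact (p + q) v = pact p v + pact q v.
Proof.
pose n := maxn (size p) (size q).
rewrite (pact_widen v (size_polyD p q)) (pact_widen (n := n) v (leq_maxl _ _)).
rewrite (pact_widen (n := n) v (leq_maxr _ _)) -big_split.
by apply: eq_bigr => i _; rewrite coefD scalerDl.
Qed.

Lemma pactZ c p v : pact (c *: p) v = c *: pact p v.
Proof.
rewrite (pact_widen v (size_scale_leq c p)) scaler_sumr.
by apply: eq_bigr => i _; rewrite coefZ scalerA.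
Qed.

Lemma pactN p v : pact (- p) v = - pact p v.
Proof. by rewrite -[- p]scaleN1r pactZ scaleN1r. Qed.

Lemma pactC c v : pact c%:P v = c *: v.
Proof. by rewrite (pact_widen v (size_polyC_leq1 c)) big_ord1 coefC. Qed.

Lemma pact_lin p c u v : pact p (c *: u + v) = c *: pact p u + pact p v.
Proof.
have E i : iter i T (c *: u + v) = c *: iter i T u + iter i T v.
  by elim: i => //= i ->; rewrite Tlin.
rewrite /pact scaler_sumr -big_split; apply: eq_bigr => i _ /=.
by rewrite E scalerDr !scalerA mulrC.
Qed.

Lemma pact_iter p v : pact p (T v) = T (pact p v).
Proof. by rewrite (linop_sum Tlin); apply: eq_bigr => i _; rewrite (linopZ Tlin) -iterSr. Qed.

Lemma pactXM p v : pact ('X * p) v = T (pact p v).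
Proof.
have le : (size ('X * p)%R <= (size p).+1)%N.
  by rewrite (leq_trans (size_polyMleq _ _)) // size_polyX.
rewrite (pact_widen v le) big_ord_recl coefXM /= scale0r add0r -pact_iter.
by apply: eq_bigr => i _; rewrite coefXM /= -iterSr.
Qed.

Lemma pactM p q v : pact (p * q) v = pact p (pact q v).
Proof.
elim/poly_ind: p => [|p c IH].
  by rewrite mul0r -[0]/(0%:P) !pactC !scale0r.
rewrite mulrDl !pactD -mulrA mulrCA pactXM IH (mulrC p) pactXM.
by rewrite mul_polyC pactZ pactC.
Qed.

Lemma pactX v : pact 'X v = T v.
Proof. by rewrite -['X]mulr1 pactXM -[1]/(1%:P) pactC scale1r. Qed.

Lemma pact1 v : pact 1 v = v.
Proof. by rewrite -[1]/(1%:P) pactC scale1r. Qed.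

Lemma pact_dvd p q v : p %| q -> pact p v = 0 -> pact q v = 0.
Proof.
move=> /dvdpP[r ->] h; rewrite pactM h.
by have := pact_lin r (-1) 0 0; rewrite scaler0 addr0 scaleN1r addNr.
Qed.

Lemma pact_closed (P : V -> Prop) : P 0 -> (forall c u v, P u -> P v -> P (c *: u + v)) ->
  (forall u, P u -> P (T u)) -> forall p v, P v -> P (pact p v).
Proof.
move=> P0 PL PT p v Pv; rewrite /pact.
have Pi i : P (iter i T v) by elim: i => //= i /PT.
elim/big_rec: _ => // i u _; exact: PL.
Qed.

Definition split_poly (S : seq K) : {poly K} := \prod_(a <- S) ('X - a%:P).

Lemma pact_split_cons a S v :
  pact (split_poly (a :: S)) v = T (pact (split_poly S) v) - a *: pact (split_poly S) v.
Proof. by rewrite /split_poly big_cons pactM pactD pactN pactX pactC. Qed.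

Lemma pact_split_consr a S v :
  pact (split_poly (a :: S)) v = pact (split_poly S) (T v - a *: v).
Proof. by rewrite /split_poly big_cons mulrC pactM pactD pactN pactX pactC. Qed.

(** Induction on S: the components of T v - a v, each divided by its b - a, add up to a vector whose
    difference from v is an eigenvector for a. The predicate P carries properties of v over to its
    components. *)
Lemma eigen_decomposition (P : V -> Prop) (S : seq K) v :
  (forall c u w, P u -> P w -> P (c *: u + w)) ->
  (forall u, P u -> P (T u)) ->
  uniq S -> P v -> pact (split_poly S) v = 0 ->
  exists w : K -> V, v = \sum_(a <- S) w a /\
    {in S, forall a, T (w a) = a *: w a /\ P (w a)}.
Proof.
move=> PL PT; elim: S v => [|a S IH] v /=.
  by move=> _ _; rewrite /split_poly big_nil pact1 => ->; exists (fun=> 0); rewrite big_nil.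
move=> /andP[aS uS] Pv; rewrite pact_split_consr => h.
have P0 : P 0 by rewrite -[0](addNr v) -scaleN1r; exact: PL.
have Pv' : P (T v - a *: v) by rewrite addrC -scaleNr; apply: PL => //; exact: PT.
have [w [vE wP]] := IH _ uS Pv' h.
pose w1 b := (b - a)^-1 *: w b.
have ne b : b \in S -> b - a != 0.
  by move=> bS; rewrite subr_eq0; apply: contraNneq aS => <-.
have w1E b : b \in S -> T (w1 b) = b *: w1 b /\ P (w1 b).
  move=> /wP[e Pb]; rewrite /w1 (linopZ Tlin) e scalerA mulrC -scalerA; split=> //.
  by rewrite -[_ *: _]addr0; exact: PL.
have Psum : P (\sum_(b <- S) w1 b).
  rewrite big_seq; elim/big_rec: _ => // b u bS Pu.
  by rewrite -[w1 b]scale1r; apply: PL => //; case: (w1E b bS).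
exists (fun b => if b == a then v - \sum_(b <- S) w1 b else w1 b); split.
  rewrite big_cons eqxx [X in _ + X](_ : _ = \sum_(b <- S) w1 b) ?subrK //.
  rewrite !big_seq; apply: eq_bigr => b bS.
  by rewrite ifN //; apply: contraNneq aS => <-.
move=> b; rewrite inE; case: eqVneq => [-> _|/= nb bS]; last exact: w1E.
split; last by rewrite addrC -scaleN1r; exact: PL.
have E : T (\sum_(b <- S) w1 b) = (T v - a *: v) + a *: \sum_(b <- S) w1 b.
  rewrite (linop_sum Tlin) vE scaler_sumr -big_split !big_seq /=; apply: eq_bigr => c cS.
  have [-> _] := w1E c cS.
  by rewrite -[w c](scalerKV (ne c cS)) -/(w1 c) -scalerDl subrK.
have -> : T (v - \sum_(b <- S) w1 b) = T v - T (\sum_(b <- S) w1 b).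
  by rewrite addrC -scaleN1r Tlin scaleN1r addrC.
by rewrite E scalerBr opprD opprB addrA [T v + _]addrC subrK.
Qed.
End PolynomialAction.

(** * Annihilating polynomials of semisimple operators *)

Section Semisimple.
Variable k : fieldType.

Lemma pact_linfun (V : vectType k) (f : 'End(V)) (p : {poly k}) :
  exists h : 'End(V), forall v, h v = pact f p v.
Proof.
have l : linear (pact f p).
  by move=> c u v; apply: pact_lin => d x y; rewrite linearP.
pose L : {linear V -> V} := HB.pack (pact f p) (GRing.isLinear.Build _ _ _ _ _ l).
by exists (linfun L) => v; rewrite lfunE.
Qed.

(** The powers f^i with i <= dim End(V) outnumber the dimension of End(V), so they are linearly
    dependent. *)
Lemma annihilator (V : vectType k) (f : 'End(V)) :
  exists2 p : {poly k}, p != 0 & forall v, pact f p v = 0.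
Proof.
pose N := (\dim {: 'End(V)}).+1.
pose fi i : 'End(V) := iter i (fun h => f \o h)%VF \1%VF.
have fiE i v : fi i v = iter i f v.
  by elim: i => [|i IH] /=; rewrite ?id_lfunE // comp_lfunE IH.
pose X := [tuple fi i | i < N].
have nfree : ~~ free X.
  rewrite /free size_tuple neq_ltn; apply/orP; left.
  by rewrite ltnS dimvS // subvf.
have : ~ (forall c : 'I_N -> k, \sum_(i < N) c i *: X`_i = 0 -> forall i, c i = 0).
  by move=> h; case/negP: nfree; apply/freeP.
move=> /existsNP[c /not_implyP[c0 /existsNP[i ci]]].
exists (\poly_(j < N) (if insub j is Some i then c i else 0)).
  apply/eqP => /(congr1 (fun p : {poly k} => p`_i)); rewrite coef_poly ltn_ord coef0.
  by rewrite valK => /ci.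
move=> v; rewrite (pact_widen f v (size_poly N _)).
have := congr1 (fun h : 'End(V) => h v) c0; rewrite sum_lfunE zero_lfunE => e.
rewrite -[RHS]e; apply: eq_bigr => j _.
by rewrite coef_poly ltn_ord valK scale_lfunE (nth_mktuple _ _ j) fiE.
Qed.

(** Let p be annihilating of least degree, u v a divisor of p and h = gcd(u, v), so that p = w h^2.
    A stable complement W of Ker (w h)(f) is mapped by h(f) into W and into that kernel, hence to 0;
    so W lies in the kernel and vanishes. Thus w h annihilates f, and minimality makes h constant.
    In characteristic 0 nonconstant divisors have nonzero derivative. *)
Lemma semisimple_annihilator (char0 : [pchar k] =i pred0) (V : vectType k) (f : 'End(V)) :
  semisimple_end f ->
  exists2 p : {poly k}, separable_poly p & forall v, pact f p v = 0.
Proof.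
move=> ss; have fl : linop f by move=> c u v; rewrite linearP.
have ex : exists n, `[< exists p : {poly k}, [/\ p != 0, forall v, pact f p v = 0 & size p = n] >].
  by have [p p0 fp] := annihilator f; exists (size p); apply/asboolP; exists p.
case: (ex_minnP ex) => n /asboolP[p [p0 fp sp]] pmin.
exists p => //; apply/separable_polyP; split=> [u v uvp|u up su]; last first.
  apply/eqP => /(congr1 (fun p : {poly k} => p`_(size u).-2)) /eqP.
  rewrite coef_deriv coef0 prednK -?subn1 ?subn_gt0 // subn1 -mulr_natl mulf_eq0.
  move/pcharf0P: char0 => ->; rewrite -lead_coefE lead_coef_eq0 -size_poly_eq0.
  by case: (size u) su => [|[|m]].
set h := gcdp u v.
have hp : h * h %| p by rewrite (dvdp_trans _ uvp) // dvdp_mul ?dvdp_gcdl ?dvdp_gcdr.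
have [w pE] := dvdpP _ _ hp; rewrite mulrA in pE.
have kill x : pact f (w * h) x = 0.
  have [r rE] := pact_linfun f (w * h).
  have inU y : (y \in lker r) = (pact f (w * h) y == 0) by rewrite memv_ker rE.
  have [W [fW sumUW capUW]] : exists W : {vspace V},
      [/\ (f @: W <= W)%VS, (lker r + W = fullv)%VS & (lker r :&: W = 0)%VS].
    apply: ss; apply/subvP => _ /memv_imgP[y yU ->].
    rewrite inU pact_iter //; move: yU; rewrite inU => /eqP ->.
    by rewrite linear0.
  have stab q y : y \in W -> pact f q y \in W.
    apply: (pact_closed (P := fun y => y \in W)) => [|c a b aW bW|a aW].
    - exact: mem0v.
    - by rewrite memvD ?memvZ.
    - by rewrite (subvP fW) // memv_img.
  have W0 y : y \in W -> y = 0.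
    move=> yW; have : pact f h y \in (lker r :&: W)%VS.
      by rewrite memv_cap inU -pactM // -pE fp eqxx stab.
    rewrite capUW memv0 => /eqP hy0.
    apply/eqP; rewrite -memv0 -capUW memv_cap yW andbT inU pactM // hy0.
    by apply/eqP; apply: (pact_dvd fl (dvd1p w)); rewrite pact1.
  have : x \in (lker r + W)%VS by rewrite sumUW memvf.
  case/memv_addP=> a aU [b /W0 -> ->]; rewrite addr0; apply/eqP.
  by rewrite -inU.
have h0 : h != 0 by apply: contraNneq p0 => h0; rewrite pE h0 mulr0.
have w0 : w != 0 by apply: contraNneq p0 => w0; rewrite pE w0 !mul0r.
have : (n <= size (w * h)%R)%N.
  by apply: pmin; apply/asboolP; exists (w * h); rewrite mulf_neq0.
rewrite -sp pE size_mul ?mulf_neq0 // => le.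
have hs : (0 < size h)%N by rewrite size_poly_gt0.
rewrite /coprimep -/h; case: (size h) hs le => [|[|m]] // _.
by rewrite addnS /= -[X in (_ <= X)%N]addn0 leq_add2l.
Qed.
End Semisimple.

(** * Splitting fields with a linear retraction *)

Lemma irreducible_factor (F : fieldType) (p : {poly F}) :
  (1 < size p)%N -> exists2 r : {poly F}, r %| p & irreducible_poly r.
Proof.
move=> p1.
have ex : exists n, `[< exists r : {poly F}, [/\ (1 < size r)%N, r %| p & size r = n] >].
  by exists (size p); apply/asboolP; exists p.
case: (ex_minnP ex) => n /asboolP[r [r1 rp rn]] rmin; exists r => //; split=> // q q1 qr.
have r0 : r != 0 by rewrite -size_poly_gt0 ltnW.
have q0 : q != 0 by apply: contraTneq qr => ->; rewrite dvd0p.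
rewrite -dvdp_size_eqp // eqn_leq (dvdp_leq r0 qr) rn; apply: rmin; apply/asboolP.
exists q; split=> //; last exact: dvdp_trans rp.
by move: q1; rewrite neq_ltn ltnS leqn0 size_poly_eq0 (negPf q0).
Qed.

(* The F-linear retraction [lam] of [iota] brings polynomials that annihilate an
   operator defined over F back to F. *)
Definition splitting_ext (F : fieldType) (p : {poly F}) : Prop :=
  exists (L : fieldType) (iota : {rmorphism F -> L}) (lam : L -> F) (rs : seq L),
    [/\ map_poly iota p %= split_poly rs,
        forall c u v, lam (iota c * u + v) = c * lam u + lam v & lam 1 = 1].

(** Some coordinate of 1 in a basis of L is nonzero; that coordinate function, rescaled, is the
    retraction. *)
Lemma field_retraction (F : fieldType) (L : fieldExtType F) :
  exists lam : L -> F,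
    (forall c u v, lam (in_alg L c * u + v) = c * lam u + lam v) /\ lam 1 = 1.
Proof.
pose b := vbasis {: L}; pose co i := coord b i (1 : L).
have [i ci] : exists i, co i != 0.
  case: (pickP (fun i => co i != 0)) => [i|h]; first by exists i.
  have := coord_vbasis (memvf (1 : L)); rewrite big1 => [/eqP|i _].
    by rewrite oner_eq0.
  by have /negbFE/eqP e := h i; rewrite -[coord _ _ _]/(co i) e scale0r.
exists (fun z => (co i)^-1 * coord b i z); split; last by rewrite mulVf.
by move=> c u v; rewrite mulr_algl linearP /=; ring.
Qed.

(** Adjoin a root of an irreducible factor, divide by the linear factor and repeat; the retractions
    compose. The induction on the size bound is over all fields at once, since the quotient lives
    over the larger field. *)
Lemma splitting_extP (F : fieldType) (p : {poly F}) : p != 0 -> splitting_ext p.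
Proof.
move: {2}(size p) (leqnn (size p)) => n; elim: n F p => [|n IH] F p.
  by rewrite leqn0 size_poly_eq0 => ->.
move=> sp p0; case: (leqP (size p) 1) => [p1|p1].
  exists F, idfun, id, [::]; split=> //.
  rewrite map_poly_id // /split_poly big_nil -size_poly_eq1 eqn_leq p1.
  by rewrite size_poly_gt0.
have [r rp irr] := irreducible_factor p1.
have [K _ [x rx _]] := irredp_FAdjoin irr.
have [lamK [lamKl lamK1]] := field_retraction K.
have /factor_theorem[q pE] : root (map_poly (in_alg K) p) x.
  by have /dvdpP[t ->] := rp; rewrite rmorphM rootM rx orbT.
have spq : size p = size (q * ('X - x%:P))%R by rewrite -pE size_map_poly.
have q0 : q != 0.
  by apply: contraNneq p0 => q0; rewrite -size_poly_eq0 spq q0 mul0r size_poly0.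
have sq : (size q <= n)%N.
  by move: sp; rewrite spq size_mul ?polyXsubC_eq0 // size_XsubC addn2.
have [L [iota [lam [rs [h1 h2 h3]]]]] := IH K q sq q0.
exists L, (iota \o in_alg K), (fun z => lamK (lam z)), (iota x :: rs); split.
- rewrite map_poly_comp pE rmorphM /= rmorphB /= map_polyX map_polyC.
  by rewrite /split_poly big_cons mulrC eqp_mull.
- by move=> c u v /=; rewrite h2 lamKl.
- by rewrite h3.
Qed.

(** * Contractions and Lie derivatives *)

Definition oddz (n : int) := odd `|n|%N.

Lemma oddzD m n : oddz (m + n) = oddz m (+) oddz n.
Proof.
rewrite /oddz.
case: m n => [m|m] [n|n] /=; rewrite -?PoszD ?absz_nat ?NegzE ?oddD //.
all: lia.
Qed.

Lemma oddzN n : oddz (- n) = oddz n. Proof. by rewrite /oddz abszN. Qed.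

Lemma oddzM m n : oddz (m * n) = oddz m && oddz n.
Proof. by rewrite /oddz abszM oddM. Qed.

Lemma oddz0 : oddz 0 = false. Proof. by []. Qed.

Lemma oddz1 : oddz 1 = true. Proof. by []. Qed.

Section Calculus.
Variables (k : fieldType) (g : gLieBialg k).
Local Notation H := (hom_elt g).
Local Notation C := (cochain g).
Implicit Types (x y z : H) (s t : seq H) (F G : C) (c : k).
(* The values of a cochain lie in [k^o], whose ring operations are convertible to
   those of [k] but not syntactically equal to them. *)
Local Notation "F '$' s" := (F s : k)
  (at level 10, s at next level, left associativity, only parsing).

Lemma sgE (n : int) : (-1) ^ n = (-1) ^+ oddz n :> k.
Proof. exact: signzE. Qed.

Lemma oddz_wt1 x : oddz (wt1 x) = ~~ oddz (tag x).
Proof. by rewrite /wt1 oddzD oddzN oddz1 addbT. Qed.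

Lemma cochainP F G : (forall s, F $ s = G $ s) -> F = G.
Proof. by move=> e; apply/funext. Qed.

Lemma addcE F G s : (F + G) $ s = F $ s + G $ s. Proof. by []. Qed.

Lemma oppcE F s : (- F) $ s = - F $ s. Proof. by []. Qed.

Lemma scalecE c F s : (c *: F) $ s = c * F $ s. Proof. by []. Qed.

Lemma zerocE s : (0 : C) $ s = 0. Proof. by []. Qed.

Lemma sumcE (I : Type) (r : seq I) (P : pred I) (f : I -> C) s :
  (\sum_(i <- r | P i) f i) $ s = \sum_(i <- r | P i) f i $ s.
Proof. by elim/big_rec2: _ => // i a b _ <-. Qed.

Definition cochainE := (addcE, oppcE, scalecE, zerocE).

Lemma wt_nil : wt ([::] : seq H) = 0. Proof. by rewrite /wt big_nil. Qed.

Lemma wt_cons x s : wt (x :: s) = wt1 x + wt s. Proof. by rewrite /wt big_cons. Qed.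

Lemma tag_brH x y : tag (brH x y) = tag x + tag y. Proof. by []. Qed.

Lemma oddz_tag_brH x y : oddz (tag (brH x y)) = oddz (tag x) (+) oddz (tag y).
Proof. by rewrite tag_brH oddzD. Qed.

Definition oddzE := (oddz_tag_brH, oddzD, oddzM, oddzN, oddz0, oddz1, oddz_wt1).

(** A sign depends only on the parity of its exponent: split on all parities and leave the rest to
    [ring]. The argument is an extra parity relation, typically the one between x and the two
    factors of a term of its cobracket. *)
Ltac signs_with e := rewrite ?sgE ?oddzE ?e;
  repeat match goal with |- context [oddz ?a] => case: (oddz a) end;
  rewrite /= ?expr0 ?expr1; ring.

Ltac signs := signs_with oddz1.

Definition contract x F : C := fun s => F (x :: s).

Definition multilin F := forall s t i (c : k) (x y : g i),
  F $ (s ++ homog g (c *: x + y) :: t) =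
    c * F $ (s ++ homog g x :: t) + F $ (s ++ homog g y :: t).

Definition gsym F := forall s t (x y : H),
  F $ (s ++ x :: y :: t) = (-1) ^ (wt1 x * wt1 y) * F $ (s ++ y :: x :: t).

Definition symlin F := multilin F /\ gsym F.

(** Both L_x and B move one entry to the front with its Koszul sign and then act on it; [posum_cons]
    provides the recursion for the two of them. *)
Definition posum (f : H -> seq H -> k) s : k :=
  \sum_(j < size s) (-1) ^ front_exp j s * f (entry s j) (remove j s).

Lemma posum_nil f : posum f [::] = 0. Proof. by rewrite /posum big_ord0. Qed.

Lemma posum_cons f x s :
  posum f (x :: s) =
    f x s + posum (fun y t => (-1) ^ (wt1 y * wt1 x) * f y (x :: t)) s.
Proof.
rewrite /posum big_ord_recl /=; congr (_ + _).
  by rewrite /front_exp /= wt_nil mulr0 expr0z mul1r /remove /= drop0.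
apply: eq_bigr => j _.
have -> : front_exp (lift ord0 j) (x :: s) = wt1 (entry s j) * wt1 x + front_exp j s.
  by rewrite /front_exp /= wt_cons mulrDr.
signs.
Qed.

Lemma eq_posum f f' s : (forall y t, f y t = f' y t) -> posum f s = posum f' s.
Proof. by move=> e; apply: eq_bigr => j _; rewrite e. Qed.

Lemma posum_lin c f f' s :
  posum (fun y t => c * f y t + f' y t) s = c * posum f s + posum f' s.
Proof.
by rewrite /posum mulr_sumr -big_split; apply: eq_bigr => j _ /=; ring.
Qed.

Lemma posumZ c f s : posum (fun y t => c * f y t) s = c * posum f s.
Proof. by rewrite /posum mulr_sumr; apply: eq_bigr => j _ /=; ring. Qed.

Definition lie x F : C := fun s => posum (fun y t => F $ (brH x y :: t)) s.

Lemma lie_linear x c F G : lie x (c *: F + G) = c *: lie x F + lie x G.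
Proof. by apply: cochainP => s; rewrite !cochainE -posum_lin. Qed.

Lemma ce_d_linear c F G : ce_d (c *: F + G) = c *: ce_d F + ce_d G.
Proof.
apply: cochainP => s; rewrite !cochainE /ce_d mulrN -opprD mulr_sumr -big_split /=.
congr (- _); apply: eq_bigr => j _; rewrite mulr_sumr -big_split /=.
by apply: eq_bigr => i _; rewrite !cochainE; ring.
Qed.

Lemma gsym_head F : gsym F -> forall x y s,
  F $ (x :: y :: s) = (-1) ^ (wt1 x * wt1 y) * F $ (y :: x :: s).
Proof. by move=> h x y s; exact: (h [::]). Qed.

(** The pairs (i, j) with i = 0 make up the Lie derivative, those with i > 0 the differential of the
    contraction; in the latter the symmetry of F moves x past the bracket. *)
Lemma ce_d_cons F x s : gsym F ->
  ce_d F $ (x :: s) = (-1) ^ wt1 x * (ce_d (contract x F) $ s + lie x F $ s).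
Proof.
move=> /gsym_head hF; rewrite /ce_d big_ord_recl [X in - (X + _)]big_ord0 add0r /=.
under eq_bigr => j _ do rewrite big_ord_recl /=.
rewrite big_split /= opprD mulrDr addrC; congr (_ + _).
  rewrite mulrN mulr_sumr; congr (- _); apply: eq_bigr => j _.
  rewrite mulr_sumr; apply: eq_bigr => i _; rewrite /bump /= !add1n.
  rewrite /contract.
  have -> : remove i.+1 (remove j.+1 (x :: s)) = x :: remove i (remove j s) by [].
  rewrite /front_exp /= !wt_cons.
  by rewrite hF !add0n; signs.
rewrite /lie /posum mulr_sumr -sumrN; apply: eq_bigr => j _.
rewrite /remove /= drop0 /front_exp /= wt_nil wt_cons.
by rewrite !add0n; signs.
Qed.

Lemma lie_cons F x y s : gsym F ->
  lie x F $ (y :: s) = F $ (brH x y :: s)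
    + (-1) ^ (wt1 y * tag x) * lie x (contract y F) $ s.
Proof.
move=> /gsym_head hF; rewrite /lie posum_cons; congr (_ + _).
rewrite -posumZ; apply: eq_posum => z t; rewrite /contract hF mulrA; congr (_ * _).
by signs.
Qed.

Lemma contractE x F s : contract x F s = F (x :: s). Proof. by []. Qed.

Lemma contract_symlin x F : symlin F -> symlin (contract x F).
Proof. by case=> l h; split=> [s|s]; [exact: (l (x :: s))|exact: (h (x :: s))]. Qed.

Lemma symlin0 : symlin (0 : C).
Proof. by split=> [s t i c x y|s t x y]; rewrite !zerocE mulr0 ?addr0. Qed.

Lemma symlin_lin c F G : symlin F -> symlin G -> symlin (c *: F + G).
Proof.
move=> [lF sF] [lG sG]; split=> [s t i a x y|s t x y]; rewrite !cochainE ?lF ?lG.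
  by ring.
by rewrite sF sG; ring.
Qed.

Lemma symlinD F G : symlin F -> symlin G -> symlin (F + G).
Proof. by move=> hF hG; rewrite -[F]scale1r; exact: symlin_lin. Qed.

Lemma symlinZ c F : symlin F -> symlin (c *: F).
Proof. by move=> hF; rewrite -[_ *: _]addr0; apply: symlin_lin => //; exact: symlin0. Qed.

Lemma symlinN F : symlin F -> symlin (- F).
Proof. by rewrite -scaleN1r; exact: symlinZ. Qed.

Lemma contractC F x y : symlin F ->
  contract y (contract x F) = (-1) ^ (wt1 x * wt1 y) *: contract x (contract y F).
Proof. by case=> _ h; apply: cochainP => s; rewrite cochainE; exact: (h [::]). Qed.

Lemma head_lin F i c (u v : g i) s : multilin F ->
  F $ (homog g (c *: u + v) :: s) = c * F $ (homog g u :: s) + F $ (homog g v :: s).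
Proof. by move=> h; exact: (h [::]). Qed.

Lemma head0 F i s : multilin F -> F $ (homog g (0 : g i) :: s) = 0.
Proof.
move=> h; have := @head_lin F i (-1) 0 0 s h.
by rewrite scaler0 addr0 mulN1r addNr => ->.
Qed.

Lemma headZ F i c (u : g i) s : multilin F ->
  F $ (homog g (c *: u) :: s) = c * F $ (homog g u :: s).
Proof. by move=> h; rewrite -[c *: u]addr0 head_lin // head0 // addr0. Qed.

Lemma headD F i (u v : g i) s : multilin F ->
  F $ (homog g (u + v) :: s) = F $ (homog g u :: s) + F $ (homog g v :: s).
Proof. by move=> h; rewrite -[u]scale1r head_lin // scale1r mul1r. Qed.

Lemma headN F i (u : g i) s : multilin F ->
  F $ (homog g (- u) :: s) = - F $ (homog g u :: s).
Proof. by move=> h; rewrite -scaleN1r headZ // mulN1r. Qed.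

Lemma homog_gcast i j (e : i = j) (u : g i) : homog g (gcast e u) = homog g u.
Proof. by case: j / e. Qed.

Lemma brH_linearl z i c (u v : g i) :
  brH (homog g (c *: u + v)) z =
    homog g (c *: gLie_br u (tagged z) + gLie_br v (tagged z)).
Proof. by congr existT; rewrite (glie_linearl (gLieP g)). Qed.

Lemma brH_anti F x y s : multilin F ->
  F $ (brH x y :: s) = - ((-1) ^ (tag x * tag y) * F $ (brH y x :: s)).
Proof.
move=> h; rewrite {1}/brH (glie_anti (gLieP g)) headN // headZ //.
by rewrite homog_gcast.
Qed.

Lemma brH_jacobi F x y z s : multilin F ->
  F $ (brH x (brH y z) :: s) = F $ (brH (brH x y) z :: s)
    + (-1) ^ (tag x * tag y) * F $ (brH y (brH x z) :: s).
Proof.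
move=> h; rewrite {1}/brH {1}/brH /= (glie_jacobi (gLieP g)).
by rewrite headD // headZ // !homog_gcast.
Qed.

Lemma contract_lie F x y : symlin F ->
  contract y (lie x F) =
    contract (brH x y) F + (-1) ^ (wt1 y * tag x) *: lie x (contract y F).
Proof. by case=> _ h; apply: cochainP => s; rewrite contractE lie_cons. Qed.

Lemma contract_d F x : symlin F ->
  contract x (ce_d F) = (-1) ^ wt1 x *: (ce_d (contract x F) + lie x F).
Proof. by case=> _ h; apply: cochainP => s; rewrite contractE ce_d_cons. Qed.

Lemma lie_lin_elt F i c (u v : g i) s : multilin F ->
  lie (homog g (c *: u + v)) F $ s = c * lie (homog g u) F $ s + lie (homog g v) F $ s.
Proof.
move=> h; rewrite /lie -posum_lin; apply: eq_posum => z t.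
by rewrite brH_linearl head_lin.
Qed.

Lemma contract_lin_elt F i c (u v : g i) : multilin F ->
  contract (homog g (c *: u + v)) F =
    c *: contract (homog g u) F + contract (homog g v) F.
Proof. by move=> h; apply: cochainP => s; rewrite cochainE; exact: head_lin. Qed.

(** Here, as in the similar proofs for [ce_d], [ce_mul] and [bop], linearity and symmetry each split
    in two: either the entries concerned stand first, which is a computation, or they stand behind
    z, where the induction hypothesis applies to contractions. *)
Lemma lie_symlin x F : symlin F -> symlin (lie x F).
Proof.
move=> hF; split=> [s|s]; elim: s F hF => [|z s IH] F hF; have [l h] := hF.
- move=> t i c u v /=; rewrite !lie_cons // brH_linearr head_lin //.
  by rewrite contract_lin_elt // lie_linear !cochainE; ring.
- move=> t i c u v /=; rewrite !lie_cons // IH; last exact: contract_symlin.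
  by rewrite -!cat_cons l; ring.
- move=> t u v /=; have [_ hu] := contract_symlin u hF; have [_ hv] := contract_symlin v hF.
  rewrite !(lie_cons _ _ _ h) (lie_cons _ _ _ hu) (lie_cons _ _ _ hv).
  rewrite (contractC _ _ hF) (linopZ (lie_linear x)) !cochainE !contractE.
  rewrite (gsym_head h v (brH x u)) (gsym_head h u (brH x v)).
  by signs.
- move=> t u v /=; rewrite !lie_cons // IH; last exact: contract_symlin.
  by rewrite -!cat_cons h; ring.
Qed.

(** Operators act by precomposition, so the order of composition is reversed. The induction step is
    the Jacobi identity for x, y, z. *)
Lemma lie_brH x y F s : symlin F ->
  lie (brH x y) F $ s =
    lie y (lie x F) $ s - (-1) ^ (tag x * tag y) * lie x (lie y F) $ s.
Proof.
elim: s F => [|z s IH] F hF; first by rewrite /lie !posum_nil mulr0 subr0.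
have [l h] := hF; have [_ hx] := lie_symlin x hF; have [_ hy] := lie_symlin y hF.
rewrite (lie_cons _ _ _ h) (lie_cons _ _ _ hx) (lie_cons _ _ _ hy).
rewrite !(lie_cons _ _ _ h) !contract_lie // !linopD; try exact: lie_linear.
rewrite !(linopZ (lie_linear _)) !cochainE (brH_jacobi x y z s l).
rewrite IH; last exact: contract_symlin.
by signs.
Qed.

Lemma d_symlin F : symlin F -> symlin (ce_d F).
Proof.
move=> hF; split=> [s|s]; elim: s F hF => [|z s IH] F hF; have [l h] := hF.
- move=> t i c u v /=; rewrite !ce_d_cons // contract_lin_elt // ce_d_linear.
  by rewrite lie_lin_elt // !cochainE; ring.
- move=> t i c u v /=; rewrite !ce_d_cons // IH; last exact: contract_symlin.
  by have [-> _] := lie_symlin z hF; ring.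
- move=> t u v /=; have [_ hu] := contract_symlin u hF; have [_ hv] := contract_symlin v hF.
  rewrite !(ce_d_cons _ _ h) (ce_d_cons _ _ hu) (ce_d_cons _ _ hv).
  rewrite !(lie_cons _ _ _ h) (contractC _ _ hF) (linopZ ce_d_linear) !cochainE.
  by rewrite (brH_anti u v _ l); signs.
- move=> t u v /=; rewrite !ce_d_cons // IH; last exact: contract_symlin.
  by have [_ ->] := lie_symlin z hF; ring.
Qed.

Lemma d_lie x F s : symlin F ->
  ce_d (lie x F) $ s = (-1) ^ tag x * lie x (ce_d F) $ s.
Proof.
elim: s F => [|z s IH] F hF.
  by rewrite /lie posum_nil /ce_d big_ord0 oppr0 mulr0.
have [_ hx] := lie_symlin x hF; have [_ hd] := d_symlin hF.
rewrite (ce_d_cons _ _ hx) (lie_cons _ _ _ hd) -[ce_d F (_ :: _)]contractE.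
rewrite !contract_d // contract_lie // !(linopD ce_d_linear).
rewrite (linopZ ce_d_linear) (linopZ (lie_linear _)).
rewrite (linopD (lie_linear _)).
rewrite !cochainE IH ?(lie_brH x z) //; last exact: contract_symlin.
by signs.
Qed.

(** After contraction by z the terms d L_z and L_z d cancel by [d_lie]; the Jacobi identity has
    entered there through [lie_brH]. *)
Lemma d_square F s : symlin F -> ce_d (ce_d F) $ s = 0.
Proof.
elim: s F => [|z s IH] F hF; first by rewrite /ce_d big_ord0 oppr0.
have [_ hd] := d_symlin hF; rewrite (ce_d_cons _ _ hd) contract_d //.
rewrite (linopZ ce_d_linear) (linopD ce_d_linear) !cochainE d_lie //.
by rewrite IH; [signs|exact: contract_symlin].
Qed.

(** * Degree and length of cochains *)

Definition cdeg (p : int) F := forall s, wt s != - p -> F $ s = 0.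

Lemma cdeg0 p : cdeg p 0. Proof. by []. Qed.

Lemma cdeg_lin p c F G : cdeg p F -> cdeg p G -> cdeg p (c *: F + G).
Proof. by move=> hF hG s ns; rewrite !cochainE hF // hG // mulr0 addr0. Qed.

Lemma cdegD p F G : cdeg p F -> cdeg p G -> cdeg p (F + G).
Proof. by move=> hF hG; rewrite -[F]scale1r; exact: cdeg_lin. Qed.

Lemma cdegZ p c F : cdeg p F -> cdeg p (c *: F).
Proof. by move=> hF; rewrite -[_ *: _]addr0; exact: cdeg_lin. Qed.

Lemma cdeg_eq p q F : p = q -> cdeg p F -> cdeg q F. Proof. by move=> ->. Qed.

Lemma cdeg_contract p x F : cdeg p F -> cdeg (p + wt1 x) (contract x F).
Proof.
move=> hF s ns; apply: hF; rewrite wt_cons; apply: contraNneq ns => e.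
by apply/eqP; lia.
Qed.

Lemma wt1_brH x y : wt1 (brH x y) = wt1 x + wt1 y + 1.
Proof. by rewrite /wt1 tag_brH; lia. Qed.

Lemma cdeg_lie p x F : symlin F -> cdeg p F -> cdeg (p + tag x) (lie x F).
Proof.
move=> hF hd s; elim: s p F hF hd => [|z s IH] p F hF hd ns.
  by rewrite /lie posum_nil.
have [_ h] := hF; rewrite (lie_cons _ _ _ h) hd.
  rewrite (IH (p + wt1 z)) ?mulr0 ?addr0 //; first exact: contract_symlin.
    exact: cdeg_contract.
  by apply: contraNneq ns => e; rewrite wt_cons e; apply/eqP; lia.
apply: contraNneq ns; rewrite !wt_cons wt1_brH /wt1 => e; apply/eqP; lia.
Qed.

Lemma cdeg_d p F : symlin F -> cdeg p F -> cdeg (p + 1) (ce_d F).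
Proof.
move=> hF hd s; elim: s p F hF hd => [|z s IH] p F hF hd ns.
  by rewrite /ce_d big_ord0 oppr0.
have [_ h] := hF; rewrite (ce_d_cons _ _ h).
rewrite (cdeg_lie hF hd) ?addr0; last first.
  by apply: contraNneq ns; rewrite wt_cons => ->; apply/eqP; rewrite /wt1; lia.
rewrite (IH (p + wt1 z)) ?mulr0 //; first exact: contract_symlin.
  exact: cdeg_contract.
by apply: contraNneq ns => e; rewrite wt_cons e; apply/eqP; lia.
Qed.

Definition cbound (m : nat) F := forall s, (m < size s)%N -> F $ s = 0.

Lemma cbound_contract m x F : cbound m.+1 F -> cbound m (contract x F).
Proof. by move=> h s ms; exact: h. Qed.

Lemma cbound0_contract x F : cbound 0 F -> contract x F = 0.
Proof. by move=> h; apply: cochainP => s; exact: h. Qed.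

Lemma cbound_lie m x F : cbound m F -> cbound m (lie x F).
Proof.
move=> h s ms; rewrite /lie /posum big1 // => j _; rewrite h ?mulr0 //=.
by have := size_remove (ltn_ord j) => ->.
Qed.

Lemma cbound_d m F : symlin F -> cbound m F -> cbound m.+1 (ce_d F).
Proof.
move=> hF h s; elim: s m F hF h => [|z s IH] m F hF hb ms; first by [].
have [_ h] := hF; rewrite (ce_d_cons _ _ h) (cbound_lie _ hb) // addr0.
case: m hb ms => [|m] hb ms.
  by rewrite cbound0_contract // (linop0 ce_d_linear) mulr0.
by rewrite (IH m) ?mulr0 //; [exact: contract_symlin|exact: cbound_contract].
Qed.

Lemma is_cochainP n F :
  is_cochain n F <-> [/\ symlin F, cdeg n F & exists m, cbound m F].
Proof.
split=> [[l h d b]|[[l h] d [m b]]]; first by split.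
by split=> //; exists m.
Qed.

(** * The product *)

Lemma mul_linearl c F F' G :
  ce_mul (c *: F + F') G = c *: ce_mul F G + ce_mul F' G.
Proof.
apply: cochainP => s; rewrite !cochainE /ce_mul mulr_sumr -big_split /=.
by apply: eq_bigr => m _; rewrite !cochainE; ring.
Qed.

Lemma mul_linearr F c G G' :
  ce_mul F (c *: G + G') = c *: ce_mul F G + ce_mul F G'.
Proof.
apply: cochainP => s; rewrite !cochainE /ce_mul mulr_sumr -big_split /=.
by apply: eq_bigr => m _; rewrite !cochainE; ring.
Qed.

Lemma linop_mull G : linop (fun F => ce_mul F G).
Proof. by move=> c F F'; exact: mul_linearl. Qed.

Lemma linop_mulr F : linop (fun G => ce_mul F G).
Proof. by move=> c G G'; exact: mul_linearr. Qed.

Lemma ce_mulDl F F' G : ce_mul (F + F') G = ce_mul F G + ce_mul F' G.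
Proof. exact: (linopD (@linop_mull G)). Qed.

Lemma ce_mulDr F G G' : ce_mul F (G + G') = ce_mul F G + ce_mul F G'.
Proof. exact: (linopD (@linop_mulr F)). Qed.

Lemma ce_mulZl c F G : ce_mul (c *: F) G = c *: ce_mul F G.
Proof. exact: (linopZ (@linop_mull G)). Qed.

Lemma ce_mulZr c F G : ce_mul F (c *: G) = c *: ce_mul F G.
Proof. exact: (linopZ (@linop_mulr F)). Qed.

Lemma mul0F G : ce_mul 0 G = 0.
Proof. exact: (linop0 (@linop_mull G)). Qed.

Lemma mulF0 F : ce_mul F 0 = 0.
Proof. exact: (linop0 (@linop_mulr F)). Qed.

Definition ce_mulE := (ce_mulDl, ce_mulDr, ce_mulZl, ce_mulZr).

Lemma mul_nil F G : ce_mul F G $ [::] = F [::] * G [::].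
Proof.
rewrite /ce_mul (sum_tuple0 (fun m => (-1) ^ unshuffle_exp m ([::] : seq H)
  * F $ (mask m [::]) * G $ (mask (map negb m) [::]))) /=.
by rewrite expr0z mul1r.
Qed.

Lemma mul_cons p F G x s : cdeg p F ->
  ce_mul F G $ (x :: s) = ce_mul (contract x F) G $ s
    + (-1) ^ (wt1 x * p) * ce_mul F (contract x G) $ s.
Proof.
move=> hF; rewrite {1}/ce_mul /=.
rewrite (sum_tuple_cons (size s) (fun m => (-1) ^ unshuffle_exp m (x :: s)
  * F $ (mask m (x :: s)) * G $ (mask (map negb m) (x :: s)))) /=.
congr (_ + _); first by apply: eq_bigr => m _; rewrite add0r.
rewrite /ce_mul mulr_sumr; apply: eq_bigr => m _ /=.
(* The sign involves the total degree of the entries handed to F, which is -p wherever F does not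
   vanish. *)
case: (eqVneq (wt (mask m s)) (- p)) => [->|n]; last first.
  by rewrite (hF _ n) !(mulr0, mul0r).
by rewrite /contract; signs.
Qed.

Lemma contract_mul p F G x : cdeg p F ->
  contract x (ce_mul F G) = ce_mul (contract x F) G
    + (-1) ^ (wt1 x * p) *: ce_mul F (contract x G).
Proof. by move=> hF; apply: cochainP => s; rewrite contractE (mul_cons _ _ _ hF). Qed.

Lemma mul_symlin p F G : cdeg p F -> symlin F -> symlin G -> symlin (ce_mul F G).
Proof.
move=> dF hF hG; split=> [s|s]; elim: s p F G dF hF hG => [|z s IH] p F G dF hF hG;
  have [lF sF] := hF; have [lG sG] := hG.
- move=> t i c u v /=; rewrite !(mul_cons _ _ _ dF) !contract_lin_elt // !ce_mulE !cochainE.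
  by rewrite /wt1 /=; ring.
- move=> t i c u v /=; rewrite !(mul_cons _ _ _ dF).
  rewrite (IH (p + wt1 z))  1?(IH p) //; try exact: contract_symlin; last exact: cdeg_contract.
  by ring.
- move=> t u v /=; rewrite !(mul_cons _ _ _ dF) !(mul_cons _ _ _ (cdeg_contract dF)).
  rewrite (contractC _ _ hF) (contractC _ _ hG) !ce_mulE !cochainE.
  by signs.
- move=> t u v /=; rewrite !(mul_cons _ _ _ dF).
  rewrite (IH _ _ _ (cdeg_contract dF) (contract_symlin z hF) hG t u v).
  by rewrite (IH _ _ _ dF hF (contract_symlin z hG) t u v); ring.
Qed.

Lemma cdeg_mul p q F G : cdeg p F -> cdeg q G -> cdeg (p + q) (ce_mul F G).
Proof.
move=> dF dG s; elim: s p q F G dF dG => [|z s IH] p q F G dF dG.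
  rewrite wt_nil mul_nil => ns; case: (eqVneq 0 (- p)) => [e|ne].
    by rewrite (dG [::]) ?mulr0 // wt_nil; apply: contraNneq ns => e'; apply/eqP; lia.
  by rewrite (dF [::]) ?mul0r // wt_nil.
rewrite wt_cons (mul_cons _ _ _ dF) => ns.
rewrite (IH (p + wt1 z) q) 1?(IH p (q + wt1 z)) ?mulr0 ?addr0 //; try exact: cdeg_contract.
  by apply: contraNneq ns => e; apply/eqP; lia.
by apply: contraNneq ns => e; apply/eqP; lia.
Qed.

Lemma cbound_mul m n F G : cbound m F -> cbound n G -> cbound (m + n) (ce_mul F G).
Proof.
move=> hF hG s ms; rewrite /ce_mul big1 // => b _.
have := size_mask2 (size_tuple b) => e.
case: (ltnP m (size (mask b s))) => [/hF ->|le1]; first by rewrite mulr0 mul0r.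
by rewrite (hG (mask (map negb b) s)) ?mulr0 //; lia.
Qed.

Lemma ce_mulC p q F G s : cdeg p F -> cdeg q G ->
  ce_mul F G $ s = (-1) ^ (p * q) * ce_mul G F $ s.
Proof.
elim: s p q F G => [|z s IH] p q F G dF dG.
  rewrite !mul_nil; case: (eqVneq 0 (- p)) => [e|ne].
    by rewrite (_ : p = 0) ?mul0r ?expr0z ?mul1r 1?mulrC //; lia.
  by rewrite (dF [::]) ?mul0r ?mulr0 // wt_nil.
rewrite (mul_cons _ _ _ dF) (mul_cons _ _ _ dG).
rewrite (IH _ _ (contract z F) G (cdeg_contract dF) dG).
by rewrite (IH _ _ F (contract z G) dF (cdeg_contract dG)); signs.
Qed.

Lemma ce_mulA p q F G K s : cdeg p F -> cdeg q G ->
  ce_mul F (ce_mul G K) $ s = ce_mul (ce_mul F G) K $ s.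
Proof.
elim: s p q F G K => [|z s IH] p q F G K dF dG; first by rewrite !mul_nil mulrA.
rewrite (mul_cons _ _ _ dF) (mul_cons _ _ _ (cdeg_mul dF dG)).
rewrite (contract_mul _ _ dF) (contract_mul _ _ dG) !ce_mulE !cochainE.
rewrite (IH (p + wt1 z) q) 1?(IH p (q + wt1 z)) 1?(IH p q) //; try exact: cdeg_contract.
by signs.
Qed.

Lemma one_symlin : symlin (@ce_one k g).
Proof.
by split=> [[|z s] t i c u v|[|z s] t u v]; rewrite /= !mulr0 ?addr0.
Qed.

Lemma cdeg_one : cdeg 0 (@ce_one k g).
Proof. by case=> [|x s] //; rewrite wt_nil eqxx. Qed.

Lemma cbound_one : cbound 0 (@ce_one k g).
Proof. by case. Qed.

Lemma mul1F F s : ce_mul (@ce_one k g) F $ s = F s.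
Proof.
elim: s F => [|z s IH] F; first by rewrite mul_nil mul1r.
rewrite (mul_cons _ _ _ cdeg_one) cbound0_contract ?mul0F; last exact: cbound_one.
by rewrite IH mulr0 expr0z zerocE add0r mul1r.
Qed.

Lemma lie_mul p x F G s : cdeg p F -> symlin F -> symlin G ->
  lie x (ce_mul F G) $ s =
    ce_mul (lie x F) G $ s + (-1) ^ (p * tag x) * ce_mul F (lie x G) $ s.
Proof.
elim: s p F G => [|z s IH] p F G dF hF hG.
  by rewrite /lie posum_nil !mul_nil !posum_nil mul0r !mulr0 addr0.
have [_ sFG] := mul_symlin dF hF hG; have [_ sF] := hF; have [_ sG] := hG.
rewrite (lie_cons _ _ _ sFG) (mul_cons _ _ _ dF) (mul_cons _ _ _ (cdeg_lie hF dF)).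
rewrite (mul_cons _ _ _ dF) (contract_mul _ _ dF) !contract_lie //.
rewrite (linopD (lie_linear x)) (linopZ (lie_linear x)) !ce_mulE !cochainE.
rewrite (IH (p + wt1 z))  1?(IH p) //; try exact: contract_symlin; last exact: cdeg_contract.
by signs.
Qed.

Lemma d_mul p F G s : cdeg p F -> symlin F -> symlin G ->
  ce_d (ce_mul F G) $ s =
    ce_mul (ce_d F) G $ s + (-1) ^ p * ce_mul F (ce_d G) $ s.
Proof.
elim: s p F G => [|z s IH] p F G dF hF hG.
  by rewrite !mul_nil /ce_d !big_ord0 oppr0 mul0r !mulr0 addr0.
have [_ sFG] := mul_symlin dF hF hG.
rewrite (ce_d_cons _ _ sFG) (mul_cons _ _ _ dF) (mul_cons _ _ _ (cdeg_d hF dF)).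
rewrite (contract_mul _ _ dF) !contract_d // (lie_mul _ _ dF) //.
rewrite (linopD ce_d_linear) (linopZ ce_d_linear) !ce_mulE !cochainE.
rewrite (IH (p + wt1 z))  1?(IH p) //; try exact: contract_symlin; last exact: cdeg_contract.
by signs.
Qed.

(** * Cobracket *)

Definition linform (f : H -> k) := forall i (c : k) (u v : g i),
  f (homog g (c *: u + v)) = c * f (homog g u) + f (homog g v).

Lemma gbilinP (b : H -> H -> k) :
  gbilin b <-> (forall v, linform (b^~ v)) /\ (forall u, linform (b u)).
Proof.
split=> [[h1 h2]|[h1 h2]]; split.
- by move=> v i c x y; exact: h1.
- by move=> u i c x y; exact: h2.
- by move=> i c x y z; exact: (h1 z).
- by move=> i c z x y; exact: (h2 z).
Qed.

Definition dual_basis (j : int) : seq ({i : int & gdual g i} * H) :=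
  [seq (Tagged (fun i => gdual g i)
          (linfun (coord (vbasis {:g (- j)}) l : g (- j) -> k^o) : gdual g j),
        homog g (vbasis {:g (- j)})`_l)
    | l <- enum 'I_(\dim {:g (- j)})].

Definition eval (xi : {i : int & gdual g i}) (x : H) : k := gdual_eval (tagged xi) x.

Lemma eval_eq0 xi x : tag x != - tag xi -> eval xi x = 0.
Proof. exact: gdual_eval0. Qed.

Lemma dual_basisE f j x : linform f -> tag x = - j ->
  f x = \sum_(q <- dual_basis j) eval q.1 x * f q.2.
Proof.
move=> lf; case: x => n u /= e; subst n.
rewrite /dual_basis big_map big_enum /=.
pose h (u : g (- j)) : k^o := f (homog g u).
have hl : linear h by move=> c a b; exact: lf.
pose L : {linear g (- j) -> k^o} := HB.pack h (GRing.isLinear.Build _ _ _ _ _ hl).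
rewrite -[LHS]/(L u) [in LHS](coord_vbasis (memvf u)) linear_sum.
apply: eq_bigr => l _; rewrite linearZ /=; congr (_ * _).
by rewrite /eval /= gdual_eval_homog lfunE.
Qed.

Lemma dual_basis_tag j q : q \in dual_basis j -> tag q.1 = j.
Proof. by case/mapP => l _ ->. Qed.

(** The axioms of the dual bracket speak of functionals in g^*. As the components are
    finite-dimensional, any linear form is, on finitely many degrees, a finite combination of such
    functionals, so identities transfer to arbitrary multilinear forms on the degrees that occur in
    a cobracket. *)
Lemma dual_expansion (N : seq int) :
  exists r : seq ({i : int & gdual g i} * H), forall f, linform f ->
    forall x, tag x \in N -> f x = \sum_(q <- r) eval q.1 x * f q.2.
Proof.
exists (flatten [seq dual_basis (- n) | n <- undup N]) => f lf x xN.
rewrite big_flatten big_map /= (bigD1_seq (tag x)) ?mem_undup ?undup_uniq //=.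
rewrite -(dual_basisE lf) ?opprK // big1 ?addr0 // => n nx.
rewrite big_seq big1 // => q /dual_basis_tag e.
by rewrite eval_eq0 ?mul0r // e opprK eq_sym.
Qed.

(* A representative of the cobracket of [x]; it is not linear in [x], but its
   pairings with bilinear forms are. *)
Definition cob x : seq (H * H) := projT1 (cid (cobr_deg (tagged x))).

Lemma cob_tag x p : p \in cob x -> tag p.1 + tag p.2 = tag x.
Proof.
rewrite /cob; case: cid => s [/= hs _] /(allP hs) /eqP; exact.
Qed.

Definition cobsum x (b : H -> H -> k) : k := \sum_(p <- cob x) b p.1 p.2.

Lemma cobE x b : gbilin b -> cobr g _ (tagged x) b = cobsum x b.
Proof.
by move=> hb; rewrite /cobsum /cob; case: cid => s [/= _ ->]; rewrite /tensor_of asboolT.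
Qed.

Lemma eq_cobsum x b b' :
  (forall u v, tag u + tag v = tag x -> b u v = b' u v) -> cobsum x b = cobsum x b'.
Proof.
by move=> e; rewrite /cobsum !big_seq; apply: eq_bigr => p /cob_tag /e.
Qed.

Lemma cobsumD x b b' : cobsum x (fun u v => b u v + b' u v) = cobsum x b + cobsum x b'.
Proof. by rewrite /cobsum big_split. Qed.

Lemma cobsumZ x c b : cobsum x (fun u v => c * b u v) = c * cobsum x b.
Proof. by rewrite /cobsum mulr_sumr. Qed.

Lemma cobsumN x b : cobsum x (fun u v => - b u v) = - cobsum x b.
Proof. by rewrite /cobsum sumrN. Qed.

Lemma cobsum0 x : cobsum x (fun _ _ => 0) = 0.
Proof. by rewrite /cobsum big1. Qed.

Lemma cobsum_sum x (I : Type) (r : seq I) (b : I -> H -> H -> k) :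
  cobsum x (fun u v => \sum_(i <- r) b i u v) = \sum_(i <- r) cobsum x (b i).
Proof. by rewrite /cobsum exchange_big. Qed.

Lemma cobsum_linform b : gbilin b -> linform (cobsum^~ b).
Proof.
move=> hb i c u v; rewrite -!cobE //= linearP.
by have -> : forall (T U : gtensor g) b, (c *: T + U) b = c * T b + U b by [].
Qed.

Lemma cobsum_brH x y b : gbilin b ->
  cobsum (brH x y) b =
    cobsum y (fun u v => b (brH x u) v + (-1) ^ (tag x * tag u) * b u (brH x v))
    - (-1) ^ (tag x * tag y) *
      cobsum x (fun u v => b (brH y u) v + (-1) ^ (tag y * tag u) * b u (brH y v)).
Proof.
move=> hb; have [h1 h2] := hb.
have had z : gbilin (fun u v => b (brH z u) v + (-1) ^ (tag z * tag u) * b u (brH z v)).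
  by split=> i c u v w; rewrite brH_linearr !(h1, h2) /=; ring.
rewrite -!cobE // /brH /= cobr_cocycle.
have -> : forall c (T U : gtensor g) b, (T - c *: U) b = T b - c * U b by [].
by rewrite /= /tensor_ad_fun !asboolT.
Qed.

Lemma gdual_eval_gcast i j (e : i = j) (xi : gdual g i) x :
  gdual_eval (gcast e xi) x = gdual_eval xi x.
Proof. by case: j / e. Qed.

Lemma gdual_evalP i (c : k) (xi eta : gdual g i) x :
  gdual_eval (c *: xi + eta) x = c * gdual_eval xi x + gdual_eval eta x.
Proof.
case: (eqVneq (tag x) (- i)) => [|ne]; last by rewrite !gdual_eval0 // mulr0 addr0.
by case: x => n u /= e; subst n; rewrite !gdual_eval_homog add_lfunE scale_lfunE.
Qed.

Lemma gdual_evalZ i (c : k) (xi : gdual g i) x :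
  gdual_eval (c *: xi) x = c * gdual_eval xi x.
Proof.
have h0 : gdual_eval (0 : gdual g i) x = 0.
  by have := gdual_evalP (-1) 0 (0 : gdual g i) x; rewrite scaler0 addr0 mulN1r addNr.
by rewrite -[c *: xi]addr0 gdual_evalP h0 addr0.
Qed.

Lemma gdual_evalD i (xi eta : gdual g i) x :
  gdual_eval (xi + eta) x = gdual_eval xi x + gdual_eval eta x.
Proof. by rewrite -[xi]scale1r gdual_evalP scale1r mul1r. Qed.

Lemma eval_dual_br i j (xi : gdual g i) (eta : gdual g j) x :
  gdual_eval (dual_br (cobr g) xi eta) x =
    cobsum x (fun u v => gdual_eval xi u * gdual_eval eta v).
Proof.
case: (eqVneq (tag x) (- (i + j))) => [|ne].
  case: x => n u /= e; subst n.
  by rewrite gdual_eval_homog dual_brE -(@cobE (homog g u)) //; exact: gbilin_gdual.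
rewrite gdual_eval0 // -(cobsum0 x); apply: eq_cobsum => u v e.
case: (eqVneq (tag u) (- i)) => [eu|nu]; last by rewrite gdual_eval0 // mul0r.
rewrite (_ : gdual_eval eta v = 0) ?mulr0 // gdual_eval0 //.
by apply: contraNneq ne => ev; rewrite -e eu ev opprD.
Qed.

(** The sign (-1)^(i j) of the dual bracket turns into one in u and v, because only u of degree -j
    and v of degree -i contribute. *)
Lemma cobsum_anti_eval x xi eta :
  cobsum x (fun u v => eval xi u * eval eta v) =
    - cobsum x (fun u v => (-1) ^ (tag u * tag v) * (eval xi v * eval eta u)).
Proof.
case: xi eta => i xi [j eta]; rewrite /eval /= -eval_dual_br.
rewrite (glie_anti (cobr_lie g)) -scaleNr gdual_evalZ gdual_eval_gcast eval_dual_br mulNr.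
congr (- _); rewrite -cobsumZ; apply: eq_cobsum => u v _.
case: (eqVneq (tag u) (- j)) => [->|nu]; last by rewrite (gdual_eval0 _ nu) !(mul0r, mulr0).
case: (eqVneq (tag v) (- i)) => [->|nv]; last by rewrite (gdual_eval0 _ nv) !(mul0r, mulr0).
by signs.
Qed.

(** On the degrees present in [cob x] the form b is a finite combination of products of functionals,
    for which the claim is the antisymmetry of the dual bracket. *)
Lemma cobsum_anti x b : gbilin b ->
  cobsum x b = - cobsum x (fun u v => (-1) ^ (tag u * tag v) * b v u).
Proof.
move=> /gbilinP[h1 h2].
have [r hr] := dual_expansion
  ([seq tag p.1 | p : H * H <- cob x] ++ [seq tag p.2 | p : H * H <- cob x]).
pose e (q q' : {i : int & gdual g i} * H) u v := eval q.1 u * eval q'.1 v.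
have E u v : u \in [seq p.1 | p <- cob x] ++ [seq p.2 | p <- cob x] ->
    v \in [seq p.1 | p <- cob x] ++ [seq p.2 | p <- cob x] ->
    b u v = \sum_(q <- r) \sum_(q' <- r) b q.2 q'.2 * e q q' u v.
  have T w : w \in [seq p.1 | p <- cob x] ++ [seq p.2 | p <- cob x] ->
      tag w \in [seq tag p.1 | p : H * H <- cob x] ++ [seq tag p.2 | p : H * H <- cob x].
    rewrite !mem_cat; case/orP => /mapP[p pc ->]; apply/orP; [left|right];
      by apply/mapP; exists p.
  move=> /T tu /T tv; rewrite (hr (b^~ v)) //; apply: eq_bigr => q _.
  rewrite (hr (b q.2)) // mulr_sumr; apply: eq_bigr => q' _.
  by rewrite /e; ring.
have L p : p \in cob x -> p.1 \in [seq p.1 | p <- cob x] ++ [seq p.2 | p <- cob x].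
  by move=> pc; rewrite mem_cat map_f.
have R p : p \in cob x -> p.2 \in [seq p.1 | p <- cob x] ++ [seq p.2 | p <- cob x].
  by move=> pc; rewrite mem_cat map_f ?orbT.
have -> : cobsum x b = cobsum x (fun u v => \sum_(q <- r) \sum_(q' <- r) b q.2 q'.2 * e q q' u v).
  by rewrite /cobsum !big_seq; apply: eq_bigr => p pc; rewrite E ?L ?R.
have -> : cobsum x (fun u v => (-1) ^ (tag u * tag v) * b v u) =
  cobsum x (fun u v => \sum_(q <- r) \sum_(q' <- r)
     b q.2 q'.2 * ((-1) ^ (tag u * tag v) * e q q' v u)).
  rewrite /cobsum !big_seq; apply: eq_bigr => p pc; rewrite E ?L ?R // mulr_sumr.
  by apply: eq_bigr => q _; rewrite mulr_sumr; apply: eq_bigr => q' _; ring.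
rewrite !cobsum_sum -sumrN; apply: eq_bigr => q _.
rewrite !cobsum_sum -sumrN; apply: eq_bigr => q' _.
by rewrite !cobsumZ cobsum_anti_eval mulrN.
Qed.

Definition trilin (c : H -> H -> H -> k) := [/\ forall v w, linform (fun u => c u v w),
  forall u w, linform (fun v => c u v w) & forall u v, linform (c u v)].

Lemma cobsum_jacobi_eval x xi eta zeta :
  cobsum x (fun u v => cobsum v (fun a b => eval xi u * eval eta a * eval zeta b)) =
    cobsum x (fun u v => cobsum u (fun a b => eval xi a * eval eta b * eval zeta v)) +
    cobsum x (fun u v => cobsum v (fun a b =>
      (-1) ^ (tag u * tag a) * (eval xi a * eval eta u * eval zeta b))).
Proof.
case: xi eta zeta => i xi [j eta] [l zeta]; rewrite /eval /=.
have := congr1 (fun w => gdual_eval w x) (glie_jacobi (cobr_lie g) xi eta zeta).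
rewrite gdual_evalD gdual_evalZ !gdual_eval_gcast !eval_dual_br.
rewrite -cobsumZ => J; transitivity (cobsum x (fun u v =>
  gdual_eval xi u * gdual_eval (dual_br (cobr g) eta zeta) v)).
  apply: eq_cobsum => u v _; rewrite eval_dual_br -cobsumZ.
  by apply: eq_cobsum => a b _; ring.
rewrite J; congr (_ + _); apply: eq_cobsum => u v _.
  by rewrite eval_dual_br mulrC -cobsumZ; apply: eq_cobsum => a b _; ring.
rewrite eval_dual_br mulrA -cobsumZ; apply: eq_cobsum => a b _.
case: (eqVneq (tag u) (- j)) => [->|nu]; last by rewrite (gdual_eval0 _ nu) !(mul0r, mulr0).
case: (eqVneq (tag a) (- i)) => [->|na]; last by rewrite (gdual_eval0 _ na) !(mul0r, mulr0).
by signs.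
Qed.

(** As for antisymmetry: expand c in products of three functionals and use the Jacobi identity of
    the dual bracket on each. *)
Lemma cobsum_jacobi x (c : H -> H -> H -> k) : trilin c ->
  cobsum x (fun u v => cobsum v (fun a b => c u a b)) =
    cobsum x (fun u v => cobsum u (fun a b => c a b v)) +
    cobsum x (fun u v => cobsum v (fun a b => (-1) ^ (tag u * tag a) * c a u b)).
Proof.
case=> h1 h2 h3.
pose S (z : H) := [seq tag p.1 | p : H * H <- cob z] ++ [seq tag p.2 | p : H * H <- cob z].
(* All degrees that occur in the cobracket of x or in the cobracket of one of its factors. *)
pose N := S x ++ flatten [seq S p.1 ++ S p.2 | p : H * H <- cob x].
have [r hr] := dual_expansion N.
pose e (q q' q'' : {i : int & gdual g i} * H) u v w :=
  eval q.1 u * eval q'.1 v * eval q''.1 w.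
have E u v w : tag u \in N -> tag v \in N -> tag w \in N ->
    c u v w = \sum_(q <- r) \sum_(q' <- r) \sum_(q'' <- r)
       c q.2 q'.2 q''.2 * e q q' q'' u v w.
  move=> tu tv tw; rewrite (hr (fun u => c u v w)) //; apply: eq_bigr => q _.
  rewrite (hr (fun v => c q.2 v w)) // mulr_sumr; apply: eq_bigr => q' _.
  rewrite (hr (c q.2 q'.2)) // !mulr_sumr; apply: eq_bigr => q'' _.
  by rewrite /e; ring.
have S1 p : p \in cob x -> tag p.1 \in N.
  by move=> pc; rewrite !mem_cat (map_f (fun p => tag p.1) pc) ?orbT.
have S2 p : p \in cob x -> tag p.2 \in N.
  by move=> pc; rewrite !mem_cat (map_f (fun p => tag p.2) pc) ?orbT.
have SS p n : p \in cob x -> n \in S p.1 ++ S p.2 -> n \in N.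
  move=> pc np; rewrite mem_cat; apply/orP; right; apply/flattenP.
  by exists (S p.1 ++ S p.2) => //; exact: (map_f (fun p => S p.1 ++ S p.2)).
have S11 p q : p \in cob x -> q \in cob p.1 -> tag q.1 \in N.
  by move=> pc qc; apply: (SS p) => //; rewrite !mem_cat (map_f (fun p => tag p.1) qc) ?orbT.
have S12 p q : p \in cob x -> q \in cob p.1 -> tag q.2 \in N.
  by move=> pc qc; apply: (SS p) => //; rewrite !mem_cat (map_f (fun p => tag p.2) qc) ?orbT.
have S21 p q : p \in cob x -> q \in cob p.2 -> tag q.1 \in N.
  by move=> pc qc; apply: (SS p) => //; rewrite !mem_cat (map_f (fun p => tag p.1) qc) ?orbT.
have S22 p q : p \in cob x -> q \in cob p.2 -> tag q.2 \in N.
  by move=> pc qc; apply: (SS p) => //; rewrite !mem_cat (map_f (fun p => tag p.2) qc) ?orbT.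
pose W (f : _ -> _ -> _ -> k) :=
  \sum_(q <- r) \sum_(q' <- r) \sum_(q'' <- r) c q.2 q'.2 q''.2 * f q q' q''.
have -> : cobsum x (fun u v => cobsum v (fun a b => c u a b)) =
  W (fun q q' q'' => cobsum x (fun u v => cobsum v (fun a b => e q q' q'' u a b))).
  transitivity (cobsum x (fun u v => cobsum v (fun a b =>
     \sum_(q <- r) \sum_(q' <- r) \sum_(q'' <- r) c q.2 q'.2 q''.2 * e q q' q'' u a b))).
    rewrite /cobsum !big_seq; apply: eq_bigr => p pc; rewrite !big_seq.
    by apply: eq_bigr => p' pc'; apply: E;
      [exact: (S1 _ pc)|exact: (S21 _ _ pc pc')|exact: (S22 _ _ pc pc')].
  under eq_cobsum => u v _ do rewrite cobsum_sum.
  rewrite cobsum_sum; apply: eq_bigr => q _; under eq_cobsum => u v _ do rewrite cobsum_sum.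
  rewrite cobsum_sum; apply: eq_bigr => q' _; under eq_cobsum => u v _ do rewrite cobsum_sum.
  rewrite cobsum_sum; apply: eq_bigr => q'' _; under eq_cobsum => u v _ do rewrite cobsumZ.
  by rewrite cobsumZ.
have -> : cobsum x (fun u v => cobsum u (fun a b => c a b v)) =
  W (fun q q' q'' => cobsum x (fun u v => cobsum u (fun a b => e q q' q'' a b v))).
  transitivity (cobsum x (fun u v => cobsum u (fun a b =>
     \sum_(q <- r) \sum_(q' <- r) \sum_(q'' <- r) c q.2 q'.2 q''.2 * e q q' q'' a b v))).
    rewrite /cobsum !big_seq; apply: eq_bigr => p pc; rewrite !big_seq.
    by apply: eq_bigr => p' pc'; apply: E;
      [exact: (S11 _ _ pc pc')|exact: (S12 _ _ pc pc')|exact: (S2 _ pc)].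
  under eq_cobsum => u v _ do rewrite cobsum_sum.
  rewrite cobsum_sum; apply: eq_bigr => q _; under eq_cobsum => u v _ do rewrite cobsum_sum.
  rewrite cobsum_sum; apply: eq_bigr => q' _; under eq_cobsum => u v _ do rewrite cobsum_sum.
  rewrite cobsum_sum; apply: eq_bigr => q'' _; under eq_cobsum => u v _ do rewrite cobsumZ.
  by rewrite cobsumZ.
have -> : cobsum x (fun u v => cobsum v (fun a b => (-1) ^ (tag u * tag a) * c a u b)) =
  W (fun q q' q'' => cobsum x (fun u v => cobsum v (fun a b =>
     (-1) ^ (tag u * tag a) * e q q' q'' a u b))).
  transitivity (cobsum x (fun u v => cobsum v (fun a b =>
     \sum_(q <- r) \sum_(q' <- r) \sum_(q'' <- r) c q.2 q'.2 q''.2 *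
       ((-1) ^ (tag u * tag a) * e q q' q'' a u b)))).
    rewrite /cobsum !big_seq; apply: eq_bigr => p pc; rewrite !big_seq.
    apply: eq_bigr => p' pc'; rewrite E;
      [|exact: (S21 _ _ pc pc')|exact: (S1 _ pc)|exact: (S22 _ _ pc pc')].
    rewrite mulr_sumr; apply: eq_bigr => q _; rewrite mulr_sumr; apply: eq_bigr => q' _.
    by rewrite mulr_sumr; apply: eq_bigr => q'' _; ring.
  under eq_cobsum => u v _ do rewrite cobsum_sum.
  rewrite cobsum_sum; apply: eq_bigr => q _; under eq_cobsum => u v _ do rewrite cobsum_sum.
  rewrite cobsum_sum; apply: eq_bigr => q' _; under eq_cobsum => u v _ do rewrite cobsum_sum.
  rewrite cobsum_sum; apply: eq_bigr => q'' _; under eq_cobsum => u v _ do rewrite cobsumZ.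
  by rewrite cobsumZ.
rewrite /W -big_split; apply: eq_bigr => q _; rewrite -big_split; apply: eq_bigr => q' _.
rewrite -big_split; apply: eq_bigr => q'' _ /=; rewrite -mulrDr; congr (_ * _).
exact: cobsum_jacobi_eval.
Qed.

(** * The BV operator *)

Definition csum x (f : H -> H -> C) : C := \sum_(p <- cob x) f p.1 p.2.

Lemma csumE x f s : csum x f $ s = cobsum x (fun u v => f u v $ s).
Proof. exact: sumcE. Qed.

Lemma linop_csum O x f : linop O -> O (csum x f) = csum x (fun u v => O (f u v)).
Proof. by move=> l; rewrite /csum linop_sum. Qed.

Definition qop x F : C :=
  - (2%:R^-1 *: csum x (fun u v => (-1) ^ tag u *: contract v (contract u F))).

Lemma qopE x F s :
  qop x F $ s = - (2%:R^-1 * cobsum x (fun u v => (-1) ^ tag u * F $ (u :: v :: s))).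
Proof. by rewrite /qop !cochainE csumE. Qed.

(* [ce_B] is linear only on multilinear functions, because a tensor vanishes on
   forms that are not bilinear; [bop] agrees with it there and is linear everywhere. *)
Definition bop F : C := fun s => posum (fun y t => qop y F $ t) s.

Lemma gbilin_head (e : int -> int -> k) F s : multilin F ->
  gbilin (fun u v => e (tag u) (tag v) * F $ (u :: v :: s)).
Proof.
move=> l; split=> [i c u v w|i c w u v] /=; first by rewrite head_lin //; ring.
by have := l [:: w] s i c u v => /= ->; ring.
Qed.

Lemma ce_B_bop F : symlin F -> ce_B F = bop F.
Proof.
case=> l _; apply: cochainP => s; rewrite /bop /posum /ce_B mulr_sumr -sumrN.
apply: eq_bigr => i _; rewrite cobE; last first.
  exact: (gbilin_head (fun a _ => (-1) ^ a)).
by rewrite qopE; ring.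
Qed.

Lemma oddz_cob x (u v : H) : tag u + tag v = tag x ->
  oddz (tag x) = oddz (tag u) (+) oddz (tag v).
Proof. by move=> <-; rewrite oddzD. Qed.

Lemma qop_cons x y F s : gsym F ->
  qop x F $ (y :: s) = (-1) ^ (wt1 y * tag x) * qop x (contract y F) $ s.
Proof.
move=> h; rewrite !qopE mulrN mulrCA; congr (- (_ * _)); rewrite -cobsumZ.
apply: eq_cobsum => u v /oddz_cob e.
rewrite contractE -[_ :: _ :: _ :: _]/([:: u] ++ v :: y :: s) h /= (gsym_head h u).
by signs_with e.
Qed.

Lemma bop_cons x F s : gsym F ->
  bop F $ (x :: s) = qop x F $ s + (-1) ^ wt1 x * bop (contract x F) $ s.
Proof.
move=> h; rewrite /bop posum_cons; congr (_ + _).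
rewrite -posumZ; apply: eq_posum => y t.
by rewrite (qop_cons _ _ _ h); signs.
Qed.

Lemma qop_linear x : linop (qop x).
Proof.
move=> c F G; apply: cochainP => s; rewrite !cochainE !qopE mulrN mulrCA -opprD -mulrDr.
by congr (- (_ * _)); rewrite -cobsumZ -cobsumD; apply: eq_cobsum => u v _; rewrite !cochainE; ring.
Qed.

Lemma bop_linear : linop bop.
Proof.
move=> c F G; apply: cochainP => s; rewrite !cochainE -posum_lin.
by apply: eq_posum => y t; rewrite qop_linear.
Qed.

Lemma contract_bop x F : gsym F ->
  contract x (bop F) = qop x F + (-1) ^ wt1 x *: bop (contract x F).
Proof. by move=> h; apply: cochainP => s; rewrite contractE bop_cons. Qed.

Lemma qop_lin_elt F i c (u v : g i) s : multilin F ->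
  qop (homog g (c *: u + v)) F $ s = c * qop (homog g u) F $ s + qop (homog g v) F $ s.
Proof.
move=> l; rewrite !qopE cobsum_linform; first by ring.
exact: (gbilin_head (fun a _ => (-1) ^ a)).
Qed.

Lemma csum_symlin x f : (forall u v, symlin (f u v)) -> symlin (csum x f).
Proof.
move=> h; rewrite /csum; elim: (cob x) => [|p r IH]; first by rewrite big_nil; exact: symlin0.
by rewrite big_cons; exact: symlinD.
Qed.

Lemma csum_cdeg x f n : (forall u v : H, tag u + tag v = tag x -> cdeg n (f u v)) ->
  cdeg n (csum x f).
Proof.
move=> h s ns; rewrite csumE -(cobsum0 x); apply: eq_cobsum => u v /h; exact.
Qed.

Lemma qop_symlin x F : symlin F -> symlin (qop x F).
Proof.
move=> h; apply/symlinN/symlinZ/csum_symlin => u v.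
by apply/symlinZ/contract_symlin/contract_symlin.
Qed.

Lemma cdegN p F : cdeg p F -> cdeg p (- F).
Proof. by rewrite -scaleN1r; exact: cdegZ. Qed.

Lemma cdeg_qop p x F : cdeg p F -> cdeg (p + tag x - 2) (qop x F).
Proof.
move=> h; apply/cdegN/cdegZ/csum_cdeg => u v e; apply: cdegZ.
apply: (cdeg_eq _ (cdeg_contract (cdeg_contract h))).
by rewrite -e /wt1; lia.
Qed.

Lemma bop_symlin F : symlin F -> symlin (bop F).
Proof.
move=> hF; split=> [s|s]; elim: s F hF => [|z s IH] F hF; have [l h] := hF.
- move=> t i c u v /=; rewrite !bop_cons // contract_lin_elt // bop_linear.
  by rewrite qop_lin_elt // !cochainE; rewrite /wt1 /=; ring.
- move=> t i c u v /=; rewrite !bop_cons // IH; last exact: contract_symlin.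
  by have [-> _] := qop_symlin z hF; ring.
- move=> t u v /=; have [_ hu] := contract_symlin u hF; have [_ hv] := contract_symlin v hF.
  rewrite !(bop_cons _ _ h) (bop_cons _ _ hu) (bop_cons _ _ hv) !(qop_cons _ _ _ h).
  by rewrite (contractC _ _ hF) (linopZ bop_linear) !cochainE; signs.
- move=> t u v /=; rewrite !bop_cons // IH; last exact: contract_symlin.
  by have [_ ->] := qop_symlin z hF; ring.
Qed.

Lemma cdeg_bop p F : symlin F -> cdeg p F -> cdeg (p - 1) (bop F).
Proof.
move=> hF hd s; elim: s p F hF hd => [|z s IH] p F hF hd ns.
  by rewrite /bop posum_nil.
have [_ h] := hF; rewrite (bop_cons _ _ h).
rewrite (cdeg_qop hd) ?add0r; last first.
  by apply: contraNneq ns; rewrite wt_cons => ->; apply/eqP; rewrite /wt1; lia.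
rewrite (IH (p + wt1 z)) ?mulr0 //; first exact: contract_symlin.
  exact: cdeg_contract.
by apply: contraNneq ns => e; rewrite wt_cons e; apply/eqP; lia.
Qed.

Lemma cbound_bop m F : cbound m F -> cbound m (bop F).
Proof.
move=> h s ms; rewrite /bop /posum big1 // => i _.
rewrite qopE (eq_cobsum (b' := fun _ _ => 0)) ?cobsum0 ?mulr0 ?oppr0 ?mulr0 // => u v _.
by rewrite h ?mulr0 //= size_remove // ltnW.
Qed.

Lemma qop_linop x F O s : linop O ->
  O (qop x F) $ s = - (2%:R^-1 * cobsum x (fun u v =>
      (-1) ^ tag u * O (contract v (contract u F)) $ s)).
Proof.
move=> l; rewrite /qop (linopN l) (linopZ l) (linop_csum _ _ l) !cochainE csumE.
by congr (- (_ * _)); apply: eq_cobsum => u v _; rewrite (linopZ l).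
Qed.

Lemma trilin_head (e : int -> int -> int -> k) F s : multilin F ->
  trilin (fun u v w => e (tag u) (tag v) (tag w) * F $ (u :: v :: w :: s)).
Proof.
move=> l; split=> a b i c u v /=; first by rewrite head_lin //; ring.
  by have := l [:: a] (b :: s) i c u v => /= ->; ring.
by have := l [:: a; b] s i c u v => /= ->; ring.
Qed.

(** Antisymmetry of the outer cobracket exchanges the factor that is split again, and the symmetry
    of F restores the order of the arguments. *)
Lemma cobsum_antisym_left x F s : symlin F ->
  cobsum x (fun u v => cobsum u (fun a b => (-1) ^ tag b * F $ (a :: b :: v :: s))) =
  - cobsum x (fun u v => cobsum v (fun a b => (-1) ^ tag a * F $ (u :: a :: b :: s))).
Proof.
move=> [l h]; rewrite cobsum_anti; last first.
  split=> [i c u v w|i c w u v].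
    by apply: cobsum_linform; exact: (gbilin_head (fun _ b => (-1) ^ b)).
  rewrite -cobsumZ -cobsumD; apply: eq_cobsum => a b _.
  by have := l [:: a; b] s i c u v => /= ->; ring.
congr (- _); apply: eq_cobsum => u v _; rewrite -cobsumZ.
apply: eq_cobsum => a b /oddz_cob e.
rewrite -[a :: _]/([:: a] ++ b :: u :: s) h /= (gsym_head h a).
by signs_with e.
Qed.

Hypothesis char0 : [pchar k] =i pred0.

Let two_neq0 : (2%:R : k) != 0.
Proof. by move/pcharf0P: char0 => ->. Qed.

Let three_neq0 : (3%:R : k) != 0.
Proof. by move/pcharf0P: char0 => ->. Qed.

(* Antisymmetry turns both terms on the right of the co-Jacobi identity for J into
   -J, so 3 J = 0. *)
Lemma cobsum_cojacobi x F s : symlin F ->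
  cobsum x (fun u v => cobsum v (fun a b => (-1) ^ tag a * F $ (u :: a :: b :: s))) = 0.
Proof.
move=> hF; have [l h] := hF.
have := cobsum_jacobi x (trilin_head (fun _ a _ => (-1) ^ a) s l).
rewrite cobsum_antisym_left //.
set J := cobsum x _.
have -> : cobsum x (fun u v => cobsum v (fun a b => (-1) ^ (tag u * tag a) *
   ((-1) ^ tag u * F [:: a, u, b & s]))) = - J.
  rewrite -cobsumN; apply: eq_cobsum => u v _; rewrite -cobsumN.
  by apply: eq_cobsum => a b _; rewrite (gsym_head h a); signs.
move=> e; apply: (mulfI three_neq0); rewrite mulr0.
by transitivity (J - (- J + - J)); [ring|rewrite -e subrr].
Qed.

(** Moving B past the two contractions of Q_x creates terms with an iterated cobracket of x; they
    reduce to the one sum that vanishes by [cobsum_cojacobi]. *)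
Lemma bop_qop x F s : symlin F ->
  bop (qop x F) $ s = - ((-1) ^ wt1 x * qop x (bop F) $ s).
Proof.
move=> hF; have [l h] := hF.
rewrite (qop_linop _ _ _ bop_linear) qopE.
have -> : cobsum x (fun u v => (-1) ^ tag u * bop F $ (u :: v :: s)) =
  cobsum x (fun u v => (-1) ^ tag u *
    (qop u F $ (v :: s) + (-1) ^ wt1 u * qop v (contract u F) $ s))
  - (-1) ^ wt1 x * cobsum x (fun u v => (-1) ^ tag u * bop (contract v (contract u F)) $ s).
  rewrite -cobsumZ -cobsumN -cobsumD; apply: eq_cobsum => u v /oddz_cob e.
  by rewrite !bop_cons //; [signs_with e|case: (contract_symlin u hF)].
have -> : cobsum x (fun u v => (-1) ^ tag u *
    (qop u F $ (v :: s) + (-1) ^ wt1 u * qop v (contract u F) $ s)) = 0.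
  rewrite -[RHS](_ : - (2%:R^-1 * cobsum x (fun u v => cobsum u (fun a b =>
      (-1) ^ tag b * F $ (a :: b :: v :: s))))
     + 2%:R^-1 * cobsum x (fun u v => cobsum v (fun a b =>
      (-1) ^ tag a * F $ (u :: a :: b :: s))) = 0).
    rewrite -mulrN -!cobsumZ -cobsumN -!cobsumZ -cobsumD; apply: eq_cobsum => u v _.
    rewrite !qopE -cobsumN -!cobsumZ.
    rewrite mulrDr; congr (_ + _).
      rewrite -cobsumN -cobsumZ; apply: eq_cobsum => a b /oddz_cob e; signs_with e.
    rewrite mulrA -cobsumN -cobsumZ; apply: eq_cobsum => a b _; signs.
  by rewrite cobsum_antisym_left // cobsum_cojacobi //; ring.
signs.
Qed.

(** The contraction of B^2 F is Q_x B F + e_x B Q_x F plus B^2 of the contraction of F, and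
    [bop_qop] cancels the first two terms. *)
Lemma bop_square F s : symlin F ->
  bop (bop F) $ s = 0.
Proof.
elim: s F => [|x s IH] F hF; first by rewrite /bop posum_nil.
have [_ h] := hF; have [_ hB] := bop_symlin hF.
rewrite (bop_cons _ _ hB) contract_bop // (linopD bop_linear) (linopZ bop_linear).
rewrite !cochainE (bop_qop _ _ hF) IH; last exact: contract_symlin.
signs.
Qed.

(** * The bracket *)

(* The failure of B to be a derivation.  It is locked because rewriting with the
   linearity rules would otherwise see the sum through the definition. *)
Definition dev p F G : C :=
  locked (bop (ce_mul F G) - ce_mul (bop F) G - (-1) ^ p *: ce_mul F (bop G)).

Lemma devE p F G :
  dev p F G = bop (ce_mul F G) - ce_mul (bop F) G - (-1) ^ p *: ce_mul F (bop G).
Proof. by rewrite /dev -lock. Qed.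

(* The failure of [qop x] to be a derivation. *)
Definition cross p x F G : C := locked (- (2%:R^-1 *: csum x (fun u v => (-1) ^ tag u *:
  ((-1) ^ (wt1 v * (p + wt1 u)) *: ce_mul (contract u F) (contract v G)
   + (-1) ^ (wt1 u * p) *: ce_mul (contract v F) (contract u G))))).

Lemma crossE p x F G s : cross p x F G $ s = - (2%:R^-1 * cobsum x (fun u v => (-1) ^ tag u *
  ((-1) ^ (wt1 v * (p + wt1 u)) * ce_mul (contract u F) (contract v G) $ s
   + (-1) ^ (wt1 u * p) * ce_mul (contract v F) (contract u G) $ s))).
Proof. by rewrite /cross -lock !cochainE csumE. Qed.

Lemma cross_linop p x F G O s : linop O -> O (cross p x F G) $ s =
  - (2%:R^-1 * cobsum x (fun u v => (-1) ^ tag u *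
  ((-1) ^ (wt1 v * (p + wt1 u)) * O (ce_mul (contract u F) (contract v G)) $ s
   + (-1) ^ (wt1 u * p) * O (ce_mul (contract v F) (contract u G)) $ s))).
Proof.
move=> l; rewrite /cross -lock (linopN l) (linopZ l) (linop_csum _ _ l) !cochainE csumE.
congr (- (_ * _)); apply: eq_cobsum => u v _.
by rewrite (linopZ l) (linopD l) !(linopZ l) !cochainE.
Qed.

Lemma qop_mul p x F G s : cdeg p F ->
  qop x (ce_mul F G) $ s = ce_mul (qop x F) G $ s
    + (-1) ^ (p * tag x) * ce_mul F (qop x G) $ s + cross p x F G $ s.
Proof.
move=> dF; rewrite qopE (qop_linop _ _ _ (linop_mull G)) (qop_linop _ _ _ (linop_mulr F)) crossE.
suff -> : cobsum x (fun u v => (-1) ^ tag u * ce_mul F G $ (u :: v :: s)) =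
   cobsum x (fun u v => (-1) ^ tag u * ce_mul (contract v (contract u F)) G $ s)
   + (-1) ^ (p * tag x) *
     cobsum x (fun u v => (-1) ^ tag u * ce_mul F (contract v (contract u G)) $ s)
   + cobsum x (fun u v => (-1) ^ tag u *
      ((-1) ^ (wt1 v * (p + wt1 u)) * ce_mul (contract u F) (contract v G) $ s
      + (-1) ^ (wt1 u * p) * ce_mul (contract v F) (contract u G) $ s)) by ring.
rewrite -cobsumZ -!cobsumD; apply: eq_cobsum => u v /oddz_cob e.
rewrite (mul_cons _ _ _ dF) (mul_cons _ _ _ dF) (mul_cons _ _ _ (cdeg_contract dF)).
by signs_with e.
Qed.

Lemma dev_linear p F : linop (dev p F).
Proof.
move=> c G G'; rewrite !devE !(ce_mulE, bop_linear); apply: cochainP => s.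
by rewrite !cochainE; ring.
Qed.

Lemma dev_linearl p G : linop (fun F => dev p F G).
Proof.
move=> c F F'; rewrite !devE !(ce_mulE, bop_linear); apply: cochainP => s.
by rewrite !cochainE; ring.
Qed.

Lemma dev_nil p F G : dev p F G $ [::] = 0.
Proof. by rewrite !devE !cochainE !mul_nil /bop !posum_nil mulr0 mul0r mulr0 !subr0. Qed.

Lemma dev_cons p F G x s : cdeg p F -> symlin F -> symlin G ->
  dev p F G $ (x :: s) = cross p x F G $ s + (-1) ^ wt1 x *
    (dev (p + wt1 x) (contract x F) G $ s
     + (-1) ^ (wt1 x * p) * dev p F (contract x G) $ s).
Proof.
move=> dF hF hG; have [_ sF] := hF; have [_ sG] := hG.
have [_ sFG] := mul_symlin dF hF hG.
rewrite !devE !cochainE (bop_cons _ _ sFG) (contract_mul _ _ dF).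
rewrite (mul_cons _ _ _ dF) (mul_cons _ _ _ (cdeg_bop hF dF)) !contract_bop //.
rewrite (linopD bop_linear) (linopZ bop_linear) !ce_mulE !cochainE (qop_mul _ _ _ dF).
by signs.
Qed.

Lemma contract_dev p F G x : cdeg p F -> symlin F -> symlin G ->
  contract x (dev p F G) = cross p x F G + (-1) ^ wt1 x *:
    (dev (p + wt1 x) (contract x F) G + (-1) ^ (wt1 x * p) *: dev p F (contract x G)).
Proof. by move=> *; apply: cochainP => s; rewrite contractE dev_cons. Qed.

Lemma cdeg_dev p q F G : cdeg p F -> cdeg q G -> symlin F -> symlin G ->
  cdeg (p + q - 1) (dev p F G).
Proof.
move=> dF dG hF hG; rewrite devE; apply: cdegD; last first.
  apply/cdegN/cdegZ; apply: cdeg_eq (cdeg_mul dF (cdeg_bop hG dG)); lia.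
apply: cdegD; first exact: cdeg_bop (mul_symlin dF hF hG) (cdeg_mul dF dG).
by apply: cdegN; apply: cdeg_eq (cdeg_mul (cdeg_bop hF dF) dG); lia.
Qed.

Lemma dev_symlin p F G : cdeg p F -> symlin F -> symlin G -> symlin (dev p F G).
Proof.
move=> dF hF hG; rewrite devE; apply: symlinD.
  apply: symlinD; first exact/bop_symlin/(mul_symlin dF).
  exact/symlinN/(mul_symlin (cdeg_bop hF dF))/hG/bop_symlin.
by apply/symlinN/symlinZ/(mul_symlin dF) => //; exact: bop_symlin.
Qed.

Lemma cbound_dev p m n F G : cbound m F -> cbound n G -> cbound (m + n) (dev p F G).
Proof.
move=> hF hG s ms; rewrite !devE !cochainE (cbound_bop (cbound_mul hF hG)) //.
rewrite (cbound_mul (cbound_bop hF) hG) // (cbound_mul hF (cbound_bop hG)) //.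
by rewrite mulr0 !subr0.
Qed.

Lemma mulC_cochain p q F G : cdeg p F -> cdeg q G ->
  ce_mul F G = (-1) ^ (p * q) *: ce_mul G F.
Proof. by move=> dF dG; apply: cochainP => s; rewrite cochainE; exact: ce_mulC. Qed.

Lemma mulA_cochain p q F G K : cdeg p F -> cdeg q G ->
  ce_mul F (ce_mul G K) = ce_mul (ce_mul F G) K.
Proof. by move=> dF dG; apply: cochainP => s; exact: (ce_mulA _ _ dF dG). Qed.

Lemma mulCA_cochain p q F G K : cdeg p F -> cdeg q G ->
  ce_mul F (ce_mul G K) = (-1) ^ (p * q) *: ce_mul G (ce_mul F K).
Proof.
move=> dF dG; rewrite (mulA_cochain _ dF dG) (mulC_cochain dF dG) ce_mulZl.
by rewrite (mulA_cochain _ dG dF).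
Qed.

(** Each term of [cross] contracts either argument once, and a contraction is a derivation. This is
    what makes B an operator of order two. *)
Lemma cross_mul p q x F G K s : cdeg p F -> cdeg q G ->
  cross p x F (ce_mul G K) $ s = ce_mul (cross p x F G) K $ s
    + (-1) ^ ((p + tag x) * q) * ce_mul G (cross p x F K) $ s.
Proof.
move=> dF dG; rewrite crossE (cross_linop _ _ _ _ _ (linop_mull K)).
rewrite (cross_linop _ _ _ _ _ (linop_mulr G)).
set A := cobsum x _; set B := cobsum x _; set D := cobsum x _.
suff -> : A = B + (-1) ^ ((p + tag x) * q) * D by ring.
rewrite /A /B /D -cobsumZ -cobsumD; apply: eq_cobsum => u v /oddz_cob e.
rewrite !(contract_mul _ _ dG) !ce_mulE.
rewrite !(mulA_cochain K (cdeg_contract dF) (cdeg_contract dG)).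
rewrite !(mulCA_cochain _ (cdeg_contract dF) dG) !cochainE.
by signs_with e.
Qed.

(** By [dev_cons] the contraction of [dev] is [cross] plus [dev] of contractions; [cross_mul] treats
    the former and induction the latter. *)
Lemma dev_mul p q F G K s : cdeg p F -> cdeg q G -> symlin F -> symlin G -> symlin K ->
  dev p F (ce_mul G K) $ s = ce_mul (dev p F G) K $ s
    + (-1) ^ ((p + 1) * q) * ce_mul G (dev p F K) $ s.
Proof.
elim: s p q F G K => [|x s IH] p q F G K dF dG hF hG hK.
  by rewrite dev_nil !mul_nil !dev_nil mul0r !mulr0 addr0.
have hGK := mul_symlin dG hG hK.
rewrite (dev_cons _ _ dF hF hGK) (mul_cons _ _ _ (cdeg_dev dF dG hF hG)).
rewrite (mul_cons _ _ _ dG) !(contract_dev _ dF) // (contract_mul _ _ dG).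
rewrite (linopD (@dev_linear _ _)) (linopZ (@dev_linear _ _)) !ce_mulE !cochainE.
have hxF := contract_symlin x hF; have hxG := contract_symlin x hG.
have hxK := contract_symlin x hK; have dxF := cdeg_contract (x := x) dF.
have dxG := cdeg_contract (x := x) dG.
rewrite (IH _ _ _ _ _ dxF dG) // (IH _ _ _ _ _ dF dxG) // (IH _ _ _ _ _ dF dG) //.
rewrite (cross_mul _ _ _ dF dG).
by signs.
Qed.

Lemma dev_mul_cochain p q F G K :
  cdeg p F -> cdeg q G -> symlin F -> symlin G -> symlin K ->
  dev p F (ce_mul G K) = ce_mul (dev p F G) K
    + (-1) ^ ((p + 1) * q) *: ce_mul G (dev p F K).
Proof. by move=> *; apply: cochainP => s; rewrite !cochainE; exact: dev_mul. Qed.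

Lemma dev_anti p q F G s : cdeg p F -> cdeg q G -> symlin F -> symlin G ->
  dev p F G $ s = (-1) ^ (p * q) * dev q G F $ s.
Proof.
move=> dF dG hF hG; rewrite !devE !cochainE (mulC_cochain dF dG) (linopZ bop_linear) !cochainE.
rewrite (mulC_cochain (cdeg_bop hF dF) dG) (mulC_cochain dF (cdeg_bop hG dG)) !cochainE.
by signs.
Qed.

Lemma bop_bop F : symlin F -> bop (bop F) = 0.
Proof. by move=> h; apply: cochainP => s; rewrite bop_square. Qed.

Lemma bop_mul p F G : bop (ce_mul F G) =
  dev p F G + ce_mul (bop F) G + (-1) ^ p *: ce_mul F (bop G).
Proof. by rewrite devE; apply: cochainP => s; rewrite !cochainE; ring. Qed.

(** Apply B to the definition of [dev]: by B^2 = 0 only B of products with B F or B G remains. *)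
Lemma bop_dev p F G : cdeg p F -> symlin F -> symlin G ->
  bop (dev p F G) = - dev (p - 1) (bop F) G - (-1) ^ p *: dev p F (bop G).
Proof.
move=> dF hF hG; rewrite {1}devE.
rewrite (linopD bop_linear) (linopN bop_linear) (linopD bop_linear) (linopN bop_linear).
rewrite (linopZ bop_linear) bop_bop; last exact: (mul_symlin dF).
rewrite (bop_mul (p - 1)) (bop_mul p) !bop_bop // mul0F mulF0.
by apply: cochainP => s; rewrite !cochainE; signs.
Qed.

(* Expand B applied to R(F, G K), where R is [dev], with the derivation rule
   [bop_dev] on one side and the Poisson rule [dev_mul] on the other. *)
Lemma dev_jacobi p q F G K s : cdeg p F -> cdeg q G ->
  symlin F -> symlin G -> symlin K ->
  (-1) ^ (p + q) * dev p F (dev q G K) $ s =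
    (-1) ^ (p + q - 1 + p) * dev (p + q - 1) (dev p F G) K $ s
    + (-1) ^ ((p - 1) * (q - 1)) * ((-1) ^ (p + q) * dev q G (dev p F K) $ s).
Proof.
move=> dF dG hF hG hK.
have hGK := mul_symlin dG hG hK; have hBF := bop_symlin hF.
have hBG := bop_symlin hG; have hBK := bop_symlin hK.
have dBF := cdeg_bop hF dF; have dBG := cdeg_bop hG dG.
have E1 := congr1 (fun L : C => L $ s) (bop_dev dF hF hGK).
rewrite /= !cochainE in E1.
rewrite (dev_mul_cochain dF dG hF hG hK) (dev_mul_cochain dBF dG hBF hG hK) in E1.
rewrite (bop_mul q) in E1.
rewrite !(linopD (@dev_linear _ _)) !(linopZ (@dev_linear _ _)) in E1.
rewrite (dev_mul_cochain dF dBG hF hBG hK) (dev_mul_cochain dF dG hF hG hBK) in E1.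
rewrite (linopD bop_linear) (linopZ bop_linear) (bop_mul (p + q - 1)) (bop_mul q) in E1.
rewrite !bop_dev // !ce_mulE !(linopN (@linop_mull _)) !(linopN (@linop_mulr _)) in E1.
rewrite !ce_mulE !cochainE in E1.
move/eqP: E1; rewrite -subr_eq0 => /eqP E1.
apply/eqP; rewrite -subr_eq0; apply/eqP.
(* The terms that contain B F, B G or B K cancel, and what is left of the expansion is the Jacobi
   identity up to the factor (-1)^q. *)
by rewrite -[RHS](mulr0 ((-1) ^ q)) -E1; signs.
Qed.

(** * The operator Delta *)

Lemma half_double (a : k) : 2%:R^-1 * (a + a) = a.
Proof. by rewrite -mulr2n -(mulr_natl a) mulKf. Qed.

Lemma gbilin_lie (e : int -> int -> k) F s : multilin F ->
  gbilin (fun u v => e (tag u) (tag v) * lie u (contract v F) $ s).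
Proof.
move=> l; split=> [i c u v w|i c w u v] /=.
  by rewrite lie_lin_elt; [ring|move=> ? ?; exact: (l (_ :: _))].
by rewrite contract_lin_elt // lie_linear !cochainE; ring.
Qed.

Lemma cobsum_lie_anti x F s : multilin F ->
  cobsum x (fun u v => (-1) ^ (wt1 v * tag u) * lie u (contract v F) $ s) =
  - cobsum x (fun u v => (-1) ^ tag v * lie v (contract u F) $ s).
Proof.
move=> l; rewrite cobsum_anti; last first.
  exact: (gbilin_lie (fun a b => (-1) ^ ((b - 1) * a))).
by congr (- _); apply: eq_cobsum => u v _; signs.
Qed.

(** The cocycle condition enters here. In the cobracket of [x, y] the part with ad_x cancels against
    the commutator of L_x and Q_y ([E1]). The two halves of the part with ad_y agree by antisymmetry
    ([E2]), which absorbs the factor 1/2. *)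
Lemma qop_brH x y F s : symlin F ->
  qop y (lie x F) $ s + (-1) ^ wt1 x * ((-1) ^ (wt1 y * tag x) * lie x (qop y F) $ s)
    + (-1) ^ wt1 x * qop (brH x y) F $ s =
  cobsum x (fun u v => (-1) ^ tag v * F $ (u :: brH v y :: s)).
Proof.
move=> hF; have [l h] := hF.
rewrite (qop_linop _ _ _ (lie_linear x)) !qopE (cobsum_brH x y); last first.
  exact: (gbilin_head (fun a _ => (-1) ^ a)).
pose A := cobsum y (fun u v => (-1) ^ tag u * lie x F $ (u :: v :: s)).
pose D := cobsum y (fun u v => (-1) ^ tag u * lie x (contract v (contract u F)) $ s).
pose Y := cobsum y (fun u v => (-1) ^ tag (brH x u) * F $ (brH x u :: v :: s)
  + (-1) ^ (tag x * tag u) * ((-1) ^ tag u * F $ (u :: brH x v :: s))).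
pose X1 := cobsum x (fun u v => (-1) ^ tag (brH y u) * F $ (brH y u :: v :: s)).
pose X2 := cobsum x (fun u v => (-1) ^ (tag y * tag u) * ((-1) ^ tag u * F $ (u :: brH y v :: s))).
have E1 : A = (-1) ^ (tag y * tag x) * D + (-1) ^ tag x * Y.
  rewrite /A /D /Y -!cobsumZ -cobsumD; apply: eq_cobsum => u v /oddz_cob e.
  rewrite (lie_cons _ _ _ h) lie_cons; last by case: (contract_symlin u hF).
  by rewrite contractE; signs_with e.
have E2 : X1 = X2.
  rewrite /X1 cobsum_anti; last first.
    split=> [i c u v w|i c w u v] /=.
      by rewrite brH_linearr head_lin //; rewrite /brH /=; ring.
    by have := l [:: brH y w] s i c u v => /= ->; ring.
  rewrite /X2 -cobsumN; apply: eq_cobsum => u v _.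
  by rewrite (gsym_head h (brH y v)); signs.
have E3 : cobsum x (fun u v => (-1) ^ tag v * F $ (u :: brH v y :: s)) =
    (-1) ^ wt1 x * ((-1) ^ (tag x * tag y) * X2).
  rewrite /X2 -!cobsumZ; apply: eq_cobsum => u v /oddz_cob e.
  have [lu _] := contract_symlin u hF.
  rewrite -![F (u :: _)]/(contract u F _) (brH_anti v y s lu).
  by signs_with e.
rewrite -/A -/D -/Y cobsumD -/X1 -/X2 E3 E1 E2.
transitivity ((-1) ^ wt1 x * ((-1) ^ (tag x * tag y) * (2%:R^-1 * (X2 + X2)))).
  by signs.
by rewrite half_double.
Qed.

(** Contraction by y turns the claim into [qop_brH] plus the same claim for the contraction of F. *)
Lemma bop_lie x F s : symlin F ->
  bop (lie x F) $ s + (-1) ^ wt1 x * lie x (bop F) $ s =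
  cobsum x (fun u v => (-1) ^ tag v * lie v (contract u F) $ s).
Proof.
elim: s F => [|y s IH] F hF.
  rewrite /bop /lie !posum_nil mulr0 addr0 -(cobsum0 x).
  by apply: eq_cobsum => u v _; rewrite posum_nil mulr0.
have [l h] := hF; have [_ hL] := lie_symlin x hF; have [_ hB] := bop_symlin hF.
rewrite (bop_cons _ _ hL) (lie_cons _ _ _ hB) (bop_cons _ _ h) contract_lie // contract_bop //.
rewrite (linopD bop_linear) (linopD (lie_linear x)).
rewrite (linopZ bop_linear) (linopZ (lie_linear x)) !cochainE.
transitivity (cobsum x (fun u v => (-1) ^ tag v * F $ (u :: brH v y :: s))
  + (-1) ^ wt1 y * ((-1) ^ (wt1 y * tag x) *
    cobsum x (fun u v => (-1) ^ tag v * lie v (contract u (contract y F)) $ s))).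
  rewrite -(IH _ (contract_symlin y hF)) -(qop_brH x y s hF).
  by signs.
rewrite -!cobsumZ -cobsumD; apply: eq_cobsum => u v /oddz_cob e.
rewrite lie_cons; last by case: (contract_symlin u hF).
rewrite (contractC _ _ hF) (linopZ (lie_linear v)) !cochainE contractE.
by signs_with e.
Qed.

(** On multilinear F this is the contraction i_(D x); stated as a sum of contractions it is linear
    in every F. *)
Definition theta x F : C := locked (2%:R^-1 *: csum x (fun u v => contract (brH u v) F)).

Lemma thetaE x F s :
  theta x F $ s = 2%:R^-1 * cobsum x (fun u v => F $ (brH u v :: s)).
Proof. by rewrite /theta -lock !cochainE csumE. Qed.

Lemma theta_linop x F O s : linop O -> O (theta x F) $ s =
  2%:R^-1 * cobsum x (fun u v => O (contract (brH u v) F) $ s).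
Proof. by move=> l; rewrite /theta -lock (linopZ l) (linop_csum _ _ l) !cochainE csumE. Qed.

(** Delta with [bop] in place of [ce_B]: linear on all functions, and equal to [ce_Delta] on
    multilinear symmetric ones. *)
Definition lap F : C := locked (bop (ce_d F) + ce_d (bop F)).

Lemma lapE F : lap F = bop (ce_d F) + ce_d (bop F).
Proof. by rewrite /lap -lock. Qed.

Lemma lap_linear : linop lap.
Proof.
move=> c F G; rewrite !lapE !(bop_linear, ce_d_linear); apply: cochainP => s.
by rewrite !cochainE; ring.
Qed.

Lemma lap_nil F : lap F $ [::] = 0.
Proof. by rewrite lapE !cochainE /bop posum_nil add0r /ce_d big_ord0 oppr0. Qed.

(** The commutator of B with L_x is [M] by [bop_lie]. That of Q_x with d contains two sums of Lie
    derivatives, equal by antisymmetry, and so contributes -[M] together with [T] / 2, which is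
    [theta]. *)
Lemma lap_cons x F s : symlin F ->
  lap F $ (x :: s) = lap (contract x F) $ s + theta x F $ s.
Proof.
move=> hF; have [l h] := hF; have [_ hd] := d_symlin hF; have [_ hB] := bop_symlin hF.
rewrite !lapE !cochainE (bop_cons _ _ hd) (ce_d_cons _ _ hB) contract_d // contract_bop //.
rewrite (linopD ce_d_linear) (linopZ ce_d_linear).
rewrite (linopZ bop_linear) (linopD bop_linear) !cochainE.
suff E : qop x (ce_d F) $ s + (-1) ^ wt1 x * ce_d (qop x F) $ s
   + (bop (lie x F) $ s + (-1) ^ wt1 x * lie x (bop F) $ s) = theta x F $ s.
  by rewrite -E; signs.
rewrite bop_lie // (qop_linop _ _ _ ce_d_linear) qopE thetaE.
set D := cobsum x (fun u v => _ * ce_d (contract _ _) _).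
set M := cobsum x (fun u v => _ * lie _ _ _).
set T := cobsum x (fun u v => F _).
have -> : cobsum x (fun u v => (-1) ^ tag u * ce_d F $ (u :: v :: s)) =
   - ((-1) ^ wt1 x * D) + M - T
   - cobsum x (fun u v => (-1) ^ (wt1 v * tag u) * lie u (contract v F) $ s).
  rewrite /D /M /T -cobsumZ -!cobsumN -!cobsumD; apply: eq_cobsum => u v /oddz_cob e.
  have [_ hu] := contract_symlin u hF.
  rewrite (ce_d_cons _ _ h) (ce_d_cons _ _ hu) (lie_cons _ _ _ h).
  by signs_with e.
rewrite cobsum_lie_anti // -/M.
rewrite -[X in _ + X]half_double.
by signs.
Qed.

Lemma contract_lap x F : symlin F ->
  contract x (lap F) = lap (contract x F) + theta x F.
Proof. by move=> hF; apply: cochainP => s; rewrite contractE lap_cons. Qed.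

Lemma theta_mul p x F G s : cdeg p F ->
  theta x (ce_mul F G) $ s = ce_mul (theta x F) G $ s
    + (-1) ^ (p * wt1 x) * ce_mul F (theta x G) $ s.
Proof.
move=> dF; rewrite thetaE (theta_linop _ _ _ (@linop_mull G)).
rewrite (theta_linop _ _ _ (@linop_mulr F)) mulrCA -mulrDr; congr (_ * _).
rewrite -cobsumZ -cobsumD; apply: eq_cobsum => u v /oddz_cob e.
by rewrite (mul_cons _ _ _ dF); signs_with e.
Qed.

Lemma lap_symlin F : symlin F -> symlin (lap F).
Proof.
by move=> hF; rewrite lapE; apply: symlinD; [apply/bop_symlin/d_symlin|apply/d_symlin/bop_symlin].
Qed.

Lemma cdeg_lap p F : symlin F -> cdeg p F -> cdeg p (lap F).
Proof.
move=> hF dF; rewrite lapE; apply: cdegD.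
  by apply: cdeg_eq (cdeg_bop (d_symlin hF) (cdeg_d hF dF)); lia.
by apply: cdeg_eq (cdeg_d (bop_symlin hF) (cdeg_bop hF dF)); lia.
Qed.

(** The commutator of Delta with i_x is a contraction and hence obeys the Leibniz rule
    ([theta_mul]), so the rule passes to Delta by induction on the length. *)
Lemma lap_mul p F G s : cdeg p F -> symlin F -> symlin G ->
  lap (ce_mul F G) $ s = ce_mul (lap F) G $ s + ce_mul F (lap G) $ s.
Proof.
elim: s p F G => [|x s IH] p F G dF hF hG.
  by rewrite !(mul_nil, lap_nil) mul0r mulr0 addr0.
rewrite (lap_cons _ _ (mul_symlin dF hF hG)) (mul_cons _ _ _ dF).
rewrite (mul_cons _ _ _ (cdeg_lap hF dF)) (contract_mul _ _ dF) !contract_lap //.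
rewrite (linopD lap_linear) (linopZ lap_linear) !ce_mulE !cochainE.
rewrite (IH _ _ _ (cdeg_contract dF) (contract_symlin x hF) hG).
rewrite (IH _ _ _ dF hF (contract_symlin x hG)) (theta_mul _ _ _ dF).
by signs.
Qed.

Lemma d_d F : symlin F -> ce_d (ce_d F) = 0.
Proof. by move=> h; apply: cochainP => s; rewrite d_square. Qed.

Lemma lap_d F : symlin F -> lap (ce_d F) = ce_d (lap F).
Proof.
move=> hF; rewrite !lapE (linopD ce_d_linear) !d_d ?addr0 ?add0r //.
  by rewrite (linop0 bop_linear) add0r.
exact: bop_symlin.
Qed.

Lemma lap_bop F : symlin F -> lap (bop F) = bop (lap F).
Proof.
move=> hF; rewrite !lapE (linopD bop_linear) !bop_bop ?addr0 ?add0r //.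
  by rewrite (linop0 ce_d_linear) addr0.
exact: d_symlin.
Qed.

Lemma d_bop F : ce_d (bop F) = lap F - bop (ce_d F).
Proof. by rewrite lapE addrAC subrr add0r. Qed.

Lemma d_mul_cochain p F G : cdeg p F -> symlin F -> symlin G ->
  ce_d (ce_mul F G) = ce_mul (ce_d F) G + (-1) ^ p *: ce_mul F (ce_d G).
Proof. by move=> *; apply: cochainP => s; rewrite !cochainE; exact: d_mul. Qed.

(** d is a derivation that anticommutes with B up to Delta, and the Delta terms cancel because Delta
    is a derivation too. *)
Lemma d_dev p F G s : cdeg p F -> symlin F -> symlin G ->
  ce_d (dev p F G) $ s =
    - dev (p + 1) (ce_d F) G $ s - (-1) ^ p * dev p F (ce_d G) $ s.
Proof.
move=> dF hF hG; have hBF := bop_symlin hF; have hBG := bop_symlin hG.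
rewrite !devE !(linopD ce_d_linear) !(linopN ce_d_linear).
rewrite (linopZ ce_d_linear) d_bop (d_mul_cochain dF) //.
rewrite (d_mul_cochain (cdeg_bop hF dF)) // (d_mul_cochain dF) // !d_bop.
rewrite (linopD bop_linear) (linopZ bop_linear) !ce_mulE.
rewrite !(linopN (@linop_mull _)) !(linopN (@linop_mulr _)) !cochainE.
by rewrite (lap_mul _ dF hF hG); signs.
Qed.

(** * Semisimplicity *)

(** Projection to the component of degree n. In [lap_vec] it replaces a transport along the equality
    of |x'| + |x''| with |x|. *)
Definition comp_at n (y : H) : g n := untag (0 : g n) (fun v : g n => v) y.

Lemma comp_at_homog n (v : g n) : comp_at n (homog g v) = v.
Proof. by rewrite /comp_at (untagE _ _ (erefl : tag (homog g v) = n)). Qed.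

Lemma comp_at0 n y : tag y != n -> comp_at n y = 0.
Proof. exact: untag_dflt. Qed.

Lemma homog_comp_at n y : tag y = n -> homog g (comp_at n y) = y.
Proof. by case: y => m v /= e; subst m; rewrite comp_at_homog. Qed.

Lemma comp_at_lin n i c (u v : g i) :
  comp_at n (homog g (c *: u + v)) = c *: comp_at n (homog g u) + comp_at n (homog g v).
Proof.
case: (eqVneq i n) => [e|ne]; last by rewrite !comp_at0 // scaler0 addr0.
by subst i; rewrite !comp_at_homog.
Qed.

Definition lap_vec x : g (tag x) :=
  2%:R^-1 *: \sum_(p <- cob x) comp_at (tag x) (brH p.1 p.2).

Lemma theta_lap_vec x F s : multilin F -> theta x F $ s = F $ (homog g (lap_vec x) :: s).
Proof.
move=> l; rewrite thetaE /lap_vec headZ // /cobsum; congr (_ * _).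
have E (r : seq (H * H)) : {subset r <= cob x} ->
  F $ (homog g (\sum_(p <- r) comp_at (tag x) (brH p.1 p.2)) :: s) =
  \sum_(p <- r) F $ (brH p.1 p.2 :: s).
  elim: r => [|p r IH] sub; first by rewrite !big_nil head0.
  rewrite !big_cons headD // IH => [|q qr]; last by rewrite sub // inE qr orbT.
  by rewrite homog_comp_at //; apply: cob_tag; rewrite sub ?mem_head.
by rewrite E.
Qed.

(** The representatives [cob] are not linear in their argument, so coordinates are compared: each
    one is the pairing of the cobracket with a bilinear form. *)
Lemma lap_vec_linear n : linear (fun v : g n => lap_vec (homog g v) : g n).
Proof.
move=> c u v; set b := vbasis {: g n}.
pose co (i : 'I_(\dim {: g n})) (y : H) : k := 2%:R^-1 * coord b i (comp_at n y).
have coE i w : coord b i (lap_vec (homog g w)) =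
    cobsum (homog g w) (fun a d => co i (brH a d)).
  rewrite /lap_vec linearZ /= linear_sum /cobsum mulr_sumr.
  by apply: eq_bigr => p _.
have bil i : gbilin (fun a d => co i (brH a d)).
  split=> [j e a d w|j e w a d]; rewrite ?brH_linearl ?brH_linearr /co comp_at_lin.
    by rewrite linearP /=; ring.
  by rewrite linearP /=; ring.
rewrite (coord_vbasis (memvf (lap_vec (homog g (c *: u + v))))).
rewrite [in RHS](coord_vbasis (memvf (lap_vec (homog g u)))).
rewrite [in RHS](coord_vbasis (memvf (lap_vec (homog g v)))).
rewrite scaler_sumr -big_split; apply: eq_bigr => i _ /=.
by rewrite !coE (cobsum_linform (bil i)) scalerDl scalerA.
Qed.

Definition lap_end n : 'End(g n) := linfun (fun v : g n => lap_vec (homog g v) : g n).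

Lemma lap_endE n (v : g n) : lap_end n v = lap_vec (homog g v).
Proof.
pose L : {linear g n -> g n} := HB.pack (fun v : g n => lap_vec (homog g v) : g n)
  (GRing.isLinear.Build _ _ _ _ _ (@lap_vec_linear n)).
exact: (lfunE L).
Qed.

Lemma ce_gen_symlin i (xi : gdual g i) : symlin (ce_gen xi).
Proof.
split=> [[|a s] [|b t] j c u v|[|a [|b s]] t u v] /=; rewrite ?mulr0 ?addr0 //.
- exact: gdual_eval_linear.
- by case: s => [|? ?] /=; rewrite mulr0 addr0.
- by case: s => [|? ?] /=; rewrite mulr0 addr0.
Qed.

Lemma ce_Delta_lap F : symlin F -> ce_Delta F = lap F.
Proof.
move=> h; rewrite lapE /ce_Delta !ce_B_bop //; exact: d_symlin.
Qed.

Lemma Delta_dual_lap_end i (xi : gdual g i) (v : g (- i)) :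
  Delta_dual g i xi v = xi (lap_end (- i) v).
Proof.
have := congr1 (fun f : C => f $ [:: homog g v]) (ce_Delta_gen xi).
have hx := ce_gen_symlin xi; rewrite /= gdual_eval_homog => <-.
rewrite ce_Delta_lap // lap_cons // lap_nil add0r theta_lap_vec; last by case: hx.
by rewrite /= gdual_eval_homog lap_endE.
Qed.

(** An operator and its transpose satisfy the same polynomials; coordinate functionals detect that
    the value of p at D vanishes. *)
Lemma lap_end_annihilator n :
  semisimple_end (Delta_dual g (- n)) ->
  exists2 p : {poly k}, separable_poly p & forall v, pact (lap_end n) p v = 0.
Proof.
move=> /(semisimple_annihilator char0)[p sp kp]; exists p => //.
suff : forall v, pact (lap_end (- - n)) p v = 0 by rewrite opprK.
set m := - n in kp *; move=> v.
have E (xi : gdual g m) w : pact (Delta_dual g m) p xi w = xi (pact (lap_end (- m)) p w).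
  rewrite /pact sum_lfunE linear_sum; apply: eq_bigr => i _.
  rewrite scale_lfunE linearZ; congr (_ *: _).
  elim: (nat_of_ord i) w => //= j IH w.
  by rewrite Delta_dual_lap_end // IH -iterS iterSr.
rewrite (coord_vbasis (memvf (pact _ p v))) big1 // => i _.
have := E (linfun (coord (vbasis {: g (- m)}) i : g (- m) -> k^o)) v.
by rewrite kp zero_lfunE lfunE => <-; rewrite scale0r.
Qed.

(** * Delta after extension of scalars *)

Section Twisted.
Variables (L : fieldType) (iota : {rmorphism k -> L}).
Local Notation LF := (seq H -> L^o).

(* Delta on L-valued functions: each entry x in turn is replaced by D x. *)
Fixpoint der_rec (Phi : LF) s : L^o :=
  if s is x :: s' then Phi (homog g (lap_vec x) :: s') + der_rec (fun t => Phi (x :: t)) s'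
  else 0.

Definition der (Phi : LF) : LF := der_rec Phi.

Arguments der : simpl never.

Lemma der_cons (Phi : LF) x s :
  der Phi (x :: s) = Phi (homog g (lap_vec x) :: s) + der (fun t => Phi (x :: t)) s.
Proof. by []. Qed.

Lemma der_lin (c : L) (Phi Psi : LF) : der (c *: Phi + Psi) = c *: der Phi + der Psi.
Proof.
apply/funext => s; elim: s Phi Psi => [|x s IH] Phi Psi.
  by rewrite -[RHS]/(c *: (0 : L^o) + 0) scaler0 addr0.
rewrite der_cons (IH (fun t => Phi (x :: t)) (fun t => Psi (x :: t))).
have E (A B : LF) t : (c *: A + B) t = c *: A t + B t by [].
by rewrite !E !der_cons scalerDr addrACA.
Qed.

(** These functions stand for cochains over L, linear over k through [iota]. Symmetry is not
    imposed, since singling out the first entry would destroy it. *)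
Definition twisted_multilin (Phi : LF) := forall s t i (c : k) (u v : g i),
  Phi (s ++ homog g (c *: u + v) :: t) =
    iota c *: Phi (s ++ homog g u :: t) + Phi (s ++ homog g v :: t).

Lemma twisted_multilin_lin (c : L) (Phi Psi : LF) :
  twisted_multilin Phi -> twisted_multilin Psi -> twisted_multilin (c *: Phi + Psi).
Proof.
have E (A B : LF) t : (c *: A + B) t = c *: A t + B t by [].
move=> h1 h2 s t i a u v; rewrite !E h1 h2 !scalerDr !scalerA mulrC.
by rewrite addrACA.
Qed.

Lemma twisted_multilin_cons (Phi : LF) x :
  twisted_multilin Phi -> twisted_multilin (fun t => Phi (x :: t)).
Proof. by move=> h s t i c u v; exact: (h (x :: s)). Qed.

Definition slot n (f : g n -> LF) : g n -> LF := fun v => f (lap_end n v).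

Lemma twistedE (c : L) (A B : LF) t : (c *: A + B) t = c *: A t + B t.
Proof. by []. Qed.

Lemma der_twisted_multilin (Phi : LF) : twisted_multilin Phi -> twisted_multilin (der Phi).
Proof.
move=> h s; elim: s Phi h => [|x s IH] Phi h t i c u v; rewrite ?cat_cons ?cat0s.
  rewrite !der_cons lap_vec_linear /= (h [::]).
  have -> : (fun t0 => Phi (homog g (c *: u + v) :: t0)) =
     (iota c *: (fun t0 => Phi (homog g u :: t0)) + (fun t0 => Phi (homog g v :: t0)) : LF).
    by apply/funext => t0; rewrite twistedE (h [::]).
  by rewrite der_lin twistedE scalerDr addrACA.
rewrite !der_cons (h (homog g (lap_vec x) :: s)).
rewrite (IH (fun t0 => Phi (x :: t0))); last exact: twisted_multilin_cons.
by rewrite scalerDr addrACA.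
Qed.

Definition semilin n (f : g n -> LF) :=
  forall (c : k) u v, f (c *: u + v) = iota c *: f u + f v.

(** [der] with the first entry split off as a variable: [slot] plus the action on the remaining
    entries. *)
Definition head_der n (f : g n -> LF) : g n -> LF :=
  fun v => f (lap_end n v) + der (f v).

Lemma slot_lin n (c : L) (f h : g n -> LF) :
  slot (c *: f + h) = c *: slot f + slot h.
Proof. by []. Qed.

Lemma head_der_lin n (c : L) (f h : g n -> LF) :
  head_der (c *: f + h) = c *: head_der f + head_der h.
Proof.
apply/funext => v; rewrite /head_der.
have E (A B : g n -> LF) w : (c *: A + B) w = c *: A w + B w by [].
by rewrite !E der_lin scalerDr addrACA.
Qed.

Lemma iter_der_cons n i (Psi : LF) (v : g n) s :
  iter i der Psi (homog g v :: s) =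
    iter i (@head_der n) (fun w t => Psi (homog g w :: t)) v s.
Proof.
elim: i v s => // i IH v s; rewrite !iterS der_cons -lap_endE IH /head_der.
by congr (_ + _); congr (der _ s); apply/funext => t; rewrite IH.
Qed.

Lemma pact_der_cons n q (Psi : LF) (v : g n) s :
  pact der q Psi (homog g v :: s) =
    pact (@head_der n) q (fun w t => Psi (homog g w :: t)) v s.
Proof.
rewrite /pact !fct_sumE; apply: eq_bigr => i _.
by rewrite -[LHS]/(q`_i *: iter i der Psi (homog g v :: s)) iter_der_cons.
Qed.

(** On an eigenfunction of [slot] for a, [head_der] is a plus [der] on the values. Each factor keeps
    the eigenfunction property because [slot] commutes with [der] on the values. *)
Lemma pact_head_der_eigen n (a : L) (S : seq L) (w : g n -> LF) v :
  slot w = a *: w ->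
  pact (@head_der n) (split_poly S) w v = pact der (split_poly [seq b - a | b <- S]) (w v).
Proof.
elim: S w => [|e1 S IH] w e.
  by rewrite /split_poly !big_nil !pact1.
rewrite map_cons !(pact_split_consr (@head_der_lin n), pact_split_consr der_lin).
have E (x : g n) : (head_der w - e1 *: w) x = der (w x) - (e1 - a) *: w x.
  have -> : (head_der w - e1 *: w) x = (slot w) x + der (w x) - e1 *: w x by [].
  rewrite e scalerBl opprB addrA [X in X - _]addrC.
  by have -> : (a *: w) x = a *: w x by [].
rewrite IH ?E //; apply/funext => x.
rewrite -[slot _ x]/((head_der w - e1 *: w) (lap_end n x)) E.
have ex : w (lap_end n x) = a *: w x by rewrite -[LHS]/(slot w x) e.
have d0 : der (a *: w x) = a *: der (w x).
  by have := linopZ der_lin a (w x).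
have -> : (a *: (head_der w - e1 *: w)) x = a *: ((head_der w - e1 *: w) x) by [].
by rewrite E ex d0 scalerBr !scalerA mulrC.
Qed.

Lemma split_poly_dvd (S T : seq L) : uniq S -> {subset S <= T} -> split_poly S %| split_poly T.
Proof.
move=> uS sub; apply: uniq_roots_dvdp; last by rewrite uniq_rootsE.
by apply/allP => a /sub aT; rewrite /split_poly root_prod_XsubC.
Qed.

(* Delta is the sum of the operators acting on the first entry and on the others:
   on an eigenfunction of the former for a, Delta - c acts as the latter minus c - a. *)
Lemma der_split_cons n (t : seq int) :
  (exists2 S : seq L, uniq S & forall f : g n -> LF, semilin f ->
    pact (@slot n) (split_poly S) f = 0) ->
  (exists2 S : seq L, uniq S & forall Phi : LF, twisted_multilin Phi ->
     forall s, map tag s = t -> pact der (split_poly S) Phi s = 0) ->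
  (exists2 S : seq L, uniq S & forall Phi : LF, twisted_multilin Phi ->
     forall s, map tag s = n :: t -> pact der (split_poly S) Phi s = 0).
Proof.
move=> [S1 u1 h1] [S2 u2 h2].
(* Candidates for the eigenvalues of a sum of commuting operators; removing repetitions keeps the
   polynomial separable. *)
pose S := undup [seq a + b | a <- S1, b <- S2]; exists S; first exact: undup_uniq.
move=> Phi kPhi [|[m x] s] //= [e es]; subst m.
rewrite -[existT _ _ _]/(homog g x) pact_der_cons.
set f := fun w t => Phi (homog g w :: t).
(* The eigencomponents of f must again have multilinear values, so that [h2] applies to them. *)
pose P (h : g n -> LF) := semilin h /\ forall v, twisted_multilin (h v).
have Pf : P f.
  split=> [c u v|v]; last exact: twisted_multilin_cons.
  by apply/funext => t0; rewrite twistedE /f (kPhi [::]).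
have PL (c : L) (f1 f2 : g n -> LF) : P f1 -> P f2 -> P (c *: f1 + f2).
  have E (v : g n) : (c *: f1 + f2) v = c *: f1 v + f2 v by [].
  move=> [a1 b1] [a2 b2]; split=> [d u v|v]; last by rewrite E; exact: twisted_multilin_lin.
  by rewrite !E a1 a2 !scalerDr !scalerA mulrC addrACA.
have PS (h : g n -> LF) : P h -> P (slot h).
  move=> [a b]; split=> [c u v|v]; last exact: b.
  by rewrite /slot linearP a.
have [w [fE wP]] := eigen_decomposition (@slot_lin n) PL PS u1 Pf (h1 f (proj1 Pf)).
rewrite fE.
have -> : pact (@head_der n) (split_poly S) (\sum_(a <- S1) w a) =
   \sum_(a <- S1) pact (@head_der n) (split_poly S) (w a).
  apply: (linop_sum (O := pact (@head_der n) (split_poly S))) => c u v.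
  exact: (pact_lin (@head_der_lin n)).
rewrite !fct_sumE big_seq big1 // => a aS.
have [ea [_ ka]] := wP a aS; rewrite (pact_head_der_eigen _ _ ea).
(* The list shifted by a contains [S2], as every a + b with b in [S2] is in S. *)
have /dvdpP[r ->] : split_poly S2 %| split_poly [seq b - a | b <- S].
  apply: split_poly_dvd => // b bS; apply/mapP; exists (a + b); last by rewrite addrC addKr.
  by rewrite mem_undup; apply/allpairsP; exists (a, b).
rewrite mulrC (pactM der_lin); apply: h2 => //.
apply: (pact_closed (P := twisted_multilin)) (ka x).
- by move=> s0 t0 i c u v; rewrite scaler0 addr0.
- by move=> c A B; exact: twisted_multilin_lin.
- exact: der_twisted_multilin.
Qed.

(** For semilinear f the polynomial passes inside: p(slot) f at v is f(p(D) v) = f(0) = 0. *)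
Lemma slot_killed n (p : {poly k}) (S : seq L) :
  map_poly iota p %= split_poly S -> (forall v, pact (lap_end n) p v = 0) ->
  forall f : g n -> LF, semilin f -> pact (@slot n) (split_poly S) f = 0.
Proof.
move=> pS kp f sf; apply: (pact_dvd (@slot_lin n) (p := map_poly iota p)).
  by rewrite (eqp_dvdl _ pS).
have f0 : f 0 = 0.
  by have := sf (-1) 0 0; rewrite scaler0 addr0 rmorphN1 scaleN1r addNr.
apply/funext => v; rewrite /pact fct_sumE size_map_poly -[RHS]f0 -(kp v) /pact.
have fs (r : seq 'I_(size p)) : f (\sum_(i <- r) p`_i *: iter i (lap_end n) v) =
   \sum_(i <- r) iota p`_i *: f (iter i (lap_end n) v).
  by elim: r => [|i r IH]; rewrite ?big_nil // !big_cons sf IH.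
rewrite fs; apply: eq_bigr => i _; rewrite coef_map.
rewrite -[LHS]/(iota p`_i *: (iter i (@slot n) f) v); congr (_ *: _).
have it j u : iter j (@slot n) f u = f (iter j (lap_end n) u).
  by elim: j u => //= j IH u; rewrite /slot IH -iterS iterSr.
exact: it.
Qed.

End Twisted.

Hypothesis ss : forall i : int, semisimple_end (Delta_dual g i).

Lemma iter_der_lap (L : fieldType) (iota : {rmorphism k -> L}) i F s : symlin F ->
  iter i (@der L) (fun t => iota (F $ t)) s = iota (iter i lap F $ s).
Proof.
have lapi j : symlin F -> symlin (iter j lap F).
  by move=> hF; elim: j => //= j; exact: lap_symlin.
have E G t : symlin G -> der (fun t => iota (G $ t) : L^o) t = iota (lap G $ t).
  elim: t G => [|x t IH] G hG; first by rewrite lap_nil rmorph0.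
  have [l _] := hG.
  rewrite der_cons lap_cons // theta_lap_vec // rmorphD addrC; congr (_ + _).
  by rewrite -IH //; exact: contract_symlin.
move=> hF; elim: i s => // i IH s.
rewrite !iterS -E; last exact: lapi.
by congr (der _ s); apply/funext => t; rewrite IH.
Qed.

Lemma der_split (t : seq int) :
  exists (L : fieldType) (iota : {rmorphism k -> L}) (lam : L -> k) (S : seq L),
    [/\ forall c u v, lam (iota c * u + v) = c * lam u + lam v, lam 1 = 1, uniq S &
      forall Phi : seq H -> L^o, twisted_multilin iota Phi -> forall s, map tag s = t ->
        pact (@der L) (split_poly S) Phi s = 0].
Proof.
pose pn n := s2val (cid2 (lap_end_annihilator (@ss (- n)))).
have sep n : separable_poly (pn n) by rewrite /pn; case: cid2.
have kil n v : pact (lap_end n) (pn n) v = 0 by move: v; rewrite /pn; case: cid2.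
(* One field that splits this product splits the annihilators of all entries. *)
pose p := \prod_(n <- t) pn n.
have p0 : p != 0.
  rewrite prodf_seq_neq0; apply/allP => n _ /=.
  by apply: contraTneq (sep n) => ->; rewrite unlock linear0 coprime0p eqp_sym eqp0 oner_eq0.
have [L [iota [lam [rs [prs h1 h2]]]]] := splitting_extP p0.
exists L, iota, lam.
suff [S uS h] : exists2 S : seq L, uniq S &
  forall Phi : seq H -> L^o, twisted_multilin iota Phi -> forall s, map tag s = t ->
        pact (@der L) (split_poly S) Phi s = 0 by exists S.
have pd n : n \in t -> pn n %| p.
  by move=> nt; rewrite /p (big_rem n nt) dvdp_mulr.
elim: (t) pd => [|n t' IH] pd.
  (* On the empty sequence Delta is 0, whose only eigenvalue is 0. *)
  exists [:: 0] => // Phi _ [|//] _.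
  rewrite pact_split_cons; last exact: der_lin.
  by rewrite scale0r subr0.
apply: der_split_cons; last by apply: IH => m mt; apply: pd; rewrite inE mt orbT.
have : map_poly iota (pn n) %| split_poly rs.
  by rewrite -(eqp_dvdr _ prs) dvdp_map pd ?mem_head.
(* Up to a scalar the annihilator is a product over part of the roots, which are distinct by
   separability. *)
case/dvdp_prod_XsubC => m Em; exists (mask m rs).
  by rewrite -separable_prod_XsubC -(eqp_separable Em) separable_map.
exact: slot_killed Em (kil n).
Qed.

(** Keep the nonzero elements of S and normalise to v(0) = 1; then 'X v is divisible by the
    annihilating polynomial, with 0 as a simple root. Applying [lam] to the coefficients of v gives
    Q over k, and [lam 1 = 1] preserves the constant term. *)
Lemma lap_annihilator (t : seq int) : exists Q : {poly k}, Q`_0 = 1 /\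
  forall F, symlin F -> forall s, map tag s = t -> pact lap ('X * Q) F $ s = 0.
Proof.
have [L [iota [lam [S [laml lam1 uS hS]]]]] := der_split t.
pose S' := [seq a <- S | a != 0]; pose u := split_poly S'.
have u0 : u`_0 != 0.
  rewrite -horner_coef0 /u /split_poly horner_prod prodf_seq_neq0; apply/allP => a.
  by rewrite mem_filter => /andP[a0 _] /=; rewrite hornerXsubC sub0r oppr_eq0.
pose v := (u`_0)^-1 *: u.
have v0 : v`_0 = 1 by rewrite coefZ mulVf.
exists (\poly_(i < size v) lam v`_i); split.
  rewrite coef_poly v0 lam1; case: ltnP => //; rewrite leqn0 size_poly_eq0 => /eqP ve.
  by move/eqP: v0; rewrite ve coef0 eq_sym oner_eq0.
move=> F hF s st; have hG := lap_symlin hF; set G := lap F in hG.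
rewrite pactXM; last exact: lap_linear.
rewrite -pact_iter; last exact: lap_linear.
rewrite -/G (pact_widen _ _ (size_poly _ _)) sumcE.
have lam0 : lam 0 = 0 by have := laml (-1) 0 0; rewrite mulr0 addr0 mulN1r addNr.
have /dvdpP[r rE] : split_poly S %| 'X * v.
  apply: dvdp_trans (_ : split_poly (0 :: S') %| _).
    by apply: split_poly_dvd => // a aS; rewrite inE mem_filter aS andbT; case: eqP.
  by rewrite /split_poly big_cons subr0 dvdp_mul2l ?polyX_eq0 // /v dvdpZr ?invr_eq0.
pose Phi : seq H -> L^o := fun t0 => iota (F $ t0).
have kPhi : twisted_multilin iota Phi.
  by move=> s0 t0 i c a b; rewrite /Phi; case: hF => -> _; rewrite rmorphD rmorphM.
have : pact (@der L) ('X * v) Phi s = 0.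
  rewrite rE mulrC pactM; last exact: der_lin.
  apply: hS => //; apply: (pact_closed (P := twisted_multilin iota)) kPhi.
  - by move=> s0 t0 i c a b; rewrite scaler0 addr0.
  - by move=> c A B; exact: twisted_multilin_lin.
  - exact: der_twisted_multilin.
rewrite pactXM; last exact: der_lin.
rewrite -pact_iter; last exact: der_lin.
have -> : der Phi = (fun t0 => iota (G $ t0)).
  by apply/funext => t0; exact: (iter_der_lap iota 1 t0 hF).
(* The relation is a combination over L of elements of [iota](k), so [lam] acts on the coefficients
   v_i alone. *)
move=> /(congr1 lam); rewrite lam0 /pact fct_sumE => e; rewrite -[RHS]e.
have lams (I : Type) (q : seq I) (x : I -> k) (y : I -> L) :
   lam (\sum_(i <- q) y i * iota (x i)) = \sum_(i <- q) lam (y i) * x i.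
  elim: q => [|i q IH]; first by rewrite !big_nil.
  by rewrite !big_cons mulrC laml IH mulrC.
transitivity (lam (\sum_(i < size v) v`_i * iota (iter i lap G $ s))).
  rewrite lams; apply: eq_bigr => i _; rewrite cochainE coef_poly ltn_ord.
  by [].
congr lam; apply: eq_bigr => i _.
rewrite -[RHS]/(v`_i * iter i (@der L) (fun t => iota (G $ t)) s).
by rewrite iter_der_lap.
Qed.

(** As Q(0) = 1, Q(Delta) is the identity on Delta F once Delta^2 F = 0; so Delta F agrees at s with
    Delta Q(Delta) F, which is 0 there. *)
Lemma lap_lap_eq0 F : symlin F -> lap (lap F) = 0 -> lap F = 0.
Proof.
move=> hF h; apply: cochainP => s; have [Q [Q0 hQ]] := lap_annihilator (map tag s).
rewrite zerocE -[RHS](hQ F hF s erefl) pactXM; last exact: lap_linear.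
rewrite -pact_iter; last exact: lap_linear.
have E i : (0 < i)%N -> iter i lap (lap F) = 0.
  case: i => // i _; rewrite iterSr h; elim: i => //= i ->; exact: (linop0 lap_linear).
have s0 : (0 < size Q)%N.
  by case: (posnP (size Q)) => // e; move/eqP: Q0; rewrite nth_default ?e // eq_sym oner_eq0.
rewrite /pact; case: (size Q) s0 => // n _; rewrite big_ord_recl big1 => [|i _].
  by rewrite addr0 Q0 scale1r.
by rewrite E ?scaler0.
Qed.

(** D preserves degrees. This is what allows Delta to be computed on a function that is a different
    polynomial in Delta on each degree tuple. *)
Lemma lap_local s F G : symlin F -> symlin G ->
  (forall t, map tag t = map tag s -> F $ t = G $ t) -> lap F $ s = lap G $ s.
Proof.
elim: s F G => [|x s IH] F G hF hG e; first by rewrite !lap_nil.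
have [lF _] := hF; have [lG _] := hG.
rewrite !lap_cons // !theta_lap_vec // e //; congr (_ + _).
apply: IH; try exact: contract_symlin.
by move=> t et; apply: e; rewrite /= et.
Qed.

Lemma cbound_lap m F : symlin F -> cbound m F -> cbound m (lap F).
Proof.
move=> hF b s ms; rewrite (@lap_local s F 0) //; last 2 first.
- exact: symlin0.
- by move=> t e; rewrite b // -(size_map tag) e size_map.
by rewrite (linop0 lap_linear).
Qed.

Lemma pact_lap_symlin p F : symlin F -> symlin (pact lap p F).
Proof.
move=> hF; apply: (pact_closed (P := fun G : C => symlin G)) hF; first exact: symlin0.
  by move=> c u v; exact: symlin_lin.
exact: lap_symlin.
Qed.

(* The polynomial may depend on the degrees of the entries, since Delta preserves
   them. *)
Definition assemble (A : seq int -> {poly k}) F : C :=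
  fun s => pact lap (A (map tag s)) F $ s.

Lemma assembleE (A : seq int -> {poly k}) F s :
  assemble A F $ s = pact lap (A (map tag s)) F $ s.
Proof. by []. Qed.

Definition kills s (r : {poly k}) := forall F, symlin F -> pact lap r F $ s = 0.

Lemma killsM s r q : kills s r -> kills s (r * q).
Proof.
move=> h F hF; rewrite pactM; last exact: lap_linear.
exact/h/pact_lap_symlin.
Qed.

Lemma killsB s r q : kills s r -> kills s q -> kills s (r - q).
Proof. by move=> h1 h2 F hF; rewrite pactD pactN !cochainE h1 // h2 // subr0. Qed.

(** Polynomials chosen for a degree tuple and for a permutation of it can thus be compared at the
    same sequence. *)
Lemma kills_swap s t x y r : kills (s ++ y :: x :: t) r -> kills (s ++ x :: y :: t) r.
Proof.
by move=> h F hF; have [_ ->] := pact_lap_symlin r hF; rewrite h ?mulr0.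
Qed.

(** Linearity involves a single degree tuple. Exchanging entries changes the tuple and hence the
    polynomial, so symmetry requires the difference of the two polynomials to act by 0. *)
Lemma assemble_symlin A F :
  (forall s t x y, kills (s ++ x :: y :: t)
     (A (map tag (s ++ x :: y :: t)) - A (map tag (s ++ y :: x :: t)))) ->
  symlin F -> symlin (assemble A F).
Proof.
move=> hA hF; split=> [s t i c u v|s t x y].
  rewrite !assembleE !map_cat /=.
  by have [-> _] := pact_lap_symlin (A (map tag s ++ i :: map tag t)) hF.
have := hA s t x y F hF; rewrite pactD pactN !cochainE !assembleE => /eqP.
rewrite subr_eq0 => /eqP ->.
by have [_ ->] := pact_lap_symlin (A (map tag (s ++ y :: x :: t))) hF.
Qed.

Lemma lap_assemble A F s : symlin F -> symlin (assemble A F) ->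
  lap (assemble A F) $ s = pact lap ('X * A (map tag s)) F $ s.
Proof.
move=> hF hA; rewrite pactXM; last exact: lap_linear.
apply: lap_local => //; first exact: pact_lap_symlin.
by move=> t e; rewrite assembleE e.
Qed.

Lemma assemble_cochain n A F : symlin (assemble A F) ->
  is_cochain n F -> is_cochain n (assemble A F).
Proof.
move=> hA /is_cochainP[hF dF [m bF]]; apply/is_cochainP; split=> //.
  move=> s ns; rewrite assembleE.
  have [_ ->] // : symlin F /\ cdeg n (pact lap (A (map tag s)) F).
  have : symlin (pact lap (A (map tag s)) F) /\ cdeg n (pact lap (A (map tag s)) F).
    apply: (pact_closed (P := fun G : C => symlin G /\ cdeg n G)) => //.
    - by split; [exact: symlin0|].
    - by move=> c u v [u1 u2] [v1 v2]; split; [exact: symlin_lin|exact: cdeg_lin].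
    - by move=> u [u1 u2]; split; [exact: lap_symlin|exact: cdeg_lap].
  by case.
exists m => s ms; rewrite assembleE.
have : symlin (pact lap (A (map tag s)) F) /\ cbound m (pact lap (A (map tag s)) F).
  apply: (pact_closed (P := fun G : C => symlin G /\ cbound m G)) => //.
  - by split; [exact: symlin0|].
  - move=> c u v [u1 u2] [v1 v2]; split; first exact: symlin_lin.
    by move=> t mt; rewrite !cochainE u2 // v2 // mulr0 addr0.
  - by move=> u [u1 u2]; split; [exact: lap_symlin|exact: cbound_lap].
by case=> _; exact.
Qed.

(* With Q_t(0) = 1, 'X Q_t killing the degrees t and 'X H_t = 1 - Q_t, take
   K = Q_t(Delta) F and L = 'X H_t^2 (Delta) F.  Any two choices of Q_t agree on F,
   which makes K and L symmetric. *)
Lemma lap_decomposition n F : is_cochain n F ->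
  exists K L : C, [/\ is_cochain n K, is_cochain n L, lap K = 0 & F = K + lap L].
Proof.
move=> cF; have /is_cochainP[hF _ _] := cF.
pose Q (t : seq int) := projT1 (cid (lap_annihilator t)).
have Q0 (t : seq int) : (Q t)`_0 = 1 by rewrite /Q; case: cid => ? [].
have Qk s : kills s ('X * Q (map tag s)).
  by move=> G hG; rewrite /Q; case: cid => q [_ /= ->].
have ex (t : seq int) : exists h : {poly k}, 'X * h = 1 - Q t.
  have /factor_theorem[h hE] : root (1 - Q t) 0.
    by rewrite /root horner_coef0 coefB coef1 Q0 subrr.
  by exists h; rewrite hE subr0 mulrC.
pose Hq (t : seq int) := projT1 (cid (ex t)).
have HE (t : seq int) : 'X * Hq t = 1 - Q t by rewrite /Hq; case: cid.
have Qs s t x y (s1 := s ++ x :: y :: t) (s2 := s ++ y :: x :: t) :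
    kills s1 ('X * Q (map tag s1)) /\ kills s1 ('X * Q (map tag s2)).
  by split; [exact: Qk|apply: kills_swap; exact: Qk].
have sK : symlin (assemble Q F).
  apply: assemble_symlin => // s t x y; have [h1 h2] := Qs s t x y.
  set t1 := map tag _ in h1 *; set t2 := map tag _ in h2 *.
  (* Q_1 - Q_2 = Q_1 (1 - Q_2) - Q_2 (1 - Q_1), where 1 - Q_i = 'X H_i. *)
  have -> : Q t1 - Q t2 = 'X * Q t1 * Hq t2 - 'X * Q t2 * Hq t1.
    transitivity (Q t1 * ('X * Hq t2) - Q t2 * ('X * Hq t1)); last by ring.
    by rewrite !HE; ring.
  by apply: killsB; exact: killsM.
(* On Ker Delta, H_t acts as the scalar H_t(0) = -Q_t'(0), which depends on the chosen Q_t, so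
   H_t(Delta) F need not be symmetric. The further factor 'X H_t = 1 - Q_t vanishes on Ker Delta. *)
pose A (t : seq int) := 'X * Hq t ^+ 2.
have sL : symlin (assemble A F).
  apply: assemble_symlin => // s t x y; have [h1 h2] := Qs s t x y.
  set t1 := map tag _ in h1 *; set t2 := map tag _ in h2 *.
  have -> : A t1 - A t2 = 'X * Q t2 * (Hq t1 * (Hq t1 + Hq t2))
      - 'X * Q t1 * (Hq t2 * (Hq t1 + Hq t2)).
    have e : 'X * (Hq t1 - Hq t2) = Q t2 - Q t1 by rewrite mulrBr !HE; ring.
    transitivity ('X * (Hq t1 - Hq t2) * (Hq t1 + Hq t2)); first by rewrite /A; ring.
    rewrite e; transitivity ((Q t2 * ('X * Hq t1) - Q t1 * ('X * Hq t2)) * (Hq t1 + Hq t2)).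
      by rewrite !HE; ring.
    by ring.
  by apply: killsB; exact: killsM.
exists (assemble Q F), (assemble A F); split.
- exact: assemble_cochain.
- exact: assemble_cochain.
- by apply: cochainP => s; rewrite lap_assemble // Qk.
apply: cochainP => s; rewrite cochainE lap_assemble // assembleE -cochainE -pactD.
set t := map tag s.
(* Q + (1 - Q)^2 = 1 - Q (1 - Q), and Q (1 - Q) = 'X Q H acts by 0. *)
have -> : Q t + 'X * A t = 1 - 'X * Q t * Hq t.
  transitivity (Q t + ('X * Hq t) * ('X * Hq t)); first by rewrite /A; ring.
  transitivity (1 - Q t * ('X * Hq t)); last by ring.
  by rewrite !HE; ring.
by rewrite pactD pactN pact1 !cochainE (killsM _ (Qk s)) // subr0.
Qed.

(** * The quasi-isomorphism *)

Lemma ce_bra_dev p F G : cdeg p F -> symlin F -> symlin G ->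
  ce_bra p F G = (-1) ^ p *: dev p F G.
Proof.
move=> dF hF hG; rewrite /ce_bra !ce_B_bop // ?devE //.
exact: (mul_symlin dF).
Qed.

Lemma is_cochain_symlin n F : is_cochain n F -> symlin F.
Proof. by case/is_cochainP. Qed.

Lemma is_cochain_cdeg n F : is_cochain n F -> cdeg n F.
Proof. by case/is_cochainP. Qed.
Hint Resolve is_cochain_symlin is_cochain_cdeg : core.

Lemma is_cochain0 n : is_cochain n (0 : C).
Proof. by apply/is_cochainP; split; [exact: symlin0|exact: cdeg0|exists 0%N]. Qed.

Lemma is_cochain_lin n c F G : is_cochain n F -> is_cochain n G -> is_cochain n (c *: F + G).
Proof.
move=> /is_cochainP[h1 d1 [m1 b1]] /is_cochainP[h2 d2 [m2 b2]]; apply/is_cochainP; split.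
- exact: symlin_lin.
- exact: cdeg_lin.
exists (maxn m1 m2) => s; rewrite gtn_max => /andP[s1 s2].
by rewrite !cochainE b1 // b2 // mulr0 addr0.
Qed.

Lemma is_cochainZ n c F : is_cochain n F -> is_cochain n (c *: F).
Proof. by move=> h; rewrite -[_ *: _]addr0; apply: is_cochain_lin => //; exact: is_cochain0. Qed.

Lemma is_cochain_one : is_cochain 0 (@ce_one k g).
Proof.
apply/is_cochainP; split; [exact: one_symlin|exact: cdeg_one|exists 0%N].
exact: cbound_one.
Qed.

Lemma is_cochain_mul p q F G : is_cochain p F -> is_cochain q G ->
  is_cochain (p + q) (ce_mul F G).
Proof.
move=> /is_cochainP[h1 d1 [m1 b1]] /is_cochainP[h2 d2 [m2 b2]]; apply/is_cochainP; split.
- exact: (mul_symlin d1).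
- exact: cdeg_mul.
by exists (m1 + m2)%N; exact: cbound_mul.
Qed.

Lemma is_cochain_d p F : is_cochain p F -> is_cochain (p + 1) (ce_d F).
Proof.
move=> /is_cochainP[h d [m b]]; apply/is_cochainP; split.
- exact: d_symlin.
- exact: cdeg_d.
by exists m.+1; exact: cbound_d.
Qed.

Lemma is_cochain_bop p F : is_cochain p F -> is_cochain (p - 1) (bop F).
Proof.
move=> /is_cochainP[h d [m b]]; apply/is_cochainP; split.
- exact: bop_symlin.
- exact: cdeg_bop.
by exists m; exact: cbound_bop.
Qed.

Lemma is_cochain_lap p F : is_cochain p F -> is_cochain p (lap F).
Proof.
move=> /is_cochainP[h d [m b]]; apply/is_cochainP; split.
- exact: lap_symlin.
- exact: cdeg_lap.
by exists m; exact: cbound_lap.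
Qed.

Lemma is_cochain_dev p q F G : is_cochain p F -> is_cochain q G ->
  is_cochain (p + q - 1) (dev p F G).
Proof.
move=> /is_cochainP[h1 d1 [m1 b1]] /is_cochainP[h2 d2 [m2 b2]]; apply/is_cochainP; split.
- exact: dev_symlin.
- exact: cdeg_dev.
by exists (m1 + m2)%N; exact: cbound_dev.
Qed.

Lemma ce_bra_cochain p q F G : is_cochain p F -> is_cochain q G ->
  ce_bra p F G = (-1) ^ p *: dev p F G.
Proof. by move=> hF hG; apply: ce_bra_dev; eauto. Qed.

Lemma is_cochain_bra p q F G : is_cochain p F -> is_cochain q G ->
  is_cochain (p + q - 1) (ce_bra p F G).
Proof.
move=> hF hG; rewrite (ce_bra_cochain hF hG); apply: is_cochainZ.
exact: is_cochain_dev.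
Qed.

Lemma CE_module : graded_module (CE g).
Proof. by split=> [p|p c F G]; [exact: is_cochain0|exact: is_cochain_lin]. Qed.

Lemma CE_alg : graded_comm_alg (CE g).
Proof.
split=> /=.
- exact: is_cochain_one.
- exact: is_cochain_mul.
- by move=> p q c F F' G _ _ _; exact: mul_linearl.
- by move=> p q c F G G' _ _ _; exact: mul_linearr.
- by move=> p F _; apply: cochainP => s; exact: mul1F.
- by move=> p q r F G K hF hG _; apply: mulA_cochain; eauto.
- by move=> p q F G hF hG; apply: mulC_cochain; eauto.
Qed.

Lemma CE_diff : differential (CE g).
Proof.
split=> /=.
- exact: is_cochain_d.
- by move=> p c F F' _ _; exact: ce_d_linear.
- by move=> p F hF; apply: d_d; eauto.
- by move=> p q F G hF hG; apply: d_mul_cochain; eauto.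
Qed.

Lemma CE_lie : shifted_lie (CE g).
Proof.
split=> /=.
- exact: is_cochain_bra.
- move=> p q c F F' G hF hF' hG; rewrite !(ce_bra_cochain _ hG) //; last exact: is_cochain_lin.
  rewrite (dev_linearl p G c F F'); apply: cochainP => s; rewrite !cochainE; ring.
- move=> p q c F G G' hF hG hG'; rewrite (ce_bra_cochain hF hG) (ce_bra_cochain hF hG').
  rewrite (ce_bra_cochain hF (is_cochain_lin c hG hG')) (dev_linear p F).
  by apply: cochainP => s; rewrite !cochainE; ring.
- move=> p q F G hF hG; rewrite (ce_bra_cochain hF hG) (ce_bra_cochain hG hF).
  apply: cochainP => s; rewrite !cochainE (@dev_anti p q); eauto.
  signs.
- move=> p q r F G K hF hG hK.
  rewrite (ce_bra_cochain hG hK) (ce_bra_cochain hF hK) (ce_bra_cochain hF hG).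
  rewrite (ce_bra_cochain hF (is_cochainZ _ (is_cochain_dev hG hK))).
  rewrite (ce_bra_cochain (is_cochainZ _ (is_cochain_dev hF hG)) hK).
  rewrite (ce_bra_cochain hG (is_cochainZ _ (is_cochain_dev hF hK))).
  rewrite !(linopZ (@dev_linear _ _)) (linopZ (@dev_linearl _ _)).
  apply: cochainP => s; rewrite !cochainE.
  have := dev_jacobi s (is_cochain_cdeg hF) (is_cochain_cdeg hG)
    (is_cochain_symlin hF) (is_cochain_symlin hG) (is_cochain_symlin hK).
  move=> e; rewrite mulrA [(-1) ^ p * (-1) ^ q](_ : _ = (-1) ^ (p + q)) ?e; signs.
Qed.

Lemma CE_diff_gerstenhaber : diff_gerstenhaber (CE g).
Proof.
split=> /=.
- exact: CE_module.
- exact: CE_alg.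
- exact: CE_diff.
- exact: CE_lie.
- move=> p q r F G K hF hG hK.
  rewrite (ce_bra_cochain hF (is_cochain_mul hG hK)) (ce_bra_cochain hF hG).
  rewrite (ce_bra_cochain hF hK) (dev_mul_cochain (q := q)); eauto.
  by rewrite !ce_mulE; apply: cochainP => s; rewrite !cochainE; signs.
- move=> p q F G hF hG.
  rewrite (ce_bra_cochain hF hG) (ce_bra_cochain (is_cochain_d hF) hG).
  rewrite (ce_bra_cochain hF (is_cochain_d hG)) (linopZ ce_d_linear).
  apply: cochainP => s; rewrite !cochainE (d_dev s (is_cochain_cdeg hF)); eauto.
  signs.
Qed.

Lemma ce_Delta_eq0 n F : is_cochain n F -> ce_Delta F = 0 <-> lap F = 0.
Proof. by move=> hF; rewrite ce_Delta_lap; eauto. Qed.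

(** * Cochains annihilated by Delta *)

Definition harmonic n F := is_cochain n F /\ ce_Delta F = 0.

Lemma harmonicP n F : harmonic n F <-> is_cochain n F /\ lap F = 0.
Proof. by split=> -[hF]; rewrite /harmonic (ce_Delta_eq0 hF). Qed.

Lemma harmonic_d n F : harmonic n F -> harmonic (n + 1) (ce_d F).
Proof.
move=> /harmonicP[hF e]; apply/harmonicP; split; first exact: is_cochain_d.
by rewrite lap_d ?e ?(linop0 ce_d_linear); eauto.
Qed.

Lemma harmonic_bop n F : harmonic n F -> harmonic (n - 1) (bop F).
Proof.
move=> /harmonicP[hF e]; apply/harmonicP; split; first exact: is_cochain_bop.
by rewrite lap_bop ?e ?(linop0 bop_linear); eauto.
Qed.

Lemma harmonic_mul p q F G : harmonic p F -> harmonic q G -> harmonic (p + q) (ce_mul F G).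
Proof.
move=> /harmonicP[hF eF] /harmonicP[hG eG]; apply/harmonicP; split; first exact: is_cochain_mul.
apply: cochainP => s; rewrite (lap_mul s (is_cochain_cdeg hF)); eauto.
by rewrite eF eG mul0F mulF0 addr0.
Qed.

Lemma harmonic0 n : harmonic n 0.
Proof. by apply/harmonicP; split; [exact: is_cochain0|exact: (linop0 lap_linear)]. Qed.

Lemma harmonic_lin n c F G : harmonic n F -> harmonic n G -> harmonic n (c *: F + G).
Proof.
move=> /harmonicP[hF eF] /harmonicP[hG eG]; apply/harmonicP; split; first exact: is_cochain_lin.
by rewrite lap_linear eF eG scaler0 addr0.
Qed.

Lemma harmonicZ n c F : harmonic n F -> harmonic n (c *: F).
Proof. by move=> h; rewrite -[_ *: _]addr0; apply: harmonic_lin => //; exact: harmonic0. Qed.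

Lemma harmonicB n F G : harmonic n F -> harmonic n G -> harmonic n (F - G).
Proof. by move=> hF hG; rewrite [F - G]addrC -scaleN1r; exact: harmonic_lin. Qed.

(** The bracket is built from the product and B; Delta is a derivation of the former and commutes
    with the latter. *)
Lemma harmonic_bra p q F G : harmonic p F -> harmonic q G ->
  harmonic (p + q - 1) (ce_bra p F G).
Proof.
move=> hF hG; have [cF _] := hF; have [cG _] := hG.
rewrite (ce_bra_cochain cF cG) devE; apply: harmonicZ.
have h1 := harmonic_bop (harmonic_mul hF hG).
have h2 : harmonic (p + q - 1) (ce_mul (bop F) G).
  by have := harmonic_mul (harmonic_bop hF) hG; rewrite addrAC.
have h3 : harmonic (p + q - 1) (ce_mul F (bop G)).
  by have := harmonic_mul hF (harmonic_bop hG); rewrite addrA.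
by apply: harmonicB (harmonicZ _ h3); exact: harmonicB.
Qed.

Lemma harmonic_one : harmonic 0 (@ce_one k g).
Proof.
apply/harmonicP; split; first exact: is_cochain_one.
apply: cochainP => -[|x s]; first exact: lap_nil.
have c0 : contract x (@ce_one k g) = 0 by apply: cbound0_contract; exact: cbound_one.
rewrite (lap_cons _ _ one_symlin) c0 (linop0 lap_linear) add0r.
by rewrite theta_lap_vec //; case: one_symlin.
Qed.

Lemma Ker_Delta_diff_gerstenhaber : diff_gerstenhaber (Ker_Delta g).
Proof.
have [M A D Li P Q] := CE_diff_gerstenhaber.
split.
- by split=> [p|p c F G]; [exact: harmonic0|exact: harmonic_lin].
- case: A => a1 a2 a3 a4 a5 a6 a7; split.
  + exact: harmonic_one.
  + exact: harmonic_mul.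
  + by move=> p q c F F' G [? _] [? _] [? _]; exact: (a3 p q).
  + by move=> p q c F G G' [? _] [? _] [? _]; exact: (a4 p q).
  + by move=> p F [? _]; exact: (a5 p).
  + by move=> p q r F G K [? _] [? _] [? _]; exact: (a6 p q r).
  + by move=> p q F G [? _] [? _]; exact: (a7 p q).
- case: D => a1 a2 a3 a4; split.
  + exact: harmonic_d.
  + by move=> p c F F' [? _] [? _]; exact: (a2 p).
  + by move=> p F [? _]; exact: (a3 p).
  + by move=> p q F G [? _] [? _]; exact: (a4 p q).
- case: Li => a1 a2 a3 a4 a5; split.
  + exact: harmonic_bra.
  + by move=> p q c F F' G [? _] [? _] [? _]; exact: (a2 p q).
  + by move=> p q c F G G' [? _] [? _] [? _]; exact: (a3 p q).
  + by move=> p q F G [? _] [? _]; exact: (a4 p q).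
  + by move=> p q r F G K [? _] [? _] [? _]; exact: (a5 p q r).
- by move=> p q r F G K [? _] [? _] [? _]; exact: (P p q r).
- by move=> p q F G [? _] [? _]; exact: (Q p q).
Qed.

(** Injectivity: if x - y = d(K + Delta M) with x, y, K in Ker Delta, then Delta^2 d M = 0, so Delta
    d M = 0 and x - y = d K. Surjectivity: a cocycle K + Delta L with L in Im Delta has d K = 0 and
    d L = 0, so Delta L = d B L is exact. *)
Lemma Ker_Delta_cohomology : cohomology_iso (@Ker_Delta_incl k g).
Proof.
have lapD := linopD lap_linear; have dD := linopD ce_d_linear.
have lap0 := linop0 lap_linear.
have lapl n F : is_cochain n F -> lap (lap F) = 0 -> lap F = 0.
  by move=> /is_cochain_symlin hF; exact: lap_lap_eq0.
have ld n F : is_cochain n F -> lap (ce_d F) = ce_d (lap F).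
  by move=> /is_cochain_symlin hF; exact: lap_d.
move=> p; split=> [x y [[hx ex] _] [[hy ey] _] [z hz e]|y [hy dy]].
  have [K [M [hK hM lK zE]]] := lap_decomposition hz.
  exists K; first by apply/harmonicP.
  have hdM := is_cochain_d hM; have hdK := is_cochain_d hK.
  move: e; rewrite /Ker_Delta_incl /= zE dD -(ld _ _ hM) => e.
  suff lM : lap (ce_d M) = 0 by rewrite e lM addr0.
  apply: (lapl _ _ hdM); have := congr1 lap e.
  rewrite [lap (ce_d K + _)]lapD (ld _ _ hK) lK (linop0 ce_d_linear) add0r => <-.
  have /harmonicP[_ ->] // : harmonic p (x - y) by exact: harmonicB.
have [K [M [hK hM lK yE]]] := lap_decomposition hy.
(* A second decomposition replaces M by L in Im Delta without changing Delta M; for such L, Delta d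
   L = 0 forces d L = 0. *)
have [K2 [N [_ hN lK2 ME]]] := lap_decomposition hM.
have hL := is_cochain_lap hN; set L := lap N in hL.
have lL : lap M = lap L by rewrite ME lapD lK2 add0r.
have hdL := is_cochain_d hL; have hdN := is_cochain_d hN.
have e : ce_d K + lap (ce_d L) = 0 by rewrite (ld _ _ hL) -dD -lL -yE.
have ldL : lap (ce_d L) = 0.
  apply: (lapl _ _ hdL); have := congr1 lap e.
  by rewrite lapD (ld _ _ hK) lK (linop0 ce_d_linear) add0r lap0.
have dL : ce_d L = 0 by rewrite -(ld _ _ hN); apply: (lapl _ _ hdN); rewrite (ld _ _ hN).
exists K; first by split; [apply/harmonicP|move: e; rewrite ldL addr0].
(* K - y = -Delta L = -d B L, since d L = 0. *)
exists (- bop L); first by rewrite -scaleN1r; exact/is_cochainZ/is_cochain_bop.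
rewrite /= /Ker_Delta_incl (linopN ce_d_linear) yE lL lapE dL.
by rewrite (linop0 bop_linear) add0r opprD addrA subrr add0r.
Qed.

Lemma Ker_Delta_morphism : dG_morphism (@Ker_Delta_incl k g).
Proof. by split=> // p F []. Qed.

End Calculus.

Theorem lemma3p10 (k : fieldType) (char0 : [pchar k] =i pred0)
    (g : gLieBialg k)
    (Delta_semisimple : forall i : int, semisimple_end (Delta_dual g i)) :
  dG_quasi_iso (@Ker_Delta_incl k g).
Proof.
split.
- exact: Ker_Delta_diff_gerstenhaber.
- exact: CE_diff_gerstenhaber.
- exact: Ker_Delta_morphism.
- exact: Ker_Delta_cohomology.
Qed.
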